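(* Let $\Phi:\mathbb R\times\Omega\to[0,+\infty]$ be a nonzero random symmetric convex function with $\Phi(0,\cdot)=0$ and such that $\Phi(a,\cdot),\Phi^*(a,\cdot)\in L^1$ for some constant $a>0$. Endowed with the Luxemburg norm \[ \|u\|_\Phi:=\inf\{\beta>0\mid E\Phi(|u|/\beta)\le1\}, \] $L^\Phi:=\{u\in L^1\mid\|u\|_\Phi<\infty\}$ is a Banach space. The dual of $L^\Phi$ is \[ (L^\Phi)^*=L^{\Phi^*}\oplus\mathcal M^s\oplus(L^\infty)^\perp, \] where $\mathcal M^s=\{m\in\mathcal M^{1s}\mid\sigma_\Phi(m)<\infty\}$ with $\sigma_\Phi(m):=\sup_{u\in L^\infty}\{\int_\Omega u\,dm\mid E\Phi(|u|)<\infty\}$, and $(L^\infty)^\perp$ is the annihilator of $L^\infty$ in $(L^\Phi)^*$; that is, each continuous linear functional on $L^\Phi$ has a unique representation $u\mapsto E[u\cdot y]+\int_\Omega u\,dm^s+\langle u,w\rangle$ with $y\in L^{\Phi^*}$, $m^s\in\mathcal M^s$, $w\in(L^\infty)^\perp$, and every such expression is a continuous linear functional. For any $y+m^s\in L^{\Phi^*}\oplus\mathcal M^s$, the dual norm can be expressed as \[ \|y+m^s\|_\Phi^*=\sup_{u\in L^\infty}\Big\{E[u\cdot y]+\int_\Omega u\,dm^s\ \Big|\ E\Phi(|u|)\le1\Big\}=\inf_{\beta>0}\{\beta E\Phi^*(|y|^*/\beta)+\beta\}+\sigma_\Phi(m^s), \] we have \[ \|y\|_{\Phi^*}\le\|y\|_\Phi^*\le2\|y\|_{\Phi^*}\qquad\forall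 y\in L^{\Phi^*}, \] and the dual of the closure $M^\Phi$ of $L^\infty$ in $L^\Phi$ is \[ (M^\Phi)^*=L^{\Phi^*}\oplus\mathcal M^s. \] Assume now that $\Phi(a,\cdot)\in L^1$ for all $a>0$. Then $\mathcal M^s=\{0\}$, $M^\Phi$ coincides with the Morse heart \[ \{\xi\in L^1\mid E\Phi(|\xi|/\beta)<\infty\ \ \forall\beta>0\}, \] and, in particular, $L^\Phi=M^\Phi$ if $\operatorname{dom}E\Phi:=\{u\in L^1\mid E\Phi(|u|)<\infty\}$ is a cone.
   Context: $(\Omega,\mathcal F,P)$ is a probability space, $n\ge1$, $|\cdot|$ is a norm on $\mathbb R^n$ with dual norm $|\cdot|^*$, and $L^1,L^\infty$ are the usual spaces of $\mathbb R^n$-valued random variables (real-valued when referring to $\Phi(a,\cdot)$, $\Phi^*(a,\cdot)$). ''Random convex function'' means that $\omega\mapsto\{(\xi,\alpha)\in\mathbb R^2\mid\Phi(\xi,\omega)\le\alpha\}$ is a convex-valued measurable set-valued mapping; symmetric means $\Phi(-\xi,\omega)=\Phi(\xi,\omega)$. $E\Phi(\eta)$ is shorthand for $E[\Phi(\eta(\cdot),\cdot)]$. The conjugate is $\Phi^*(\eta,\omega)=\sup_{\xi\in\mathbb R}\{\xi\eta-\Phi(\xi,\omega)\}$; $\|\cdot\|_{\Phi^*}$ and $L^{\Phi^*}$ are defined as $\|\cdot\|_\Phi$ and $L^\Phi$ with $\Phi^*$ in place of $\Phi$, that is, $\|y\|_{\Phi^*}:=\inf\{\beta>0\mid E\Phi^*(|y|/\beta)\le1\}$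 and $L^{\Phi^*}:=\{y\in L^1\mid\|y\|_{\Phi^*}<\infty\}$. $\mathcal M^1$ is the set of bounded, $P$-absolutely continuous (vanishing on $P$-null sets), finitely additive $\mathbb R^n$-valued measures on $(\Omega,\mathcal F)$. For $m\in\mathcal M^1$, $|m|^*(A):=|m^+(A)+m^-(A)|^*$ with componentwise positive and negative parts $m^\pm$. $\mathcal M^{1s}$ is the set of $m\in\mathcal M^1$ for which there is a decreasing $(A^\nu)_{\nu=1}^\infty\subset\mathcal F$ with $P(A^\nu)\searrow0$ and $|m|^*(\Omega\setminus A^\nu)=0$ for all $\nu$. For $u\in L^\infty$, $\int_\Omega u\,dm$ is the norm-continuous linear extension of $\int\sum_j\alpha^j1_{A^j}dm:=\sum_j\alpha^j\cdot m(A^j)$ from simple functions. For $u\in L^1$, let $\rho_m(u):=\sup\{\int_\Omega u'\,dm\mid u'\in L^\infty,\ |u'_j|\le|u_j|\ \forall j\}$; $\rho_m$ is a seminorm on $\operatorname{dom}\rho_m=\{u\in L^1\mid\rho_m(u)<\infty\}$, $L^\infty$ is $\rho_m$-dense there, and $\int_\Omega u\,dm$ for $u\in\operatorname{dom}\rho_m$ denotes the unique $\rho_m$-continuous linear extension of the integral from $L^\infty$. (For $m\in\mathcal M^s$ every $u\in L^\Phi$ lies in $\operatorname{dom}\rho_m$.)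
   Formalization: In the definition of ‖y‖_{Φ*} and L^{Φ*}, |y| is replaced by the dual norm |y|*; with |y| the bound ‖y‖_{Φ*} ≤ ‖y‖_Φ^* fails, e.g. for n=1, |x|=2abs(x), Φ(x)=x²/2. *)

(* Defs.v *)
From mathcomp Require Import all_boot all_order all_algebra.
From mathcomp Require Import all_classical all_reals all_analysis.
Import Order.TTheory GRing.Theory Num.Theory.
Import numFieldNormedType.Exports.

Set Implicit Arguments.
Unset Strict Implicit.
Unset Printing Implicit Defensive.

Local Open Scope classical_set_scope.
Local Open Scope ring_scope.

(* Random vectors are functions [T -> 'rV[R]_n]; the spaces [L1], [Linfty],
   [orlicz] below are sets of representatives, and two representatives denote
   the same element when they are equal almost surely. *)

Section norms.
Context {R : realType} {n : nat}.
Implicit Types (N : 'rV[R]_n -> R) (x y : 'rV[R]_n).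

Definition is_norm N : Prop :=
  [/\ forall x y, N (x + y) <= N x + N y,
      forall (c : R) x, N (c *: x) = `|c| * N x
    & forall x, N x = 0 -> x = 0].

Definition dotp x y : R := \sum_(j < n) x 0 j * y 0 j.

Definition dual_vnorm N y : R := sup [set dotp x y | x in [set x | N x <= 1]].

End norms.

(* Linear functionals on a subspace S of V are functions V -> R whose values
   outside S are irrelevant; nrm is an extended-valued seminorm that is finite
   on S. *)
Section functionals.
Context {R : realType} {V : lmodType R}.
Implicit Types (S A : set V) (nrm : V -> \bar R) (l : V -> R).

Definition linear_on S l : Prop :=
  forall (c : R) u v, S u -> S v -> l (c *: u + v) = c * l u + l v.

Definition continuous_on S nrm l : Prop :=
  forall u, S u -> forall e : R, 0 < e -> exists2 r : R, 0 < r &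
    forall v, S v -> (nrm (v - u)%R < r%:E)%E -> `|l v - l u| < e.

Definition dual_space S nrm : set (V -> R) :=
  [set l | linear_on S l /\ continuous_on S nrm l].

Definition dual_norm S nrm l : \bar R :=
  ereal_sup [set (l u)%:E | u in [set u | S u /\ (nrm u <= 1)%E]].

Definition annihilator S nrm A : set (V -> R) :=
  [set l | dual_space S nrm l /\ forall u, A u -> l u = 0].

Definition closure_in S nrm A : set V :=
  [set u | S u /\
    forall e : R, 0 < e -> exists2 v, A v & (nrm (u - v)%R < e%:E)%E].

End functionals.

Section orlicz.
Context {d : measure_display} {T : measurableType d} {R : realType}.
Variable P : probability T R.

Section integrands.
Implicit Type Phi : R -> T -> \bar R.

Definition epi Phi (w : T) : set (R^o * R^o)%type :=
  [set p | (Phi p.1 w <= p.2%:E)%E].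

(* A set-valued mapping S is measurable when {w | S w meets O} is measurable
   for every open O. *)
Definition random_convex Phi : Prop :=
  (forall w, convex_set (epi Phi w : set (convex_lmodType _))) /\
  (forall O : set (R^o * R^o)%type, open O ->
     measurable [set w | (epi Phi w `&` O) !=set0]).

Definition conjugate Phi : R -> T -> \bar R := fun eta w =>
  ereal_sup (range (fun xi : R => (xi * eta)%:E - Phi xi w)%E).

Definition Efun Phi (eta : T -> R) : \bar R := (\int[P]_w Phi (eta w) w)%E.

End integrands.

Context {n : nat}.
Implicit Types (N : 'rV[R]_n -> R) (Phi : R -> T -> \bar R).
Implicit Types (u v y : T -> 'rV[R]_n) (m : set T -> 'rV[R]_n).

Definition ae_eq_vec u v : Prop := {ae P, forall w, u w = v w}.

Definition L1 : set (T -> 'rV[R]_n) :=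
  [set u | forall j, (fun w => u w 0 j) \in Lfun P 1%E].

Definition Linfty : set (T -> 'rV[R]_n) :=
  [set u | forall j, (fun w => u w 0 j) \in Lfun P +oo%E].

Definition Linfty_norm N u : \bar R := ('N[P]_+oo [EFin \o (N \o u)])%E.

Definition is_banach (S : set (T -> 'rV[R]_n))
    (nrm : (T -> 'rV[R]_n) -> \bar R) : Prop :=
  [/\ S 0 /\ (forall (c : R) u v, S u -> S v -> S (c *: u + v)),
      (forall u, S u -> (0 <= nrm u < +oo)%E) /\
      (forall u, S u -> nrm u = 0%E <-> ae_eq_vec u 0),
      forall (c : R) u, S u -> nrm (c *: u) = (`|c|%:E * nrm u)%E,
      forall u v, S u -> S v -> (nrm (u + v)%R <= nrm u + nrm v)%E
    & forall s : nat -> T -> 'rV[R]_n, (forall k, S (s k)) ->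
        (forall e : R, 0 < e -> exists k0 : nat, forall k l,
          (k0 <= k)%N -> (k0 <= l)%N -> (nrm (s k - s l)%R < e%:E)%E) ->
        exists2 u, S u & (fun k => nrm (s k - u)) @ \oo --> 0%E].

Definition luxemburg N Phi u : \bar R :=
  ereal_inf [set b%:E | b in [set b : R |
    0 < b /\ (Efun Phi (fun w => N (u w) / b)%R <= 1)%E]].

Definition orlicz N Phi : set (T -> 'rV[R]_n) :=
  [set u | L1 u /\ (luxemburg N Phi u < +oo)%E].

Definition orlicz_heart N Phi : set (T -> 'rV[R]_n) :=
  closure_in (orlicz N Phi) (luxemburg N Phi) Linfty.

Definition morse_heart N Phi : set (T -> 'rV[R]_n) :=
  [set u | L1 u /\ forall b : R, 0 < b ->
    (Efun Phi (fun w => N (u w) / b)%R < +oo)%E].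

Definition dom_E N Phi : set (T -> 'rV[R]_n) :=
  [set u | L1 u /\ (Efun Phi (N \o u) < +oo)%E].

Definition is_cone (A : set (T -> 'rV[R]_n)) : Prop :=
  forall (c : R) u, 0 < c -> A u -> A (c *: u).

(* A set function on the sigma-algebra is encoded as a function on all subsets
   of T vanishing on non-measurable ones. *)
Definition M1 : set (set T -> 'rV[R]_n) :=
  [set m | [/\ forall A, ~ measurable A -> m A = 0,
      forall A B, measurable A -> measurable B -> A `&` B = set0 ->
        m (A `|` B) = m A + m B,
      exists C : R, forall A j, measurable A -> `|m A 0 j| <= C
    & forall A, measurable A -> P A = 0%E -> m A = 0]].

(* Componentwise Jordan decomposition of a bounded finitely additive measure:
   m_j^+ A = sup {m_j B | B measurable, B included in A} and m^- = (- m)^+. *)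
Definition pos_part m : set T -> 'rV[R]_n := fun A =>
  \row_j sup [set m B 0 j | B in [set B | measurable B /\ B `<=` A]].

Definition neg_part m : set T -> 'rV[R]_n := pos_part (fun A => - m A).

Definition abs_meas N m (A : set T) : R :=
  dual_vnorm N (pos_part m A + neg_part m A).

Definition M1s N : set (set T -> 'rV[R]_n) :=
  [set m | M1 m /\ exists A : nat -> set T,
    [/\ forall k, measurable (A k), forall k, A k.+1 `<=` A k,
        P \o A @ \oo --> 0%E & forall k, abs_meas N m (~` A k) = 0]].

Definition extends_simple m (I : (T -> 'rV[R]_n) -> R) : Prop :=
  forall (k : nat) (alpha : 'I_k -> 'rV[R]_n) (A : 'I_k -> set T),
    (forall j, measurable (A j)) ->
    I (fun w => \sum_(j < k) (\1_(A j) w : R) *: alpha j) =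
    \sum_(j < k) dotp (alpha j) (m (A j)).

(* The integral over Linfty: for m in M1 the functionals in this set exist and
   agree on Linfty. *)
Definition mint_bdd N m : (T -> 'rV[R]_n) -> R :=
  xget (fun=> 0) [set I | [/\ linear_on Linfty I,
    continuous_on Linfty (Linfty_norm N) I & extends_simple m I]].

Definition rho N m u : \bar R :=
  ereal_sup [set (mint_bdd N m v)%:E | v in [set v | Linfty v /\
    forall j, {ae P, forall w, `|v w 0 j| <= `|u w 0 j|}]].

Definition dom_rho N m : set (T -> 'rV[R]_n) :=
  [set u | L1 u /\ (rho N m u < +oo)%E].

(* The extension to dom_rho: for m in M1 the functionals in this set exist and
   agree on dom_rho. *)
Definition mint N m : (T -> 'rV[R]_n) -> R :=
  xget (fun=> 0) [set J | [/\ linear_on (dom_rho N m) J,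
    continuous_on (dom_rho N m) (rho N m) J
    & forall u, Linfty u -> J u = mint_bdd N m u]].

Definition sigma N Phi m : \bar R :=
  ereal_sup [set (mint N m u)%:E | u in [set u | Linfty u /\
    (Efun Phi (N \o u) < +oo)%E]].

Definition Ms N Phi : set (set T -> 'rV[R]_n) :=
  [set m | M1s N m /\ (sigma N Phi m < +oo)%E].

Definition Edot y u : R := fine 'E_P[fun w => dotp (u w) (y w)]%E.

Definition ypair N y m u : R := Edot y u + mint N m u.

(* L^{Phi^*} is paired with L^Phi, so its elements take values in the dual of
   (R^n, N) and |y| is measured there by the dual norm.  With N instead, the
   bound luxemburg_conj y <= dual_norm y already fails for n = 1, N x = 2 |x|. *)
Definition luxemburg_conj N Phi := luxemburg (dual_vnorm N) (conjugate Phi).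

Definition orlicz_conj N Phi := orlicz (dual_vnorm N) (conjugate Phi).

End orlicz.

(* Main.v *)
(* Everything is computed with the modular E u = E[hull Phi (|u|)], where the
   lower semicontinuous hull of Phi is used because Phi itself need not be
   measurable in omega; the two give the same Luxemburg norm.

   A functional that is bounded for the Luxemburg norm restricts to L^infty,
   where it is the integral against a bounded finitely additive measure.  The
   Yosida-Hewitt decomposition splits off a density y and a singular measure m
   carried by sets B_k with P(B_k) -> 0.  Restricting u to the complement of
   B_k isolates the part E[u.y], restricting it to B_k isolates the integral
   against m, and the modular of u 1_(B_k) tends to 0: hence both parts inherit
   the bound, the decomposition is unique, and the dual norm is the sum of the
   norms of the two parts.

   What relates E[u.y] to Phi^* is the interchange of supremum and integral
   (Efun_conj_le): if E[u.y] <= c + b E u for all bounded u, then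
   E Phi^*(|y|^*/b) <= c/b.  With a Lagrange multiplier for the constraint
   E u <= 1 it yields inf_b {b E Phi^*(|y|^*/b) + b} as the norm of u |-> E[u.y].
   If every Phi(a, .) is integrable, all bounded u have finite modular, so a
   singular m with finite sigma_Phi must vanish. *)

Require Import Defs.
From HB Require Import structures.
From mathcomp Require Import all_boot all_order all_algebra.
From mathcomp Require Import all_classical all_reals all_analysis.
From mathcomp Require Import measurable_realfun ess_sup_inf ring lra.
Import Order.TTheory GRing.Theory Num.Theory.
Import numFieldNormedType.Exports.

Set Implicit Arguments.
Unset Strict Implicit.
Unset Printing Implicit Defensive.

Local Open Scope classical_set_scope.
Local Open Scope ring_scope.

(** * Norms on R^n and their duals *)

(** The measurability of [epi Phi] is tested on open sets only, so it sees the epigraph up to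
    closure, and [Efun] of a non-measurable integrand is a lower integral: monotone, but not
    additive. The hull repairs this and is tied to the integrand by [Phi (t * x) <= hull x <= Phi x]
    for [0 <= t < 1] and [0 <= x]. Each return from the hull to [Phi] therefore costs a factor
    [t < 1], which is recovered by letting [t] tend to 1.

    Both integrals against a finitely additive measure are picked by [xget]. One extension lemma,
    for linear maps that are dominated by a seminorm on a dense family, shows twice that there is
    something to pick: from simple functions to L^infty, and from L^infty to [dom_rho].

    The supremum [sigma] ranges over L^infty, whereas the dual norm ranges over L^Phi. Density of
    L^infty for [rho] does not close this gap by itself, because an approximation in [rho] does not
    control the modular; [mint_le_sigma] combines it with a truncation. *)

Section vector_norm.
Context {R : realType} {n : nat} {N : 'rV[R]_n -> R} (hN : is_norm N).
Implicit Types x y : 'rV[R]_n.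

Lemma vnormD x y : N (x + y) <= N x + N y.
Proof. by case: hN => + _ _; exact. Qed.

Lemma vnormZ c x : N (c *: x) = `|c| * N x.
Proof. by case: hN => _ + _; exact. Qed.

Lemma vnorm0 : N 0 = 0.
Proof. by rewrite -(scale0r 0) vnormZ normr0 mul0r. Qed.

Lemma vnorm_eq0 x : N x = 0 -> x = 0.
Proof. by case: hN => _ _; exact. Qed.

Lemma vnormN x : N (- x) = N x.
Proof. by rewrite -scaleN1r vnormZ normrN1 mul1r. Qed.

Lemma vnorm_ge0 x : 0 <= N x.
Proof. by have := vnormD x (- x); rewrite subrr vnorm0 vnormN; lra. Qed.

Lemma vnorm_dist x y : `|N x - N y| <= N (x - y).
Proof.
have := vnormD (x - y) y; have := vnormD (y - x) x.
rewrite !subrK -(opprB x y) vnormN ler_norml => h1 h2.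
by apply/andP; split; lra.
Qed.

Lemma vnorm_le_coord : exists2 C : R, 0 < C &
  forall x (M : R), 0 <= M -> (forall j, `|x 0 j| <= M) -> N x <= C * M.
Proof.
(* The summand 1 makes the constant positive in every dimension, including 0. *)
exists (1 + \sum_(j < n) N (delta_mx 0 j)).
  by rewrite ltr_pwDl// sumr_ge0// => j _; exact: vnorm_ge0.
move=> x M M0 xM; rewrite [x in N x]row_sum_delta.
rewrite mulrDl mul1r mulr_suml.
apply: (@le_trans _ _ (\sum_(j < n) N (delta_mx 0 j) * M)); last by rewrite lerDr.
have: N (\sum_j x 0 j *: delta_mx 0 j) <= \sum_j N (x 0 j *: delta_mx 0 j).
  apply: (big_ind2 (fun a b => N a <= b)) => //; first by rewrite vnorm0.
  by move=> a a' b b' ? ?; apply: (le_trans (vnormD _ _)); exact: lerD.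
move=> /le_trans; apply; apply: ler_sum => j _.
by rewrite vnormZ mulrC ler_wpM2l// vnorm_ge0.
Qed.

Lemma vnorm_continuous : continuous N.
Proof.
have [C C0 hC] := vnorm_le_coord.
move=> x; apply/(@cvgrPdist_lt _ R^o _ (nbhs x)) => e e0.
have eC0 : 0 < e / C by rewrite divr_gt0.
apply: filterS (nbhsx_ballx (x : 'rV[R]_n) _ eC0) => y.
rewrite -ball_normE /= ltr_pdivlMr// mulrC => xy.
apply: (le_lt_trans (vnorm_dist _ _)); apply: le_lt_trans xy.
apply: hC => // j.
rewrite [leRHS]/Num.norm /= mx_normrE; apply/bigmax_geP; right => /=.
by exists (0, j); rewrite ?mxE.
Qed.

(** Equivalence of norms: the continuous [N] has a positive minimum on the compact unit sphere of
    the maximum norm, and its inverse is the constant. The case of an empty sphere is dimension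
    0. *)
Lemma coord_le_vnorm : exists2 C : R, 0 < C & forall x j, `|x 0 j| <= C * N x.
Proof.
have coord_le x j : `|x 0 j| <= `|x|.
  rewrite [leRHS]/Num.norm /= mx_normrE; apply/bigmax_geP; right => /=.
  by exists (0, j).
set A := [set x : 'rV[R]_n | `|x| = 1].
have [A0|/set0P A0] := eqVneq A set0.
  exists 1 => // x j.
  have [->|x0] := eqVneq x 0; first by rewrite mxE normr0 vnorm0 mulr0.
  suff: A (`|x|^-1 *: x) by rewrite A0.
  by rewrite /A /= normrZ normfV normr_id mulVf// normr_eq0.
have cA : compact A.
  apply: bounded_closed_compact.
    by exists 1; split=> // M M1 x /= ->; exact: ltW.
  apply: (@preimage_closed _ _ (fun x : 'rV[R]_n => `|x|) [set x | x = 1]).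
    by move=> x _; exact: norm_continuous.
  exact: closed_eq.
have [c /set_mem cA1 cmin] := EVT_min_rV A0 cA
  (continuous_subspaceT vnorm_continuous).
have Nc : 0 < N c.
  rewrite lt_neqAle vnorm_ge0 andbT; apply/eqP => /esym/vnorm_eq0 c0.
  by move: cA1; rewrite /A /= c0 normr0 => /eqP; rewrite eq_sym oner_eq0.
exists (N c)^-1; first by rewrite invr_gt0.
move=> x j; apply: (le_trans (coord_le _ _)).
have [->|x0] := eqVneq x 0; first by rewrite normr0 vnorm0 mulr0.
have x0' : 0 < `|x| by rewrite normr_gt0.
have /cmin : `|x|^-1 *: x \in A.
  by apply/mem_set; rewrite /A /= normrZ normfV normr_id mulVf// normr_eq0.
rewrite vnormZ ger0_norm ?invr_ge0// => h.
by rewrite ler_pdivlMl// mulrC -ler_pdivlMl.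
Qed.

Lemma dotpDl x y z : dotp (x + y) z = dotp x z + dotp y z.
Proof. by rewrite -big_split; apply: eq_bigr => j _; rewrite mxE mulrDl. Qed.

Lemma dotpZl c x z : dotp (c *: x) z = c * dotp x z.
Proof. by rewrite mulr_sumr; apply: eq_bigr => j _; rewrite mxE mulrA. Qed.

Lemma dotpBl x y z : dotp (x - y) z = dotp x z - dotp y z.
Proof. by rewrite dotpDl -[- y]scaleN1r dotpZl mulN1r. Qed.

Lemma dotp0l z : dotp (0 : 'rV[R]_n) z = 0.
Proof. by rewrite -(scale0r 0) dotpZl mul0r. Qed.

Lemma dotp_delta a j y : dotp (a *: delta_mx 0 j) y = a * y 0 j.
Proof.
rewrite dotpZl /dotp (bigD1 j)//= big1 ?addr0 => [|i ij].
  by rewrite mxE !eqxx mul1r.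
by rewrite mxE (negbTE ij) andbF mul0r.
Qed.

Lemma dual_vnorm_has_sup y : has_sup [set dotp x y | x in [set x | N x <= 1]].
Proof.
split; first by exists (dotp 0 y); exists 0 => //=; rewrite vnorm0.
have [C C0 hC] := coord_le_vnorm.
exists (\sum_j C * `|y 0 j|) => _ [x /= x1 <-].
apply: ler_sum => j _; apply: (le_trans (ler_norm _)).
rewrite normrM ler_wpM2r//; apply: (le_trans (hC _ _)).
by rewrite ler_piMr// ltW.
Qed.

Lemma dotp_le_dual_vnorm x y : dotp x y <= N x * dual_vnorm N y.
Proof.
have [->|x0] := eqVneq x 0; first by rewrite dotp0l vnorm0 mul0r.
have Nx : 0 < N x.
  rewrite lt_neqAle vnorm_ge0 andbT eq_sym; apply: contraNneq x0.
  by move/vnorm_eq0 ->.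
rewrite mulrC -ler_pdivrMr// mulrC -dotpZl.
apply: (ub_le_sup (proj2 (dual_vnorm_has_sup y))); exists ((N x)^-1 *: x) => //=.
by rewrite vnormZ ger0_norm ?invr_ge0 ?vnorm_ge0// mulVf// gt_eqF.
Qed.

Lemma dual_vnorm_ge0 y : 0 <= dual_vnorm N y.
Proof.
apply: (ub_le_sup (proj2 (dual_vnorm_has_sup y))); exists 0 => /=.
  by rewrite vnorm0.
by rewrite dotp0l.
Qed.

Lemma dual_vnorm_approx y e : 0 < e ->
  exists2 x, N x <= 1 & dual_vnorm N y - e < dotp x y.
Proof. by move/sup_adherent => /(_ _ (dual_vnorm_has_sup y))[_ [x ? <-] ?]; exists x. Qed.

(** Pairing [y] with [y 0 j] times the j-th basis vector gives the square of [y 0 j]. *)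
Lemma dual_vnorm_eq0 y : dual_vnorm N y = 0 -> y = 0.
Proof.
move=> y0; apply/rowP => j; rewrite [RHS]mxE; apply/eqP; rewrite -sqrf_eq0.
apply/eqP/le_anti; rewrite sqr_ge0 andbT.
have := dotp_le_dual_vnorm (y 0 j *: delta_mx 0 j) y.
by rewrite y0 mulr0 dotp_delta expr2.
Qed.

Lemma dual_vnorm0 : dual_vnorm N (0 : 'rV[R]_n) = 0.
Proof.
apply/le_anti; rewrite dual_vnorm_ge0 andbT.
apply: ge_sup; first exact: (proj1 (dual_vnorm_has_sup 0)).
by move=> _ [x _ <-]; rewrite /dotp big1// => j _; rewrite mxE mulr0.
Qed.

End vector_norm.

(** * Bounded functionals on seminormed spaces *)

Section seminormed_functionals.
Context {R : realType} {V : lmodType R}.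
Implicit Types (S A : set V) (p : V -> \bar R) (l : V -> R) (u v : V).

Definition seminorm_on S p : Prop :=
  [/\ S 0, forall (c : R) u v, S u -> S v -> S (c *: u + v),
      forall u, S u -> (0 <= p u < +oo)%E,
      forall (c : R) u, S u -> p (c *: u) = (`|c|%:E * p u)%E
    & forall u v, S u -> S v -> (p (u + v)%R <= p u + p v)%E].

Definition bounded_on S p l : Prop := exists2 K : R, 0 <= K &
  forall u, S u -> (`|l u|%:E <= K%:E * p u)%E.

Section closure_properties.
Context {S} (S0 : S 0) (SZD : forall (c : R) u v, S u -> S v -> S (c *: u + v)).

Lemma linD {u v} : S u -> S v -> S (u + v).
Proof. by move=> Su Sv; have := SZD 1 Su Sv; rewrite scale1r. Qed.

Lemma linZ c {u} : S u -> S (c *: u).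
Proof. by move=> Su; have := SZD c Su S0; rewrite addr0. Qed.

Lemma linB {u v} : S u -> S v -> S (u - v).
Proof. by move=> Su Sv; have := SZD (-1) Sv Su; rewrite scaleN1r addrC. Qed.

End closure_properties.

Section linear_on_theory.
Context {S l} (ll : linear_on S l) (S0 : S 0).

Lemma linear_onD u v : S u -> S v -> l (u + v) = l u + l v.
Proof. by move=> Su Sv; have := ll 1 Su Sv; rewrite scale1r mul1r. Qed.

Lemma linear_on0 : l 0 = 0.
Proof. by have := linear_onD S0 S0; rewrite addr0 => /eqP; rewrite -subr_eq0 opprD addNKr oppr_eq0 => /eqP. Qed.

Lemma linear_onZ c u : S u -> l (c *: u) = c * l u.
Proof. by move=> Su; have := ll c Su S0; rewrite linear_on0 !addr0. Qed.

Lemma linear_onB u v : S u -> S v -> l (u - v) = l u - l v.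
Proof. by move=> Su Sv; have := ll (-1) Sv Su; rewrite scaleN1r mulN1r addrC => ->; rewrite addrC. Qed.

End linear_on_theory.

Section seminorm_theory.
Context {S p} (sp : seminorm_on S p).

Lemma seminorm_on0 : S 0. Proof. by case: sp. Qed.

Lemma seminorm_onZD c u v : S u -> S v -> S (c *: u + v).
Proof. by case: sp => _ + _ _ _; exact. Qed.

Lemma seminorm_fineK u : S u -> (fine (p u))%:E = p u.
Proof.
case: sp => _ _ h _ _ /h /andP[p0 poo].
by rewrite fineK// ge0_fin_numE.
Qed.

Lemma seminorm_fine_ge0 u : S u -> 0 <= fine (p u).
Proof. by case: sp => _ _ h _ _ /h /andP[p0 _]; exact: fine_ge0. Qed.

Lemma seminorm_fineZ c u : S u -> fine (p (c *: u)) = `|c| * fine (p u).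
Proof.
move=> Su; case: sp => _ _ _ h _; rewrite h//.
by rewrite -(seminorm_fineK Su).
Qed.

Lemma seminorm_fine0 : fine (p 0) = 0.
Proof.
by have := seminorm_fineZ 0 seminorm_on0; rewrite scale0r normr0 mul0r.
Qed.

Lemma seminorm_fineD u v : S u -> S v ->
  fine (p (u + v)) <= fine (p u) + fine (p v).
Proof.
move=> Su Sv; rewrite -lee_fin EFinD !seminorm_fineK//.
  by case: sp => _ _ _ _; exact.
exact: (linD seminorm_onZD).
Qed.

Lemma seminorm_fineN u : S u -> fine (p (- u)) = fine (p u).
Proof. by move=> Su; rewrite -scaleN1r seminorm_fineZ// normrN1 mul1r. Qed.

Lemma bounded_continuous_on l : linear_on S l -> bounded_on S p l ->
  continuous_on S p l.
Proof.
move=> ll [K K0 hK] u Su e e0.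
exists (e / (K + 1)); first by rewrite divr_gt0// ltr_wpDl.
move=> v Sv; have Svu := linB seminorm_onZD Sv Su.
rewrite -(seminorm_fineK Svu) lte_fin ltr_pdivlMr ?ltr_wpDl// => h.
have := hK _ Svu; rewrite -(seminorm_fineK Svu) -EFinM lee_fin.
rewrite (linear_onB ll)//.
have := seminorm_fine_ge0 Svu; nra.
Qed.

Lemma continuous_bounded_on l : linear_on S l -> continuous_on S p l ->
  bounded_on S p l.
Proof.
move=> ll /(_ 0 seminorm_on0 1 ltr01)[r r0 hr].
exists (2 / r); first by rewrite divr_ge0// ltW.
move=> u Su; rewrite -(seminorm_fineK Su) -EFinM lee_fin.
apply/ler_addgt0Pr => e e0.
(* [t] brings [u] into the ball of radius [r]; the term with [e] keeps the denominator positive when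
   [p u = 0]. *)
pose t := r / (2 * (fine (p u) + e * r / 2)).
have d0 : 0 < fine (p u) + e * r / 2.
  have := seminorm_fine_ge0 Su; have : 0 < e * r by rewrite mulr_gt0.
  lra.
have t0 : 0 < t by rewrite divr_gt0// mulr_gt0.
have Stu : S (t *: u) by exact: (linZ seminorm_on0 seminorm_onZD).
have tE : t * (fine (p u) + e * r / 2) = r / 2.
  rewrite /t; move: (fine (p u) + e * r / 2) d0 => D D0.
  by field; rewrite gt_eqF.
clearbody t; have := hr _ Stu; rewrite subr0 -(seminorm_fineK Stu) lte_fin.
rewrite seminorm_fineZ// (linear_on0 ll seminorm_on0) subr0.
rewrite (linear_onZ ll seminorm_on0)// normrM (gtr0_norm t0).
have -> : t * fine (p u) < r.
  have : 0 < t * (e * r / 2) by rewrite !mulr_gt0.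
  move: tE; rewrite mulrDr; lra.
move=> /(_ isT) h.
have -> : 2 / r * fine (p u) + e = (fine (p u) + e * r / 2) * (2 / r).
  by field; rewrite gt_eqF.
rewrite -(ler_pM2l t0) mulrA tE.
have -> : r / 2 * (2 / r) = 1 by field; rewrite gt_eqF.
exact: ltW.
Qed.

Lemma dense_linear_on_eq0 A l : A `<=` S ->
  (forall u, S u -> forall e : R, 0 < e -> exists2 v, A v & (p (u - v)%R < e%:E)%E) ->
  linear_on S l -> bounded_on S p l -> (forall u, A u -> l u = 0) ->
  forall u, S u -> l u = 0.
Proof.
move=> AS dA ll [K K0 hK] l0 u Su; apply/eqP; rewrite -normr_eq0.
apply/eqP/le_anti; rewrite normr_ge0 andbT; apply/ler_addgt0Pr => e e0.
have [v Av] := dA _ Su (e / (K + 1)) (divr_gt0 e0 (ltr_wpDl K0 ltr01)).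
have Suv := linB seminorm_onZD Su (AS _ Av).
have := hK _ Suv; rewrite (linear_onB ll)//; last exact: AS.
rewrite (l0 _ Av) subr0 add0r -(seminorm_fineK Suv) -EFinM lee_fin lte_fin.
rewrite ltr_pdivlMr ?ltr_wpDl//.
have := seminorm_fine_ge0 Suv; nra.
Qed.

(* The value at u is the only real within p (u - s i) of L i for every i. *)
Lemma dense_linear_extension (I : Type) (s : I -> V) (L : I -> R) :
  (forall i, S (s i)) ->
  (forall c i j, exists2 k, s k = c *: s i + s j & L k = c * L i + L j) ->
  (forall i, (`|L i|%:E <= p (s i))%E) ->
  (forall u, S u -> forall e : R, 0 < e -> exists i, (p (u - s i)%R < e%:E)%E) ->
  exists l, [/\ linear_on S l, (forall u, S u -> (`|l u|%:E <= p u)%E)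
    & forall i, l (s i) = L i].
Proof.
move=> Ss scomb Lp sdense; pose q u := fine (p u).
have Lq i : `|L i| <= q (s i).
  by rewrite -lee_fin seminorm_fineK.
have Sus u i : S u -> S (u - s i) by move=> Su; exact: (linB seminorm_onZD).
(* Applied to [u = s i = s j] this also shows that [L] depends only on the vector and not on its
   index, so a simple function may be indexed by all of its presentations. *)
have Lle u i j : S u -> L i - q (u - s i) <= L j + q (u - s j).
  move=> Su; have [k sk Lk] := scomb (-1) j i.
  have := Lq k; rewrite sk Lk scaleN1r mulN1r.
  have -> : - s j + s i = (u - s j) - (u - s i).
    by rewrite opprB [RHS]addrC addrA subrK addrC.
  have := seminorm_fineD (Sus _ j Su) (linZ seminorm_on0 seminorm_onZD (-1) (Sus _ i Su)).
  rewrite scaleN1r seminorm_fineN; last exact: Sus.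
  rewrite /q; have := ler_norm (- L j + L i); lra.
pose l u := sup [set L i - q (u - s i) | i in [set: I]].
have lL u i : S u -> `|l u - L i| <= q (u - s i).
  move=> Su; rewrite ler_distl; apply/andP; split.
    apply: ub_le_sup; last by exists i.
    by exists (L i + q (u - s i)) => _ [j _ <-]; exact: Lle.
  apply: ge_sup; first by exists (L i - q (u - s i)), i.
  by move=> _ [j _ <-]; exact: Lle.
have dq u e : S u -> 0 < e -> exists i, q (u - s i) < e.
  move=> Su /(sdense _ Su)[i hi]; exists i.
  by rewrite -lte_fin seminorm_fineK//; exact: Sus.
exists l; split.
- move=> c u v Su Sv; apply/eqP; rewrite -subr_eq0 -normr_eq0.
  apply/eqP/le_anti; rewrite normr_ge0 andbT; apply/ler_addgt0Pr => e e0.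
  rewrite add0r; pose e' := e / (2 * (`|c| + 1)).
  have c1 : 0 < `|c| + 1 by rewrite ltr_wpDl.
  have e'0 : 0 < e' by rewrite divr_gt0// mulr_gt0.
  have eE : e = 2 * (`|c| * e' + e') by rewrite /e'; field; rewrite gt_eqF.
  have [i hi] := dq _ _ Su e'0; have [j hj] := dq _ _ Sv e'0.
  have [k sk Lk] := scomb c i j.
  have Scuv := seminorm_onZD c Su Sv.
  have := lL _ k Scuv; have := lL _ i Su; have := lL _ j Sv.
  have -> : q (c *: u + v - s k) = q (c *: (u - s i) + (v - s j)).
    by rewrite sk scalerBr opprD addrACA.
  have := seminorm_fineD (linZ seminorm_on0 seminorm_onZD c (Sus _ i Su)) (Sus _ j Sv).
  rewrite seminorm_fineZ ?Lk; last exact: Sus.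
  rewrite -/(q _) -/(q _) -/(q _) => h1 h2 h3 h4.
  have -> : l (c *: u + v) - (c * l u + l v) =
    (l (c *: u + v) - (c * L i + L j)) - (c * (l u - L i) + (l v - L j)) by ring.
  apply: (le_trans (ler_normB _ _)).
  have := ler_normD (c * (l u - L i)) (l v - L j); rewrite normrM.
  have : `|c| * `|l u - L i| <= `|c| * e'.
    by rewrite ler_wpM2l//; apply: (le_trans h3); exact: ltW.
  have : `|c| * q (u - s i) <= `|c| * e' by rewrite ler_wpM2l// ltW.
  by rewrite eE; lra.
- move=> u Su; rewrite -(seminorm_fineK Su) lee_fin.
  have [i _] := dq _ _ Su ltr01; have [k sk Lk] := scomb (-1) i i.
  have := lL _ k Su; rewrite sk Lk scaleN1r mulN1r !addNr.
  by rewrite !subr0.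
- move=> i; apply/eqP; rewrite -subr_eq0 -normr_eq0.
  apply/eqP/le_anti; rewrite normr_ge0 andbT.
  apply: (le_trans (lL _ i (Ss i))); rewrite subrr /q.
  by rewrite seminorm_fine0.
Qed.

End seminorm_theory.
End seminormed_functionals.

Lemma seminorm_on_closure (R : realType) (V : lmodType R) (S A : set V) (p : V -> \bar R) :
  seminorm_on S p -> A `<=` S -> A 0 ->
  (forall (c : R) u v, A u -> A v -> A (c *: u + v)) -> seminorm_on (closure_in S p A) p.
Proof.
move=> sp AS A0 AZD; have [S0 SZD pf pZ pD] := sp; split.
- split=> // e e0; exists 0 => //.
  by rewrite subr0 -(seminorm_fineK sp S0) (seminorm_fine0 sp) lte_fin.
- move=> c u v [Su hu] [Sv hv]; split=> [|e e0]; first exact: SZD.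
  have c0 : 0 < 2 * (`|c| + 1) by rewrite mulr_gt0// ltr_wpDl.
  have [u' Au' hu'] := hu _ (divr_gt0 e0 c0).
  have e20 : 0 < e / 2 by rewrite divr_gt0.
  have [v' Av' hv'] := hv _ e20.
  exists (c *: u' + v'); first exact: AZD.
  have Suu := linB SZD Su (AS _ Au'); have Svv := linB SZD Sv (AS _ Av').
  have -> : c *: u + v - (c *: u' + v') = c *: (u - u') + (v - v').
    by rewrite scalerBr opprD addrACA.
  apply: le_lt_trans (pD _ _ (linZ S0 SZD c Suu) Svv) _; rewrite pZ//.
  move: hu' hv'; rewrite -(seminorm_fineK sp Suu) -(seminorm_fineK sp Svv).
  rewrite -EFinM -EFinD !lte_fin ltr_pdivlMr// => h1 h2.
  have := seminorm_fine_ge0 sp Suu; have := normr_ge0 c; nra.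
- by move=> u [Su _]; exact: pf.
- by move=> c u [Su _]; exact: pZ.
- by move=> u v [Su _] [Sv _]; exact: pD.
Qed.

(** * Integrals and random vectors *)

Section integration_complements.
Context {d : measure_display} {T : measurableType d} {R : realType}.

Lemma measurable_ereal_sup_seq (f : nat -> T -> \bar R) :
  (forall k, measurable_fun [set: T] (f k)) ->
  measurable_fun setT (fun w => ereal_sup (range (f ^~ w))).
Proof.
move=> mf.
rewrite (_ : (fun w => _) = (fun w => esups (f ^~ w) 0%N)).
  exact: measurable_fun_esups.
apply/funext => w; rewrite /esups /=; congr ereal_sup.
by apply/seteqP; split=> [_ [k _ <-]|_ [k _ <-]]; exists k.
Qed.

(* The integral of a function that is not measurable is a lower integral. *)
Lemma ge0_le_lower_integral (mu : {measure set T -> \bar R}) (f g : T -> \bar R) :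
  (forall w, 0 <= f w)%E -> (forall w, f w <= g w)%E ->
  (\int[mu]_w f w <= \int[mu]_w g w)%E.
Proof.
move=> f0 fg; have g0 w : (0 <= g w)%E by exact: le_trans (fg w).
rewrite !ge0_integralTE//; apply: ge_ereal_sup => _ [h /= hf <-].
by apply: ereal_sup_ubound; exists h => // w; exact: le_trans (hf w) (fg w).
Qed.

(** * Decreasing sets of vanishing measure *)

Section tails.
Context {mu : {finite_measure set T -> \bar R}} {A : nat -> set T}.
Hypotheses (mA : forall k, measurable (A k))
  (decA : forall k, A k.+1 `<=` A k) (A0 : mu \o A @ \oo --> 0%E).

Lemma decreasing_le k l : (k <= l)%N -> A l `<=` A k.
Proof.
move=> /subnK <-; elim: (l - k)%N => // i ih.
by rewrite addSn; apply: subset_trans ih; exact: decA.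
Qed.

Lemma tail_null : mu (\bigcap_k A k) = 0%E.
Proof.
have mI : measurable (\bigcap_k A k) by exact: bigcapT_measurable.
apply/le_anti; rewrite measure_ge0 andbT.
have /cvg_lim <- // := A0.
apply: lime_ge; first by apply/cvg_ex; exists 0%E.
apply: nearW => k /=; apply: le_measure; rewrite ?inE//.
exact: bigcap_inf.
Qed.

Lemma tail_indic_cvg0 : {ae mu, forall w, (\1_(A k) w : R) @[k --> \oo] --> (0 : R)}.
Proof.
exists (\bigcap_k A k); split => //.
- exact: bigcapT_measurable.
- exact: tail_null.
move=> w /= h; apply: contrapT => nw; apply: h.
have [k nAk] : exists k, ~ A k w.
  by apply/existsNP => h; apply: nw => k _; exact: h.
apply/cvgrPdist_lt => e e0; exists k => // l /= kl.
rewrite sub0r normrN indicE memNset ?normr0// => /(decreasing_le kl).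
exact: nAk.
Qed.

Lemma tail_integral_cvg0 (f : T -> \bar R) : mu.-integrable setT f ->
  (\int[mu]_w ((\1_(A k) w)%:E * f w))%E @[k --> \oo] --> 0%E.
Proof.
move=> fi; have mf := measurable_int _ fi.
have := @dominated_convergence _ _ _ mu setT measurableT
  (fun k w => ((\1_(A k) w)%:E * f w)%E) (cst 0%E) (abse \o f).
rewrite integral0; case=> //.
- by move=> k; apply: emeasurable_funM => //; apply/measurable_EFinP; exact: measurable_indic.
- have := tail_indic_cvg0; apply: filterS2 (integrable_ae measurableT fi).
  move=> w /(_ Logic.I) fw hw _.
  rewrite -(fineK fw) -[X in _ --> X]/((0 : R)%:E).
  apply/cvg_EFin; first by apply: nearW => k; rewrite -EFinM.
  rewrite -(mul0r (fine (f w))); apply: cvgMl; exact: hw.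
- exact: integrable_abse.
- apply: aeW => w k _ /=; rewrite abseM -[leRHS]mul1e lee_wpmul2r//.
  by rewrite lee_fin indicE; case: (_ \in _); rewrite ?normr1 ?normr0.
Qed.

End tails.
End integration_complements.

(** * Measurable random vectors and a countable dense set of values *)

Section random_vectors.
Context {d : measure_display} {T : measurableType d} {R : realType}.
Context {n : nat}.
Implicit Types (u v y : T -> 'rV[R]_n).

Lemma coordB (x y : 'rV[R]_n) j : (x - y) 0 j = x 0 j - y 0 j.
Proof. by rewrite !mxE. Qed.

Definition measurable_vec u := forall j, measurable_fun setT (fun w => u w 0 j).

Definition vrestr (A : set T) u : T -> 'rV[R]_n := fun w => (\1_A w : R) *: u w.

Lemma measurable_vecZD c u v : measurable_vec u -> measurable_vec v ->
  measurable_vec (c *: u + v).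
Proof.
move=> mu mv j; rewrite (_ : (fun w => _) = (fun w => c * u w 0 j + v w 0 j)).
  by apply: measurable_funD => //; exact: measurable_funM.
by apply/funext => w; rewrite !fctE !mxE.
Qed.

Lemma measurable_vec_cst x : measurable_vec (fun=> x).
Proof. by move=> j; exact: measurable_cst. Qed.

Lemma measurable_vecZ c u : measurable_vec u -> measurable_vec (c *: u).
Proof.
move=> mu; have := measurable_vecZD c mu (measurable_vec_cst 0).
by rewrite (_ : (fun=> 0) = 0)// addr0.
Qed.

Lemma measurable_vecD u v : measurable_vec u -> measurable_vec v ->
  measurable_vec (u + v).
Proof. by move=> mu mv; have := measurable_vecZD 1 mu mv; rewrite scale1r. Qed.

Lemma measurable_vecB u v : measurable_vec u -> measurable_vec v ->
  measurable_vec (u - v).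
Proof. by move=> mu mv; have := measurable_vecZD (-1) mv mu; rewrite scaleN1r addrC. Qed.

Lemma measurable_vrestr A u : measurable A -> measurable_vec u ->
  measurable_vec (vrestr A u).
Proof.
move=> mA mu j; rewrite (_ : (fun w => _) = (fun w => \1_A w * u w 0 j)).
  by apply: measurable_funM => //; exact: measurable_indic.
by apply/funext => w; rewrite !mxE.
Qed.

Lemma measurable_dotp u v : measurable_vec u -> measurable_vec v ->
  measurable_fun setT (fun w => dotp (u w) (v w)).
Proof.
by move=> mu mv; apply: measurable_sum => j; exact: measurable_funM.
Qed.

(** An enumeration of the rational vectors, with value 0 at numbers that code nothing. Suprema over
    it are countable and so preserve measurability. *)
Definition rational_vec (k : nat) : 'rV[R]_n :=
  map_mx ratr (odflt 0 (unpickle k) : 'rV[rat]_n).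

Lemma rational_vec_dense (x : 'rV[R]_n) (e : R) : 0 < e ->
  exists k, forall j, `|x 0 j - rational_vec k 0 j| < e.
Proof.
move=> e0.
have /choice[f hf] : forall j, exists q : rat, `|x 0 j - ratr q| < e.
  move=> j; have [|q] := @rat_in_itvoo R (x 0 j - e) (x 0 j + e); first by lra.
  rewrite in_itv /= => /andP[h1 h2]; exists q; rewrite ltr_norml.
  by apply/andP; split; lra.
exists (pickle (\row_j f j)) => j; rewrite /rational_vec pickleK /= !mxE.
exact: hf.
Qed.

Context {N : 'rV[R]_n -> R} (hN : is_norm N).

Lemma rational_vec_vnorm_dense (x : 'rV[R]_n) (e : R) : 0 < e ->
  exists k, N (x - rational_vec k) < e.
Proof.
move=> e0; have [C C0 hC] := vnorm_le_coord hN.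
have [k hk] := rational_vec_dense x (divr_gt0 e0 (ltr_pwDl ltr01 (ltW C0))).
exists k; apply: (@le_lt_trans _ _ (C * (e / (1 + C)))).
  apply: hC => [|j]; first by rewrite divr_ge0// ltW// ltr_wpDl// ltW.
  by rewrite coordB ltW// hk.
rewrite mulrCA gtr_pMr// ltr_pdivrMr ?mul1r; lra.
Qed.

(* N is Lipschitz, so N x is the supremum of the lower bounds of N x given by
   the values of N on a dense sequence. *)
Lemma vnorm_sup_seq (C : R) : 0 < C ->
  (forall (x : 'rV[R]_n) (M : R), 0 <= M -> (forall j, `|x 0 j| <= M) -> N x <= C * M) ->
  forall x, (N x)%:E = ereal_sup (range (fun k =>
    (N (rational_vec k) - C * \sum_j `|x 0 j - rational_vec k 0 j|)%:E)).
Proof.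
move=> C0 hC x; apply/le_anti/andP; split; last first.
  apply: ge_ereal_sup => _ [k _ <-]; rewrite lee_fin.
  have : N (rational_vec k - x) <= C * \sum_j `|x 0 j - rational_vec k 0 j|.
    apply: hC => [|j]; first by rewrite sumr_ge0.
    by rewrite coordB distrC (bigD1 j)//= lerDl sumr_ge0.
  by have := vnormD hN (rational_vec k - x) x; rewrite subrK; lra.
apply/lee_addgt0Pr => e e0.
(* The error [C * S] enters twice, once in the term of the supremum and once through
   [N (x - rational_vec k)]; the factor [n + 1] absorbs the [n] summands of [S]. *)
have Cn : 0 < 2 * C * (n%:R + 1) by rewrite !mulr_gt0// ltr_wpDl.
have [k hk] := rational_vec_dense x (divr_gt0 e0 Cn).
apply: (@le_trans _ _ (((N (rational_vec k) -
    C * \sum_j `|x 0 j - rational_vec k 0 j|) + e)%:E)); last first.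
  by rewrite EFinD leeD2r//; apply: ereal_sup_ubound; exists k.
rewrite lee_fin.
set S := \sum_j _.
have hS : S * (2 * C * (n%:R + 1)) <= n%:R * e.
  rewrite -ler_pdivlMr// /S.
  apply: le_trans (ler_sum _ (fun j _ => ltW (hk j))) _.
  by rewrite sumr_const card_ord -[leLHS]mulr_natl mulrA.
have S0 : 0 <= S by exact: sumr_ge0.
have hCS : 2 * (C * S) <= e.
  have n1 : 0 < n%:R + 1 :> R by rewrite ltr_wpDl.
  rewrite -(ler_pM2r n1); apply: (@le_trans _ _ (n%:R * e)); last first.
    by rewrite mulrC ler_pM2l// lerDl.
  by apply: le_trans hS; rewrite le_eqVlt; apply/orP; left; apply/eqP; ring.
have : N (x - rational_vec k) <= C * S.
  apply: hC => [|j]; first exact: sumr_ge0.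
  by rewrite /S coordB (bigD1 j)//= lerDl sumr_ge0.
have := vnormD hN (x - rational_vec k) (rational_vec k); rewrite subrK.
lra.
Qed.

(** Measurability of vectors is coordinatewise, so [N \o u] is obtained as a countable supremum of
    functions of the coordinates. *)
Lemma measurable_vnorm u : measurable_vec u -> measurable_fun setT (N \o u).
Proof.
move=> mu; have [C C0 hC] := vnorm_le_coord hN.
apply/measurable_EFinP.
rewrite (_ : EFin \o _ = fun w => ereal_sup (range (fun k =>
  (N (rational_vec k) - C * \sum_j `|u w 0 j - rational_vec k 0 j|)%:E))).
  apply: measurable_ereal_sup_seq => k; apply/measurable_EFinP.
  apply: measurable_funB => //; apply: measurable_funM => //.
  apply: measurable_sum => j; apply: measurableT_comp => //.
  exact: measurable_funB.
by apply/funext => w /=; rewrite -vnorm_sup_seq.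
Qed.

End random_vectors.

(** * Essentially bounded random vectors and simple functions *)

Section bounded_random_vectors.
Context {d : measure_display} {T : measurableType d} {R : realType}.
Context (P : probability T R) {n : nat} {N : 'rV[R]_n -> R} (hN : is_norm N).
Implicit Types (u v y : T -> 'rV[R]_n).

Lemma probT_gt0 : (0 < P [set: T])%E.
Proof. by rewrite probability_setT lte01. Qed.

Lemma Lfunoo_P (f : T -> R) : f \in Lfun P +oo%E <->
  measurable_fun setT f /\ exists M : R, {ae P, forall w, `|f w| <= M}.
Proof.
have LE : 'N[P]_+oo[EFin \o f]%E = ess_sup P (abse \o (EFin \o f)).
  by rewrite unlock probT_gt0.
split.
  move=> /andP[]; rewrite !inE /= => mf.
  rewrite /finite_norm LE => foo; split => //.
  have := ess_sup_ge P (abse \o (EFin \o f)).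
  move: foo; case: (ess_sup _ _) => [M _|//|_].
    by move=> h; exists M; apply: filterS h => w /=; rewrite lee_fin.
  by move=> h; exists 0; apply: filterS h => w /=; rewrite leNgt ltNye.
move=> [mf [M hM]]; apply/andP; rewrite !inE /=; split => //.
rewrite /finite_norm LE; apply: (@le_lt_trans _ _ M%:E); last exact: ltry.
by apply/ess_supP; apply: filterS hM => w /=; rewrite lee_fin.
Qed.

Lemma ae_forall_ord (Q : 'I_n -> T -> Prop) :
  (forall j, {ae P, forall w, Q j w}) -> {ae P, forall w, forall j, Q j w}.
Proof. by move=> h; apply: filter_forall => j; exact: h. Qed.

Lemma LinftyP u : Linfty P u <->
  measurable_vec u /\ exists M : R, {ae P, forall w, N (u w) <= M}.
Proof.
have [C C0 hC] := vnorm_le_coord hN; have [C' C'0 hC'] := coord_le_vnorm hN.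
split=> [h|[mu [M hM]] j].
  split=> [j|]; first by have /Lfunoo_P[] := h j.
  have /choice[M hM] : forall j, exists M : R, {ae P, forall w, `|u w 0 j| <= M}.
    by move=> j; have /Lfunoo_P[] := h j.
  exists (C * \sum_j `|M j|); have := ae_forall_ord hM; apply: filterS => w hw.
  apply: hC => [|j]; first exact: sumr_ge0.
  apply: (le_trans (hw j)); apply: (le_trans (ler_norm _)).
  by rewrite (bigD1 j)//= lerDl sumr_ge0.
apply/Lfunoo_P; split; first exact: mu.
exists (C' * M); apply: filterS hM => w hw; apply: (le_trans (hC' _ _)).
by rewrite ler_pM2l.
Qed.

Lemma Linfty_coordP u : Linfty P u <->
  measurable_vec u /\ exists M : R, 0 <= M /\ {ae P, forall w j, `|u w 0 j| <= M}.
Proof.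
have [C C0 hC] := vnorm_le_coord hN; have [C' C'0 hC'] := coord_le_vnorm hN.
rewrite LinftyP; split=> -[mu [M]].
  move=> hM; split=> //; exists (C' * `|M|); split; first by rewrite mulr_ge0// ltW.
  apply: filterS hM => w hw j; apply: (le_trans (hC' _ _)).
  by rewrite ler_pM2l// (le_trans hw)// ler_norm.
move=> [M0 hM]; split=> //; exists (C * M); apply: filterS hM => w hw.
by apply: hC => // j; exact: hw.
Qed.

Lemma Linfty_measurable u : Linfty P u -> measurable_vec u.
Proof. by move/LinftyP => []. Qed.

Lemma Linfty_norm_leP u (M : R) : 0 <= M ->
  (Linfty_norm P N u <= M%:E)%E <-> {ae P, forall w, N (u w) <= M}.
Proof.
move=> M0; rewrite /Linfty_norm unlock probT_gt0; split.
  move/ess_supP; apply: filterS => w /=.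
  by rewrite lee_fin ger0_norm ?vnorm_ge0.
move=> h; apply/ess_supP; apply: filterS h => w /=.
by rewrite lee_fin ger0_norm ?vnorm_ge0.
Qed.

Lemma Linfty_norm_fin u : Linfty P u -> exists2 M : R, 0 <= M & Linfty_norm P N u = M%:E.
Proof.
move/LinftyP => [mu [M hM]].
have h0 : (0 <= Linfty_norm P N u)%E by rewrite /Linfty_norm Lnorm_ge0.
have hM' : (Linfty_norm P N u <= `|M|%:E)%E.
  apply/Linfty_norm_leP => //; apply: filterS hM => w hw.
  exact: le_trans (ler_norm _).
exists (fine (Linfty_norm P N u)); first exact: fine_ge0.
by rewrite fineK// ge0_fin_numE// (le_lt_trans hM')// ltry.
Qed.

Lemma Linfty_norm_ae u (M : R) : Linfty_norm P N u = M%:E ->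
  {ae P, forall w, N (u w) <= M}.
Proof.
move=> h; apply/Linfty_norm_leP; last by rewrite h.
by rewrite -lee_fin -h /Linfty_norm Lnorm_ge0.
Qed.

Lemma seminorm_on_Linfty : seminorm_on (Linfty P) (Linfty_norm P N).
Proof.
have ZD (c : R) u v : Linfty P u -> Linfty P v -> Linfty P (c *: u + v).
  move=> /LinftyP[mu [M hM]] /LinftyP[mv [M' hM']]; apply/LinftyP; split.
    exact: measurable_vecZD.
  exists (`|c| * M + M'); apply: filterS2 hM hM' => w h1 h2.
  apply: (le_trans (vnormD hN _ _)); rewrite vnormZ// lerD//.
  by rewrite ler_wpM2l.
have L0 : Linfty P (0 : T -> 'rV[R]_n).
  apply/LinftyP; split; first exact: measurable_vec_cst.
  by exists 0; apply: aeW => w; rewrite vnorm0.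
have le_Z (c : R) u : Linfty P u ->
    (Linfty_norm P N (c *: u) <= `|c|%:E * Linfty_norm P N u)%E.
  move=> /Linfty_norm_fin[M M0 hM]; rewrite hM -EFinM.
  apply/Linfty_norm_leP; first by rewrite mulr_ge0.
  have := Linfty_norm_ae hM; apply: filterS => w hw.
  by rewrite vnormZ// ler_wpM2l.
split => //.
- by move=> u /Linfty_norm_fin[M M0 ->]; rewrite lee_fin M0 ltry.
- move=> c u Lu; apply/le_anti/andP; split; first exact: le_Z.
  have [->|c0] := eqVneq c 0.
    by rewrite normr0 mul0e /Linfty_norm Lnorm_ge0.
  have Lcu : Linfty P (c *: u) by rewrite -[c *: u]addr0; exact: ZD.
  rewrite -lee_pdivlMl ?normr_gt0// -normfV.
  by have := le_Z c^-1 _ Lcu; rewrite scalerA mulVf// scale1r.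
- move=> u v Lu Lv; have [M M0 hM] := Linfty_norm_fin Lu.
  have [M' M'0 hM'] := Linfty_norm_fin Lv; rewrite hM hM' -EFinD.
  apply/Linfty_norm_leP; first exact: addr_ge0.
  have := Linfty_norm_ae hM; have := Linfty_norm_ae hM'.
  apply: filterS2 => w h1 h2; apply: (le_trans (vnormD hN _ _)).
  exact: lerD.
Qed.

Lemma LinftyZD c u v : Linfty P u -> Linfty P v -> Linfty P (c *: u + v).
Proof. exact: (seminorm_onZD seminorm_on_Linfty). Qed.

Lemma Linfty0 : Linfty P (0 : T -> 'rV[R]_n).
Proof. exact: (seminorm_on0 seminorm_on_Linfty). Qed.

Lemma LinftyD u v : Linfty P u -> Linfty P v -> Linfty P (u + v).
Proof. exact: (linD LinftyZD). Qed.

Lemma LinftyB u v : Linfty P u -> Linfty P v -> Linfty P (u - v).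
Proof. exact: (linB LinftyZD). Qed.

Lemma LinftyZ c u : Linfty P u -> Linfty P (c *: u).
Proof. exact: (linZ Linfty0 LinftyZD). Qed.

Lemma Linfty_cst (x : 'rV[R]_n) : Linfty P (fun=> x).
Proof.
apply/LinftyP; split; first exact: measurable_vec_cst.
by exists (N x); apply: aeW.
Qed.

Lemma vnorm_vrestr A u w : N (vrestr A u w) = \1_A w * N (u w).
Proof. by rewrite /vrestr vnormZ// ger0_norm// indicE; case: (_ \in _). Qed.

Lemma vnorm_vrestr_le A u w : N (vrestr A u w) <= N (u w).
Proof.
by rewrite vnorm_vrestr ler_piMl ?vnorm_ge0// indicE; case: (_ \in _).
Qed.

Lemma Linfty_vrestr A u : measurable A -> Linfty P u -> Linfty P (vrestr A u).
Proof.
move=> mA /LinftyP[mu [M hM]]; apply/LinftyP; split.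
  exact: measurable_vrestr.
by exists M; apply: filterS hM => w; exact/le_trans/vnorm_vrestr_le.
Qed.

Lemma Linfty_coord_ge u v : measurable_vec v -> Linfty P u ->
  {ae P, forall w j, `|v w 0 j| <= `|u w 0 j|} -> Linfty P v.
Proof.
move=> mv /Linfty_coordP[mu [M [M0 hM]]] h; apply/Linfty_coordP; split => //.
exists M; split => //.
by apply: filterS2 h hM => w h1 h2 j; exact: le_trans (h1 j) (h2 j).
Qed.

(** The presentation is a list, so that sums become concatenations; the sets in it may overlap. *)
Definition simple_vec (s : seq ('rV[R]_n * {A : set T | measurable A})) :
  T -> 'rV[R]_n := fun w => \sum_(x <- s) (\1_(sval x.2) w : R) *: x.1.

Lemma simple_vec_cons x s : simple_vec (x :: s) = vrestr (sval x.2) (fun=> x.1) + simple_vec s.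
Proof. by apply/funext => w; rewrite /simple_vec big_cons. Qed.

Lemma simple_vec_cat s t : simple_vec (s ++ t) = simple_vec s + simple_vec t.
Proof. by apply/funext => w; rewrite /simple_vec big_cat. Qed.

Lemma Linfty_simple_vec s : Linfty P (simple_vec s).
Proof.
elim: s => [|x s ih].
  rewrite (_ : simple_vec [::] = 0); first exact: Linfty0.
  by apply/funext => w; rewrite /simple_vec big_nil.
rewrite simple_vec_cons; apply: LinftyD => //; apply: Linfty_vrestr.
  exact: (svalP x.2).
exact: Linfty_cst.
Qed.

(** Subtracting [M / 2] times the sign of each coordinate leaves at most [M / 2]. The signs are
    constant on [0 <= u_j] and on its complement. *)
Lemma simple_vec_halve u (M : R) : measurable_vec u -> exists s, forall w,
  (forall j, `|u w 0 j| <= M) -> forall j, `|(u - simple_vec s) w 0 j| <= M / 2.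
Proof.
move=> mu.
have mge j : measurable [set w | 0 <= u w 0 j].
  have := mu j measurableT `[0, +oo[%classic (measurable_itv _).
  by rewrite setTI; congr measurable; apply/funext => w /=; rewrite in_itv /= andbT.
pose A j : {A : set T | measurable A} := exist _ _ (mge j).
pose B j : {A : set T | measurable A} := exist _ _ (measurableC (mge j)).
pose c j : 'rV[R]_n := (M / 2) *: delta_mx 0 j.
exists ([seq (c j, A j) | j <- index_enum 'I_n] ++
  [seq (- c j, B j) | j <- index_enum 'I_n]).
move=> w hw j.
rewrite simple_vec_cat coordB mxE /simple_vec !big_map !summxE.
rewrite (bigD1 j)//= [X in _ - (_ + X)](bigD1 j)//=.
rewrite [X in _ + X + _]big1 ?addr0; last first.
  by move=> i ij; rewrite !mxE eqxx eq_sym (negbTE ij) /= !mulr0.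
rewrite [X in _ + (_ + X)]big1 ?addr0; last first.
  by move=> i ij; rewrite !mxE eqxx eq_sym (negbTE ij) /= mulr0 oppr0 mulr0.
rewrite !mxE !eqxx /= mulr1 !indicE in_setC.
have := hw j; rewrite !ler_norml => /andP[h1 h2].
have [u0|u0] := leP 0 (u w 0 j).
  by rewrite mem_set//= mul1r mul0r addr0; apply/andP; split; lra.
rewrite memNset /=; last by move=> /= /(lt_le_trans u0); rewrite ltxx.
by rewrite mul0r mul1r add0r; apply/andP; split; lra.
Qed.

(** Iterated halving: after [k] rounds the coordinates of the remainder are at most [M / 2 ^+ k]. *)
Lemma simple_vec_dense u : Linfty P u -> forall e : R, 0 < e ->
  exists s, (Linfty_norm P N (u - simple_vec s)%R < e%:E)%E.
Proof.
move=> /Linfty_coordP[mu [M [M0 hM]]] e e0.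
have approx k : exists s, {ae P, forall w j, `|(u - simple_vec s) w 0 j| <= M / 2 ^+ k}.
  elim: k => [|k [s hs]].
    exists [::]; apply: filterS hM => w hw j.
    by rewrite expr0 divr1 coordB /simple_vec big_nil mxE subr0.
  have mus : measurable_vec (u - simple_vec s).
    exact/measurable_vecB/Linfty_measurable/Linfty_simple_vec.
  have [t ht] := simple_vec_halve (M / 2 ^+ k) mus.
  exists (s ++ t); apply: filterS hs => w hw j.
  rewrite simple_vec_cat opprD addrA exprSr invfM mulrA.
  exact: ht.
have [C C0 hC] := vnorm_le_coord hN.
have [k hk] : exists k, C * (M / 2 ^+ k) < e.
  exists (Num.bound (C * M / e)).
  rewrite mulrA ltr_pdivrMr ?exprn_gt0// [ltRHS]mulrC -ltr_pdivrMr//.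
  apply: (lt_le_trans (archi_boundP _)); first by rewrite divr_ge0 ?mulr_ge0// ltW.
  by rewrite -natrX ler_nat ltnW// ltn_expl.
have [s hs] := approx k; exists s.
apply: (@le_lt_trans _ _ (C * (M / 2 ^+ k))%:E); last by rewrite lte_fin.
apply/Linfty_norm_leP.
  by rewrite mulr_ge0// ?divr_ge0// ?exprn_ge0// ltW.
apply: filterS hs => w hw; apply: hC => //.
by rewrite divr_ge0// exprn_ge0.
Qed.

(** By density of the simple functions, two bounded functionals need only be compared on indicators
    times constant vectors. *)
Lemma Linfty_linear_eq0 (l : (T -> 'rV[R]_n) -> R) :
  linear_on (Linfty P) l -> bounded_on (Linfty P) (Linfty_norm P N) l ->
  (forall A x, measurable A -> l (vrestr A (fun=> x)) = 0) ->
  forall u, Linfty P u -> l u = 0.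
Proof.
move=> ll lb l0.
apply: (dense_linear_on_eq0 seminorm_on_Linfty (A := range simple_vec)) => //.
- by move=> _ [s _ <-]; exact: Linfty_simple_vec.
- move=> u Lu e e0; have [s hs] := simple_vec_dense Lu e0.
  by exists (simple_vec s).
move=> _ [s _ <-]; elim: s => [|x s ih].
  rewrite (_ : simple_vec [::] = 0); first exact: (linear_on0 ll Linfty0).
  by apply/funext => w; rewrite /simple_vec big_nil.
have mx := svalP x.2.
rewrite simple_vec_cons (linear_onD ll) ?ih ?l0 ?addr0//.
  exact/Linfty_vrestr/Linfty_cst.
exact: Linfty_simple_vec.
Qed.

End bounded_random_vectors.

(** * Finitely additive measures and their integrals *)

Section bounded_additive_measures.
Context {d : measure_display} {T : measurableType d} {R : realType}.
Context {P : probability T R} {n : nat}.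
Implicit Types (u v y : T -> 'rV[R]_n) (m : set T -> 'rV[R]_n) (A B : set T).

(* In the definition of M1 the equations are between the coordinate functions
   of the values of m. *)
Lemma M1P m : M1 P m <->
  [/\ forall A, ~ measurable A -> m A = 0,
      forall A B, measurable A -> measurable B -> A `&` B = set0 ->
        m (A `|` B) = m A + m B,
      exists C : R, forall A j, measurable A -> `|m A 0 j| <= C
    & forall A, measurable A -> P A = 0%E -> m A = 0].
Proof.
have fE (x y : 'rV[R]_n) : (fun_of_matrix x = fun_of_matrix y) <-> x = y.
  by split=> [h|->//]; apply/matrixP => i j; rewrite h.
have f0 : fun_of_matrix (0 : 'rV[R]_n) = 0.
  by apply/funext => i; apply/funext => j; rewrite mxE.
have fD (x y : 'rV[R]_n) :
    fun_of_matrix (x + y) = (fun_of_matrix x : 'I_1 -> 'I_n -> R) + fun_of_matrix y.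
  by apply/funext => i; apply/funext => j; rewrite mxE.
split=> -[m1 m2 m3 m4]; split => //.
- by move=> A mA; apply/fE; rewrite f0; exact: m1.
- by move=> A B mA mB AB; apply/fE; rewrite fD; exact: m2.
- by move=> A mA A0; apply/fE; rewrite f0; exact: m4.
- by move=> A mA; rewrite -f0; apply/fE; exact: m1.
- by move=> A B mA mB AB; rewrite -fD; apply/fE; exact: m2.
- by move=> A mA A0; rewrite -f0; apply/fE; exact: m4.
Qed.

Lemma M1N m : M1 P m -> M1 P (fun A => - m A).
Proof.
case/M1P=> m1 m2 [C m3] m4; apply/M1P; split.
- by move=> A /m1 ->; rewrite oppr0.
- by move=> A B mA mB AB; rewrite m2// opprD.
- by exists C => A j mA; rewrite mxE normrN; exact: m3.
- by move=> A mA A0; rewrite m4// oppr0.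
Qed.

Definition total_variation m (j : 'I_n) A : R :=
  pos_part m A 0 j + neg_part m A 0 j.

Section positive_part.
Context {m} (hm : M1 P m).

Lemma M1_set0 : m set0 = 0.
Proof. by case/M1P: hm => _ _ _; apply. Qed.

Lemma M1_setU A B : measurable A -> measurable B -> A `&` B = set0 ->
  m (A `|` B) = m A + m B.
Proof. by case/M1P: hm => _ + _ _; exact. Qed.

Lemma M1_null A : measurable A -> P A = 0%E -> m A = 0.
Proof. by case/M1P: hm => _ _ _; exact. Qed.

Lemma M1_setIC A B : measurable A -> measurable B ->
  m A = m (A `&` B) + m (A `&` ~` B).
Proof.
move=> mA mB; rewrite -M1_setU.
- by rewrite -setIUr setUCr setIT.
- exact: measurableI.
- exact/measurableI/measurableC.
- by rewrite setIACA setICr setI0.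
Qed.

Lemma pos_part_has_sup A j :
  has_sup [set m B 0 j | B in [set B | measurable B /\ B `<=` A]].
Proof.
split; first by exists (m set0 0 j), set0 => //; split => //; exact: sub0set.
case: hm => _ _ [C hC] _; exists C => _ [B [mB _] <-].
exact: le_trans (ler_norm _) (hC _ _ mB).
Qed.

Lemma le_pos_part A B j : measurable B -> B `<=` A ->
  m B 0 j <= pos_part m A 0 j.
Proof.
by move=> mB BA; rewrite mxE; apply: (ub_le_sup (proj2 (pos_part_has_sup A j))); exists B.
Qed.

Lemma pos_part_le A j (x : R) :
  (forall B, measurable B -> B `<=` A -> m B 0 j <= x) -> pos_part m A 0 j <= x.
Proof.
move=> h; rewrite mxE; apply: ge_sup; first exact: (proj1 (pos_part_has_sup A j)).
by move=> _ [B [mB BA] <-]; exact: h.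
Qed.

Lemma pos_part_ge0 A j : 0 <= pos_part m A 0 j.
Proof.
by apply: (le_trans _ (le_pos_part (B := set0) _ _ _)) => //; rewrite M1_set0 mxE.
Qed.

Lemma pos_partU A B j : measurable A -> measurable B -> A `&` B = set0 ->
  pos_part m (A `|` B) 0 j = pos_part m A 0 j + pos_part m B 0 j.
Proof.
move=> mA mB AB; apply/le_anti/andP; split.
  apply: pos_part_le => C mC CAB.
  have -> : C = (C `&` A) `|` (C `&` B) by rewrite -setIUr; apply/esym/setIidl.
  rewrite M1_setU; [|exact: measurableI..|by rewrite setIACA AB setI0].
  rewrite mxE lerD// le_pos_part//; exact: measurableI.
rewrite -lerBrDr; apply: pos_part_le => C mC CA.
rewrite lerBrDr addrC -lerBrDr; apply: pos_part_le => D mD DB.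
have -> : m D 0 j = m (C `|` D) 0 j - m C 0 j.
  rewrite M1_setU ?mxE//; first by rewrite addrAC subrr add0r.
  by apply/seteqP; split=> // w [/CA Aw /DB Bw]; rewrite -AB.
rewrite lerD2r le_pos_part//; first exact: measurableU.
exact: setUSS.
Qed.

End positive_part.

Context {m} (hm : M1 P m).

Lemma total_variation_ge0 j A : 0 <= total_variation m j A.
Proof. by rewrite addr_ge0// ?(pos_part_ge0 hm)// (pos_part_ge0 (M1N hm)). Qed.

Lemma total_variationU j A B : measurable A -> measurable B -> A `&` B = set0 ->
  total_variation m j (A `|` B) = total_variation m j A + total_variation m j B.
Proof.
move=> mA mB AB; rewrite /total_variation (pos_partU hm)//.
by rewrite /neg_part (pos_partU (M1N hm))// addrACA.
Qed.

Lemma norm_le_total_variation j A B : measurable B -> B `<=` A ->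
  `|m B 0 j| <= total_variation m j A.
Proof.
move=> mB BA; have := le_pos_part hm j mB BA; have := le_pos_part (M1N hm) j mB BA.
have := pos_part_ge0 hm A j; have := pos_part_ge0 (M1N hm) A j.
rewrite /total_variation /neg_part [(- m B) 0 j]mxE ler_norml => *.
by apply/andP; split; lra.
Qed.

Lemma total_variation_mono j A B : measurable A -> measurable B -> A `<=` B ->
  total_variation m j A <= total_variation m j B.
Proof.
move=> mA mB AB; have -> : B = A `|` (B `&` ~` A) by rewrite -setDE setDUK.
rewrite total_variationU ?lerDl ?total_variation_ge0//.
  exact/measurableI/measurableC.
by rewrite setIC -setIA setICl setI0.
Qed.

(** Removes the dual norm and the Jordan parts from the notion of singularity: only the vanishing of
    [m] below [A] remains. *)
Lemma abs_meas_eq0 (N : 'rV[R]_n -> R) (hN : is_norm N) A :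
  abs_meas N m A = 0 <-> forall B, measurable B -> B `<=` A -> m B = 0.
Proof.
split=> [/(dual_vnorm_eq0 hN)/rowP h B mB BA|h].
  apply/rowP => j; have := norm_le_total_variation j mB BA.
  by have := h j; rewrite !mxE /total_variation !mxE => ->; rewrite normr_le0 => /eqP.
rewrite /abs_meas (_ : _ + _ = 0) ?(dual_vnorm0 hN)//.
apply/rowP => j; rewrite mxE [RHS]mxE.
have -> : pos_part m A 0 j = 0.
  apply/le_anti; rewrite (pos_part_ge0 hm) andbT; apply: (pos_part_le hm) => B mB BA.
  by rewrite h// mxE.
rewrite add0r; apply/le_anti; rewrite (pos_part_ge0 (M1N hm)) andbT.
by apply: (pos_part_le (M1N hm)) => B mB BA; rewrite h// oppr0 mxE.
Qed.

Notation seqvec := (seq ('rV[R]_n * {A : set T | measurable A})).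

(* Induction on s, splitting B by the first set of s. *)
Lemma simple_integral_bound (s : seqvec) j B (t c : R) : 0 <= c -> measurable B ->
  {ae P, forall w, B w -> `|(\sum_(x <- s) \1_(sval x.2) w * x.1 0 j) + t| <= c} ->
  `|(\sum_(x <- s) x.1 0 j * m (sval x.2 `&` B) 0 j) + t * m B 0 j| <=
    c * total_variation m j B.
Proof.
(* [t] collects the values on the sets already known to contain [B], hence it varies in the
   induction. *)
move=> c0; elim: s B t => [|x s ih] B t mB.
  under eq_near do rewrite big_nil add0r.
  rewrite big_nil add0r => h; have [tc|tc] := leP `|t| c.
    by rewrite normrM ler_pM// norm_le_total_variation.
  (* At the end of the list the integrand on [B] is the constant [t]. If [t] exceeds the almost sure
     bound [c], then [B] is a null set and [m] vanishes on it. *)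
  have B0 : P B = 0%E.
    apply/measure_negligible => //; apply: negligibleS h => w /= Bw /(_ Bw).
    by rewrite leNgt tc.
  by rewrite (M1_null hm)// mxE mulr0 normr0 mulr_ge0// total_variation_ge0.
case: x => a [A mA] h.
have mB1 : measurable (B `&` A) by exact: measurableI.
have mB2 : measurable (B `&` ~` A) by exact/measurableI/measurableC.
have h1 := ih _ (a 0 j + t) mB1; have h2 := ih _ t mB2.
rewrite big_cons /=.
have -> : \sum_(x <- s) x.1 0 j * m (sval x.2 `&` B) 0 j =
   \sum_(x <- s) x.1 0 j * m (sval x.2 `&` (B `&` A)) 0 j +
   \sum_(x <- s) x.1 0 j * m (sval x.2 `&` (B `&` ~` A)) 0 j.
  rewrite -big_split; apply: eq_bigr => -[b [D mD]] _ /=.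
  rewrite -mulrDr (M1_setIC hm (measurableI _ _ mD mB) mA) mxE.
  by rewrite !setIA.
rewrite [A `&` B]setIC (M1_setIC hm mB mA) mxE.
have -> : total_variation m j B = total_variation m j (B `&` A) +
    total_variation m j (B `&` ~` A).
  rewrite -total_variationU// -?setIUr ?setUCr ?setIT//.
  by rewrite setIACA setICr setI0.
have {}h1 := h1 _; have {}h2 := h2 _.
set S1 := \sum_(x <- s) _; set S2 := \sum_(x <- s) _.
have -> : a 0 j * m (B `&` A) 0 j + (S1 + S2) +
    t * (m (B `&` A) 0 j + m (B `&` ~` A) 0 j) =
  (S1 + (a 0 j + t) * m (B `&` A) 0 j) + (S2 + t * m (B `&` ~` A) 0 j) by ring.
rewrite mulrDr; apply: (le_trans (ler_normD _ _)); apply: lerD.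
  apply: h1; apply: filterS h => w /= hw [Bw Aw]; have := hw Bw.
  by rewrite big_cons /= indicE mem_set// mul1r addrCA addrA.
apply: h2; apply: filterS h => w /= hw [Bw Aw]; have := hw Bw.
by rewrite big_cons /= indicE memNset// mul0r add0r.
Qed.

Definition simple_integral (s : seqvec) : R := \sum_(x <- s) dotp x.1 (m (sval x.2)).

Context {N : 'rV[R]_n -> R} (hN : is_norm N).

Lemma simple_integral_le : exists2 K : R, 0 <= K & forall s,
  (`|simple_integral s|%:E <= K%:E * Linfty_norm P N (simple_vec s))%E.
Proof.
have [C C0 hC] := coord_le_vnorm hN.
exists (C * \sum_j total_variation m j setT).
  by apply: mulr_ge0; [exact: ltW|apply: sumr_ge0 => j _; exact: total_variation_ge0].
move=> s; have [M M0 hM] := Linfty_norm_fin hN (Linfty_simple_vec P hN s).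
rewrite hM -EFinM lee_fin /simple_integral /dotp exchange_big /=.
rewrite mulrAC mulr_sumr; apply: (le_trans (ler_norm_sum _ _ _)); apply: ler_sum => j _.
have := @simple_integral_bound s j setT 0 (C * M) (mulr_ge0 (ltW C0) M0) measurableT.
have -> : \sum_(x <- s) x.1 0 j * m (sval x.2 `&` setT) 0 j =
    \sum_(x <- s) x.1 0 j * m (sval x.2) 0 j.
  by apply: eq_bigr => x _; rewrite setIT.
rewrite mul0r addr0; apply; have := Linfty_norm_ae hN hM; apply: filterS => w hw _.
rewrite addr0; have -> : \sum_(x <- s) \1_(sval x.2) w * x.1 0 j = simple_vec s w 0 j.
  by rewrite /simple_vec summxE; apply: eq_bigr => x _; rewrite mxE.
by apply: (le_trans (hC _ _)); rewrite ler_pM2l.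
Qed.

(** [mint_bdd] is a choice from a set of functionals; extending [simple_integral] along the dense
    simple functions shows that this set is inhabited. *)
Lemma mint_bdd_spec : [/\ linear_on (Linfty P) (mint_bdd P N m),
  bounded_on (Linfty P) (Linfty_norm P N) (mint_bdd P N m)
  & forall A x, measurable A -> mint_bdd P N m (vrestr A (fun=> x)) = dotp x (m A)].
Proof.
have sL := @seminorm_on_Linfty _ _ _ P _ _ hN.
suff [ll cl el] : [/\ linear_on (Linfty P) (mint_bdd P N m),
    continuous_on (Linfty P) (Linfty_norm P N) (mint_bdd P N m) &
    extends_simple m (mint_bdd P N m)].
  split => //; first exact: (continuous_bounded_on sL).
  move=> A x mA; have := el 1%N (fun=> x) (fun=> A) (fun=> mA).
  rewrite big_ord1 => <-; congr mint_bdd; apply/funext => w.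
  by rewrite /vrestr big_ord1.
rewrite /mint_bdd; apply: (@xgetPex _ _ [set I | [/\ linear_on (Linfty P) I,
    continuous_on (Linfty P) (Linfty_norm P N) I & extends_simple m I]]).
have [K K0 hK] := simple_integral_le.
(* Rescaling the norm makes [simple_integral] dominated with factor 1, as the extension lemma asks;
   [K + 1] is positive even when [K = 0]. *)
pose p u := ((K + 1)%:E * Linfty_norm P N u)%E.
have K1 : 0 < K + 1 by rewrite ltr_wpDl.
have sp : seminorm_on (Linfty P) p.
  case: sL => L0 LZD Lp LZ LD; split => //.
  - move=> u Lu; have /andP[p0 poo] := Lp _ Lu; rewrite /p mule_ge0 ?lee_fin ?(ltW K1)//=.
    by rewrite lte_mul_pinfty// lee_fin ltW.
  - by move=> c u Lu; rewrite /p LZ// muleCA.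
  - move=> u v Lu Lv; rewrite /p -ge0_muleDr; last 2 first.
    + by have /andP[] := Lp _ Lu.
    + by have /andP[] := Lp _ Lv.
    by rewrite lee_wpmul2l ?LD// lee_fin ltW.
have [|c i j|s|u Lu e e0|I [Il Ib Is]] :=
    dense_linear_extension sp (s := simple_vec) (L := simple_integral).
- exact: (Linfty_simple_vec P hN).
- exists ([seq (c *: x.1, x.2) | x <- i] ++ j).
    rewrite simple_vec_cat; congr (_ + _); apply/funext => w.
    rewrite /simple_vec big_map fctE /= scaler_sumr.
    by apply: eq_bigr => x _ /=; rewrite !scalerA mulrC.
  rewrite /simple_integral big_cat big_map /= mulr_sumr; congr (_ + _).
  by apply: eq_bigr => x _; rewrite dotpZl.
- apply: (le_trans (hK s)); rewrite lee_wpmul2r ?lee_fin ?lerDl//.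
  by have /andP[] : (0 <= Linfty_norm P N (simple_vec s) < +oo)%E
    by case: sL => _ _ + _ _; apply; exact: (Linfty_simple_vec P hN).
- have [s hs] := simple_vec_dense hN Lu (divr_gt0 e0 K1); exists s.
  by rewrite /p muleC -lte_pdivlMr// -EFinM.
exists I; split => //.
  apply: (bounded_continuous_on sL) => //; exists (K + 1); first exact: ltW.
  exact: Ib.
move=> k alpha A mA.
have := Is [seq (alpha j, exist _ _ (mA j)) | j <- index_enum 'I_k].
by rewrite /simple_integral /simple_vec big_map; under eq_fun do rewrite big_map.
Qed.

End bounded_additive_measures.

(** * Truncation of a real to a symmetric interval *)

Section clip.
Context {R : realType}.
Implicit Types a b : R.

Definition clip a b : R := Num.max (- a) (Num.min a b).

Lemma norm_clip a b : 0 <= a -> `|clip a b| = Num.min a `|b|.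
Proof.
move=> a0; rewrite /clip; have [b0|b0] := leP 0 b.
  rewrite (ger0_norm b0); have [ab|ba] := leP a b.
    by rewrite max_r ?ger0_norm//; lra.
  by rewrite max_r ?ger0_norm//; lra.
have -> : Num.min a b = b by apply: min_r; lra.
rewrite (ltr0_norm b0); have [ab|ba] := leP a (- b).
  by rewrite max_l ?normrN ?ger0_norm//; lra.
by rewrite max_r ?ltr0_norm//; lra.
Qed.

Lemma norm_subr_clip a b : 0 <= a -> `|b - clip a b| = `|b| - Num.min a `|b|.
Proof.
move=> a0; rewrite /clip; have [b0|b0] := leP 0 b.
  rewrite (ger0_norm b0); have [ab|ba] := leP a b.
    by rewrite max_r ?ger0_norm ?subr_ge0//; lra.
  by rewrite max_r ?subrr ?normr0//; lra.
have -> : Num.min a b = b by apply: min_r; lra.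
rewrite (ltr0_norm b0); have [ab|ba] := leP a (- b).
  rewrite max_l; last by lra.
  by rewrite opprK ler0_norm ?opprD//; lra.
by rewrite max_r ?subrr ?normr0//; lra.
Qed.

Lemma norm_clip_le a b : 0 <= a -> `|clip a b| <= a.
Proof. by move=> a0; rewrite norm_clip// ge_min lexx. Qed.

Lemma norm_clip_ler a b : 0 <= a -> `|clip a b| <= `|b|.
Proof. by move=> a0; rewrite norm_clip// ge_min lexx orbT. Qed.

Lemma norm_subr_clip_le a a' b : 0 <= a -> 0 <= a' -> `|b| <= a + a' ->
  `|b - clip a b| <= a'.
Proof. by move=> a0 a'0 h; rewrite norm_subr_clip//; case: (leP a `|b|) => ?; lra. Qed.

End clip.

(** * The seminorm [rho] and the extension of the integral beyond L^infty *)

Section integral_singular.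
Context {d : measure_display} {T : measurableType d} {R : realType}.
Context {P : probability T R} {n : nat}.
Context {N : 'rV[R]_n -> R} (hN : is_norm N).
Implicit Types (u v y : T -> 'rV[R]_n) (A B : set T).

Lemma L1P u : L1 P u <-> forall j, P.-integrable setT (fun w => (u w 0 j)%:E).
Proof. by split=> h j; [exact/Lfun1_integrable/h|apply/Lfun1_integrable; exact: h]. Qed.

Lemma L1_measurable u : L1 P u -> measurable_vec u.
Proof. by move/L1P => h j; have /measurable_int/measurable_EFinP := h j. Qed.

Lemma L1ZD (c : R) u v : L1 P u -> L1 P v -> L1 P (c *: u + v).
Proof.
move=> /L1P hu /L1P hv; apply/L1P => j.
apply: (@eq_integrable _ _ _ _ _ measurableT
  ((fun w => c%:E * (u w 0 j)%:E) \+ (fun w => (v w 0 j)%:E))%E).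
  by move=> w _; rewrite !mxE EFinD EFinM.
by apply: integrableD => //; exact: integrableZl.
Qed.

Lemma Linfty_L1 u : Linfty P u -> L1 P u.
Proof.
move=> /(Linfty_coordP P hN)[mu [M [M0 hM]]]; apply/L1P => j.
apply/integrableP; split; first exact/measurable_EFinP/mu.
apply: (@le_lt_trans _ _ (M%:E * P setT)%E).
  apply: integral_le_bound => //; first exact/measurable_EFinP/mu.
  by apply: filterS hM => w h _; rewrite lee_fin.
by rewrite probability_setT mule1 ltry.
Qed.

Lemma L1_0 : L1 P (0 : T -> 'rV[R]_n).
Proof. exact/Linfty_L1/(Linfty0 P hN). Qed.

Context {m : set T -> 'rV[R]_n} (hm : M1 P m).

Let I := mint_bdd P N m.
Let sL := @seminorm_on_Linfty _ _ _ P _ _ hN.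

Lemma mint_bdd_linear : linear_on (Linfty P) I.
Proof. by have [] := mint_bdd_spec hm hN. Qed.

Lemma mint_bdd_le : exists2 K : R, 0 <= K &
  forall u (M : R), 0 <= M -> Linfty P u -> {ae P, forall w j, `|u w 0 j| <= M} -> `|I u| <= K * M.
Proof.
have [_ [K K0 hK] _] := mint_bdd_spec hm hN; have [C C0 hC] := vnorm_le_coord hN.
exists (K * C); first by rewrite mulr_ge0// ltW.
move=> u M M0 Lu hM; rewrite -lee_fin; apply: (le_trans (hK _ Lu)).
rewrite -mulrA EFinM lee_wpmul2l ?lee_fin//; apply/Linfty_norm_leP => //.
  by rewrite mulr_ge0// ltW.
by apply: filterS hM => w h; exact: hC.
Qed.

Lemma mint_bdd_ae0 u : Linfty P u -> {ae P, forall w j, u w 0 j = 0} -> I u = 0.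
Proof.
move=> Lu u0; have [K K0 hK] := mint_bdd_le.
apply/eqP; rewrite -normr_le0 -(mulr0 K); apply: hK => //.
by apply: filterS u0 => w h j; rewrite h normr0.
Qed.

Lemma le_rho u v : Linfty P v -> {ae P, forall w j, `|v w 0 j| <= `|u w 0 j|} ->
  ((I v)%:E <= rho P N m u)%E.
Proof.
move=> Lv vu; apply: ereal_sup_ubound; exists v => //; split => // j.
by apply: filterS vu => w; exact.
Qed.

Lemma rho_le u (x : \bar R) : (forall v, Linfty P v ->
  {ae P, forall w j, `|v w 0 j| <= `|u w 0 j|} -> ((I v)%:E <= x)%E) ->
  (rho P N m u <= x)%E.
Proof.
move=> h; apply: ge_ereal_sup => _ [v [Lv vu] <-]; apply: h => //.
exact: ae_forall_ord.
Qed.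

Lemma norm_le_rho u v : Linfty P v -> {ae P, forall w j, `|v w 0 j| <= `|u w 0 j|} ->
  (`|I v|%:E <= rho P N m u)%E.
Proof.
move=> Lv vu; have [I0|I0] := leP 0 (I v).
  by rewrite ger0_norm//; exact: le_rho.
rewrite ltr0_norm// -mulN1r -(linear_onZ mint_bdd_linear (Linfty0 P hN))//.
apply: le_rho; first exact: (LinftyZ hN).
by apply: filterS vu => w h j; rewrite mxE normrM normrN1 mul1r.
Qed.

Lemma rho_ge0 u : (0 <= rho P N m u)%E.
Proof.
have := @le_rho u 0 (Linfty0 P hN).
rewrite (linear_on0 mint_bdd_linear (Linfty0 P hN)); apply.
by apply: aeW => w j; rewrite mxE normr0.
Qed.

Lemma rhoZ_le (c : R) u : (rho P N m u < +oo)%E ->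
  (rho P N m (c *: u) <= `|c|%:E * rho P N m u)%E.
Proof.
move=> uoo; apply: rho_le => v Lv vu; have [c0|c0] := eqVneq c 0.
  rewrite c0 normr0 mul0e mint_bdd_ae0//; apply: filterS vu => w h j.
  by have := h j; rewrite c0 scale0r mxE normr0 normr_le0 => /eqP.
have c0' : 0 < `|c| by rewrite normr_gt0.
rewrite -lee_pdivrMl// -EFinM -(linear_onZ mint_bdd_linear (Linfty0 P hN))//.
apply: le_rho; first exact: (LinftyZ hN).
apply: filterS vu => w h j; rewrite mxE normrM normfV normr_id ler_pdivrMl//.
by have := h j; rewrite mxE normrM.
Qed.

(** Riesz decomposition: a vector dominated by [|u| + |v|] splits, coordinate by coordinate, into
    its truncation at [|u|] and a remainder dominated by [|v|]. *)
Lemma rhoD_le u v : measurable_vec u -> measurable_vec v ->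
  (rho P N m (u + v)%R <= rho P N m u + rho P N m v)%E.
Proof.
move=> mu mv; apply: rho_le => z Lz zuv.
pose z1 : T -> 'rV[R]_n := fun w => \row_j clip `|u w 0 j| (z w 0 j).
have mz := Linfty_measurable hN Lz.
have mz1 : measurable_vec z1.
  move=> j; rewrite (_ : (fun w => _) = (fun w => clip `|u w 0 j| (z w 0 j))).
    apply: measurable_maxr; first by apply: measurableT_comp => //; exact: measurableT_comp.
    by apply: measurable_minr => //; exact: measurableT_comp.
  by apply/funext => w; rewrite mxE.
have Lz1 : Linfty P z1.
  apply: (Linfty_coord_ge hN mz1 Lz); apply: aeW => w j.
  by rewrite mxE norm_clip_ler.
have -> : z = z1 + (z - z1) by rewrite addrC subrK.
rewrite (linear_onD mint_bdd_linear)//; last exact: (LinftyB hN).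
rewrite EFinD leeD//; apply: le_rho => //.
- by apply: aeW => w j; rewrite mxE norm_clip_le.
- exact: (LinftyB hN).
- apply: filterS zuv => w h j; rewrite coordB mxE norm_subr_clip_le//.
  by apply: (le_trans (h j)); rewrite mxE; exact: ler_normD.
Qed.

Lemma Linfty_dom_rho u : Linfty P u -> dom_rho P N m u.
Proof.
move=> Lu; split; first exact: Linfty_L1.
have [K K0 hK] := mint_bdd_le; have /(Linfty_coordP P hN)[mu [M [M0 hM]]] := Lu.
apply: (@le_lt_trans _ _ (K * M)%:E); last exact: ltry.
apply: rho_le => v Lv vu; rewrite lee_fin; apply: (le_trans (ler_norm _)).
apply: hK => //; apply: filterS2 vu hM => w h1 h2 j.
exact: le_trans (h1 j) (h2 j).
Qed.

Lemma seminorm_on_rho : seminorm_on (dom_rho P N m) (rho P N m).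
Proof.
have ZD (c : R) u v : dom_rho P N m u -> dom_rho P N m v -> dom_rho P N m (c *: u + v).
  move=> [Lu uoo] [Lv voo]; split; first exact: L1ZD.
  have mu := L1_measurable Lu.
  apply: le_lt_trans (rhoD_le (measurable_vecZ c mu) (L1_measurable Lv)) _.
  rewrite lte_add_pinfty//; apply: (le_lt_trans (rhoZ_le c uoo)).
  by rewrite lte_mul_pinfty// lee_fin.
have d0 := Linfty_dom_rho (Linfty0 P hN).
split => //.
- by move=> u [_ uoo]; rewrite rho_ge0.
- move=> c u [Lu uoo]; apply/le_anti/andP; split; first exact: rhoZ_le.
  have [->|c0] := eqVneq c 0; first by rewrite normr0 mul0e rho_ge0.
  have [_ cuoo] : dom_rho P N m (c *: u) by rewrite -[c *: u]addr0; exact: ZD.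
  rewrite -lee_pdivlMl ?normr_gt0// -normfV.
  by have := rhoZ_le c^-1 cuoo; rewrite scalerA mulVf// scale1r.
- by move=> u v [Lu _] [Lv _]; apply: rhoD_le; exact: L1_measurable.
Qed.

(* If v is nearly optimal for rho u and bounded by M, then v + v' competes in
   rho u for every v' competing in the seminorm of u - clip M u. *)
Lemma Linfty_rho_dense u : dom_rho P N m u -> forall e : R, 0 < e ->
  exists2 v, Linfty P v & (rho P N m (u - v)%R < e%:E)%E.
Proof.
move=> [Lu uoo] e e0; have mu := L1_measurable Lu.
have fu : rho P N m u \is a fin_num by rewrite ge0_fin_numE// rho_ge0.
have e20 : 0 < e / 2 by rewrite divr_gt0.
have [_ [v [Lv vu] <-] hv] := ub_ereal_sup_adherent e20 fu.
have /(Linfty_coordP P hN)[mv [M [M0 hM]]] := Lv.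
pose z : T -> 'rV[R]_n := fun w => \row_j clip M (u w 0 j).
have mz : measurable_vec z.
  move=> j; rewrite (_ : (fun w => _) = (fun w => clip M (u w 0 j))).
    apply: measurable_maxr => //; exact: measurable_minr.
  by apply/funext => w; rewrite mxE.
exists z.
  apply/(Linfty_coordP P hN); split => //; exists M; split => //.
  by apply: aeW => w j; rewrite mxE norm_clip_le.
apply: (@le_lt_trans _ _ (e / 2)%:E); last by rewrite lte_fin; lra.
apply: rho_le => v' Lv' v'u.
have : ((I (v + v'))%:E <= rho P N m u)%E.
  apply: le_rho; first exact: (LinftyD hN).
  have := ae_forall_ord vu; apply: filterS3 hM v'u => w h1 h2 h3 j.
  have := h2 j; have := h1 j; have := h3 j.
  rewrite coordB !mxE norm_subr_clip//.
  by have := ler_normD (v w 0 j) (v' w 0 j); case: (leP M `|u w 0 j|); lra.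
rewrite (linear_onD mint_bdd_linear)// -(fineK fu) lee_fin => h1.
move: hv; rewrite -/(rho P N m u) -(fineK fu) lte_fin lee_fin -/I; lra.
Qed.

(** Continuity of the chosen functional gives a bound by [rho] with some constant only. By density
    it coincides with the extension [J], whose constant is 1. *)
Lemma mint_spec : [/\ linear_on (dom_rho P N m) (mint P N m),
  (forall u, dom_rho P N m u -> (`|mint P N m u|%:E <= rho P N m u)%E)
  & forall u, Linfty P u -> mint P N m u = mint_bdd P N m u].
Proof.
have [|c i j|i|u Du e e0|J [Jl Jb JI]] := dense_linear_extension seminorm_on_rho
    (s := fun v : {v | Linfty P v} => sval v) (L := fun v : {v | Linfty P v} => I (sval v)).
- by move=> [v Lv] /=; exact: Linfty_dom_rho.
- case: i j => [i Li] [j Lj] /=.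
  exists (exist _ (c *: i + j) (LinftyZD hN c Li Lj)) => //=.
  exact: mint_bdd_linear.
- by case: i => i Li /=; apply: norm_le_rho => //; exact: aeW.
- by have [v Lv h] := Linfty_rho_dense Du e0; exists (exist _ v Lv).
have [Ml Mc MI] : [/\ linear_on (dom_rho P N m) (mint P N m),
    continuous_on (dom_rho P N m) (rho P N m) (mint P N m)
    & forall u, Linfty P u -> mint P N m u = mint_bdd P N m u].
  rewrite /mint; apply: (@xgetPex _ _ [set J | [/\ linear_on (dom_rho P N m) J,
    continuous_on (dom_rho P N m) (rho P N m) J
    & forall u, Linfty P u -> J u = mint_bdd P N m u]]).
  exists J; split => //.
    apply: (bounded_continuous_on seminorm_on_rho) => //.
    by exists 1 => // u Du; rewrite mul1e Jb.
  by move=> u Lu; have := JI (exist _ u Lu).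
split => // u Du; suff -> : mint P N m u = J u by exact: Jb.
apply/eqP; rewrite -subr_eq0; apply/eqP.
have [K K0 hK] := continuous_bounded_on seminorm_on_rho Ml Mc.
apply: (@dense_linear_on_eq0 _ _ _ _ seminorm_on_rho (Linfty P)
  (fun u => mint P N m u - J u)) => //.
- exact: Linfty_dom_rho.
- exact: Linfty_rho_dense.
- by move=> c x y Dx Dy; rewrite Ml// Jl//; ring.
- exists (K + 1); first by rewrite addr_ge0.
  move=> x Dx; rewrite EFinD ge0_muleDl ?lee_fin// mul1e.
  apply: le_trans (leeD (hK _ Dx) (Jb _ Dx)); rewrite -EFinD lee_fin.
  exact: ler_normB.
- by move=> v Lv; rewrite MI// (JI (exist _ v Lv)) subrr.
Qed.

End integral_singular.

(** * The integrand and the modular *)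

Section lower_semicontinuous_hull.
Context {d : measure_display} {T : measurableType d} {R : realType}.
Context (Phi : R -> T -> \bar R).
Hypothesis Phi_ge0 : forall xi w, (0 <= Phi xi w)%E.
Hypothesis Phi_convex : random_convex Phi.
Hypothesis Phi_sym : forall xi w, Phi (- xi) w = Phi xi w.
Hypothesis Phi0 : forall w, Phi 0 w = 0%E.

Lemma Phi_convexE (t x y : R) (w : T) : 0 <= t <= 1 ->
  (Phi (t * x + (1 - t) * y) w <= t%:E * Phi x w + (1 - t)%:E * Phi y w)%E.
Proof.
move=> /andP[t0 t1]; have t1' : 0 <= 1 - t by lra.
have [->|tn0] := eqVneq t 0.
  by rewrite mul0r add0r subr0 mul1r mul0e add0e mul1e.
have [->|tn1] := eqVneq t 1.
  by rewrite mul1r subrr mul0r addr0 mul1e mul0e adde0.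
have tp : 0 < t by rewrite lt_neqAle eq_sym tn0.
have tp' : 0 < 1 - t by rewrite lt_neqAle eq_sym subr_eq0 eq_sym tn1.
have := Phi_ge0 x w; have := Phi_ge0 y w.
case Ex : (Phi x w) => [a| |//]; case Ey : (Phi y w) => [b| |//] a0 b0; last 3 first.
- by rewrite gt0_muley ?lte_fin// addeC -EFinM leey.
- by rewrite gt0_muley ?lte_fin// -EFinM leey.
- by rewrite !gt0_muley ?lte_fin// leey.
have [/(_ w) cvx _] := Phi_convex.
have := cvx ((x, a) : R^o * R^o) (y, b) (Itv01 t0 t1).
rewrite !inE /epi /= Ex Ey !lexx => /(_ isT isT).
by rewrite -!EFinM -EFinD.
Qed.

(** [x] is a convex combination of [y] and 0, and [Phi] vanishes at 0. *)
Lemma le_Phi (x y : R) (w : T) : 0 <= x -> x <= y -> (Phi x w <= Phi y w)%E.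
Proof.
move=> x0 xy; have [y0|y0] := leP y 0.
  by have -> : x = y by lra.
have t01 : 0 <= x / y <= 1.
  by apply/andP; split; [rewrite divr_ge0// ltW|rewrite ler_pdivrMr// mul1r].
have := Phi_convexE y 0 w t01; rewrite mulr0 addr0 Phi0 mule0 adde0.
rewrite divfK ?gt_eqF// => /le_trans; apply.
by rewrite gee_pMl ?lee_fin//; case/andP: t01.
Qed.

(** For [q >= 0] this is the right limit of [Phi] at [q], by monotonicity. That it lies below [c]
    says that the epigraph meets the open set [q < z], [a < c], which is what the measurability of
    [epi Phi] controls. *)
Definition hull_level (q : R) (w : T) : \bar R :=
  ereal_inf [set Phi z w | z in [set z | q < z]].

Definition rational_seq (k : nat) : R := ratr (odflt 0 (unpickle k) : rat).

(* Lower semicontinuous hull of Phi, written so that its measurability follows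
   from that of the epigraphs, which only see Phi up to closure. *)
Definition hull (x : R) (w : T) : \bar R := ereal_sup (range (fun k =>
  if (0 <= rational_seq k) && (rational_seq k < `|x|) then
    hull_level (rational_seq k) w else 0%E)).

Lemma measurable_hull_level q : measurable_fun setT (hull_level q).
Proof.
apply: (measurability _ (ErealGenCInfty.measurableE R)) => //.
move=> _ [_ [c ->] <-]; rewrite setTI.
rewrite [X in measurable X](_ : _ = ~` [set w | hull_level q w < c%:E]%E); last first.
  apply/seteqP; split=> w /=; rewrite in_itv /= andbT leNgt; first by move/negP.
  by move=> h; apply/negP.
apply: measurableC.
have [_ /(_ [set p : R^o * R^o | q < p.1 /\ p.2 < c])] := Phi_convex.
rewrite (_ : [set w | _] = [set w | (hull_level q w < c%:E)%E]).
  apply.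
  apply: (@openI _ (fst @^-1` [set z : R^o | q < z]) (snd @^-1` [set z : R^o | z < c])).
    by apply: open_comp; [move=> p _; exact: cvg_fst|exact: open_gt].
  by apply: open_comp; [move=> p _; exact: cvg_snd|exact: open_lt].
apply/seteqP; split=> w /=.
  move=> [[z a] [/= za [qz ac]]].
  apply: (@le_lt_trans _ _ a%:E); last by rewrite lte_fin.
  by apply: le_trans za; apply: ereal_inf_lbound; exists z.
move=> /ereal_inf_lt[_ [z qz <-]] zc; exists (z, fine (Phi z w)); split => /=.
  by rewrite /epi /= fineK// ge0_fin_numE// (lt_trans zc)// ltry.
by split=> //; rewrite -lte_fin fineK// ge0_fin_numE// (lt_trans zc)// ltry.
Qed.

Lemma measurable_hull (f : T -> R) : measurable_fun setT f ->
  measurable_fun setT (fun w => hull (f w) w).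
Proof.
move=> mf; apply: measurable_ereal_sup_seq => k.
apply: measurable_fun_ifT => //; last exact: measurable_hull_level.
apply: measurable_and => //; apply: measurable_fun_ltr => //.
exact: measurableT_comp.
Qed.

Lemma hull_ge0 x w : (0 <= hull x w)%E.
Proof.
(* The index of a negative rational contributes the term 0. *)
apply: ereal_sup_ubound; exists (pickle (-1 : rat)) => //.
by rewrite /rational_seq pickleK /= rmorphN1 oppr_ge0 ler10.
Qed.

Lemma hull_le x w : (hull x w <= Phi x w)%E.
Proof.
apply: ge_ereal_sup => _ [k _ <-]; case: ifPn => // /andP[q0 qx].
have -> : Phi x w = Phi `|x| w.
  by have [x0|x0] := leP 0 x; [rewrite ger0_norm|rewrite ltr0_norm ?Phi_sym].
by apply: ereal_inf_lbound; exists `|x|.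
Qed.

Lemma le_hull x y w : `|x| <= `|y| -> (hull x w <= hull y w)%E.
Proof.
move=> xy; apply: ge_ereal_sup => _ [k _ <-]; case: ifPn => [/andP[q0 qx]|_].
  apply: ereal_sup_ubound; exists k => //.
  by rewrite q0 (lt_le_trans qx xy).
exact: hull_ge0.
Qed.

Lemma hull0 w : hull 0 w = 0%E.
Proof. by apply/le_anti; rewrite hull_ge0 andbT -(Phi0 w) hull_le. Qed.

(** Together with [hull_le] this places the hull between [Phi] at smaller arguments and [Phi] at the
    same argument, so the two differ at most by a jump at the end of the domain. *)
Lemma Phi_le_hull x y w : 0 <= x -> x < `|y| -> (Phi x w <= hull y w)%E.
Proof.
move=> x0 xy; have [q] := rat_in_itvoo xy; rewrite in_itv /= => /andP[xq qy].
apply: (@le_trans _ _ (hull_level (ratr q) w)).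
  apply: le_ereal_inf_tmp => _ [z /= qz <-]; apply: le_Phi => //.
  exact/ltW/(lt_trans xq).
apply: ereal_sup_ubound; exists (pickle q) => //.
by rewrite /rational_seq pickleK /= (le_trans x0 (ltW xq)) qy.
Qed.

Lemma Phi_scale_le_hull t x w : 0 <= t < 1 -> 0 <= x -> (Phi (t * x) w <= hull x w)%E.
Proof.
move=> /andP[t0 t1]; rewrite le_eqVlt => /predU1P[<-|x0].
  by rewrite mulr0 Phi0 hull0.
apply: Phi_le_hull; first by rewrite mulr_ge0// ltW.
by rewrite gtr0_norm// gtr_pMl.
Qed.

(** Lower semicontinuity takes the form of left continuity in [|y|], the hull being monotone
    there. *)
Lemma hull_lsc y w (c : \bar R) : (0 <= c)%E ->
  (forall x, 0 <= x -> x < `|y| -> (hull x w <= c)%E) -> (hull y w <= c)%E.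
Proof.
move=> c0 h; apply: ge_ereal_sup => _ [k _ <-]; case: ifPn => // /andP[q0 qy].
pose z := (rational_seq k + `|y|) / 2; pose x := (z + `|y|) / 2.
have zx : z < x by rewrite /x /z; lra.
have z0 : 0 <= z by rewrite /z; lra.
apply: (@le_trans _ _ (Phi z w)).
  by apply: ereal_inf_lbound; exists z => //=; rewrite /z; lra.
apply: (@le_trans _ _ (hull x w)).
  by apply: Phi_le_hull => //; rewrite ger0_norm//; lra.
by apply: h; rewrite /x /z; lra.
Qed.

(** By [hull_lsc] it suffices to treat [l] times the convex combination with [l < 1]; there [Phi] is
    convex, and [Phi] at a shrunken point is below the hull at the original one. *)
Lemma hull_convex (t x y : R) (w : T) : 0 <= t <= 1 -> 0 <= x -> 0 <= y ->
  (hull (t * x + (1 - t) * y) w <= t%:E * hull x w + (1 - t)%:E * hull y w)%E.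
Proof.
move=> t01 x0 y0; have /andP[t0 t1] := t01; have t1' : 0 <= 1 - t by lra.
have s0 : 0 <= t * x + (1 - t) * y by rewrite addr_ge0// mulr_ge0.
apply: hull_lsc => [|z z0].
  by rewrite adde_ge0// mule_ge0// ?lee_fin// hull_ge0.
rewrite ger0_norm// => zs.
pose l := z / (t * x + (1 - t) * y).
have sp : 0 < t * x + (1 - t) * y by exact: le_lt_trans zs.
have l01 : 0 <= l < 1 by rewrite /l divr_ge0//= ltr_pdivrMr// mul1r.
have -> : z = t * (l * x) + (1 - t) * (l * y).
  by rewrite (mulrCA t) (mulrCA (1 - t)) -mulrDr /l divfK// gt_eqF.
apply: (le_trans (hull_le _ _)); apply: (le_trans (Phi_convexE _ _ _ t01)).
by apply: leeD; rewrite lee_wpmul2l ?lee_fin// Phi_scale_le_hull.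
Qed.

Lemma hullZ_le (t x : R) (w : T) : 0 <= t <= 1 -> 0 <= x ->
  (hull (t * x) w <= t%:E * hull x w)%E.
Proof.
move=> t01 x0; have := hull_convex w t01 x0 (lexx 0).
by rewrite mulr0 addr0 hull0 mule0 adde0.
Qed.

Lemma conjugate_ge0 eta w : (0 <= conjugate Phi eta w)%E.
Proof.
apply: ereal_sup_ubound; exists 0 => //.
by rewrite mul0r Phi0 sube0.
Qed.

(** The Fenchel-Young inequality for [Phi] at [l * x] with [l < 1], where [Phi] is below the hull at
    [x]; then [l] tends to 1. *)
Lemma hull_conjugate x eta w : 0 <= x ->
  ((x * eta)%:E <= hull x w + conjugate Phi eta w)%E.
Proof.
move=> x0; have := hull_ge0 x w; have := conjugate_ge0 eta w.
case Eb : (hull x w) => [b| |//]; last first.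
  by move=> c0 _; rewrite addye ?leey//; apply: contraTneq c0 => ->.
case Ec : (conjugate Phi eta w) => [c| |//] c0 b0; last by rewrite addey// leey.
rewrite -EFinD lee_fin.
have h l : 0 <= l < 1 -> l * (x * eta) <= b + c.
  move=> l01; have := Phi_scale_le_hull w l01 x0; rewrite Eb => hb.
  have : ((l * x * eta)%:E - Phi (l * x) w <= c%:E)%E.
    by rewrite -Ec; apply: ereal_sup_ubound; exists (l * x).
  have := Phi_ge0 (l * x) w; move: hb.
  case: (Phi (l * x) w) => [e| |] //; rewrite !lee_fin => h1 h2 h3.
  by rewrite mulrA; lra.
rewrite leNgt; apply/negP => bc.
have bc0 : 0 <= b + c by move: c0 b0; rewrite !lee_fin; lra.
have xe0 : 0 < x * eta by lra.
(* The midpoint between [(b + c) / (x * eta)] and 1 is an admissible factor at which [h] would be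
   violated. *)
have /h : 0 <= ((b + c) / (x * eta) + 1) / 2 < 1.
  have : (b + c) / (x * eta) < 1 by rewrite ltr_pdivrMr// mul1r.
  have : 0 <= (b + c) / (x * eta) by rewrite divr_ge0// ltW.
  by move=> h1 h2; apply/andP; split; lra.
rewrite mulrAC mulrDl mul1r divfK ?gt_eqF//; lra.
Qed.

End lower_semicontinuous_hull.

Section limit_inferior.
Context {R : realType}.
Implicit Types (u : (\bar R)^nat) (c : \bar R).

Lemma le_limn_einf u c : (\forall k \near \oo, c <= u k)%E -> (c <= limn_einf u)%E.
Proof.
move=> [k0 _ h]; rewrite limn_einf_lim; apply: lime_ge; first exact: is_cvg_einfs.
exists k0 => // k /= kk0; apply: le_ereal_inf_tmp => _ [l /= kl <-]; apply: h => /=.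
exact: leq_trans kk0 kl.
Qed.

Lemma limn_einf_le u c : (forall k, u k <= c)%E -> (limn_einf u <= c)%E.
Proof.
move=> h; rewrite limn_einf_lim; apply: lime_le; first exact: is_cvg_einfs.
apply: nearW => k; apply: le_trans (h k); apply: ereal_inf_lbound.
by exists k => /=.
Qed.

End limit_inferior.

(** * The modular and the Luxemburg norm *)

Definition modular d (T : measurableType d) (R : realType) (P : probability T R)
    n (N : 'rV[R]_n -> R) (Phi : R -> T -> \bar R) (u : T -> 'rV[R]_n) : \bar R :=
  (\int[P]_w hull Phi (N (u w)) w)%E.

Section modular.
Context {d : measure_display} {T : measurableType d} {R : realType}.
Context {P : probability T R} {n : nat} {N : 'rV[R]_n -> R} (hN : is_norm N).
Context {Phi : R -> T -> \bar R}.
Hypothesis Phi_ge0 : forall xi w, (0 <= Phi xi w)%E.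
Hypothesis Phi_convex : random_convex Phi.
Hypothesis Phi_sym : forall xi w, Phi (- xi) w = Phi xi w.
Hypothesis Phi0 : forall w, Phi 0 w = 0%E.
Implicit Types (u v y : T -> 'rV[R]_n).

Local Notation Psi := (hull Phi).

Local Notation E := (modular P N Phi).

Let N0 x : 0 <= N x. Proof. exact: vnorm_ge0. Qed.

Let Psi0 x w : (0 <= Psi x w)%E. Proof. exact: hull_ge0. Qed.

Lemma measurable_modular u : measurable_vec u ->
  measurable_fun setT (fun w => Psi (N (u w)) w).
Proof. by move=> mu; apply: measurable_hull => //; exact: measurable_vnorm. Qed.

Lemma modular_ge0 u : (0 <= E u)%E.
Proof. by apply: integral_ge0 => w _. Qed.

Lemma le_modular u v : measurable_vec u -> measurable_vec v ->
  {ae P, forall w, N (u w) <= N (v w)} -> (E u <= E v)%E.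
Proof.
move=> mu mv h; apply: ae_ge0_le_integral => //; try exact: measurable_modular.
by apply: filterS h => w h _; apply: le_hull => //; rewrite !ger0_norm.
Qed.

Lemma modular0 : E 0 = 0%E.
Proof.
rewrite /modular; under eq_integral => w _ do rewrite (vnorm0 hN) hull0//.
by rewrite integral0.
Qed.

Lemma modular_convex (t : R) u v : measurable_vec u -> measurable_vec v -> 0 <= t <= 1 ->
  (E (t *: u + (1 - t) *: v)%R <= t%:E * E u + (1 - t)%:E * E v)%E.
Proof.
move=> mu mv t01; have /andP[t0 t1] := t01; have t1' : 0 <= 1 - t by lra.
rewrite /modular -!ge0_integralZl//; try exact: measurable_modular.
rewrite -ge0_integralD//; last 4 first.
- by move=> w _; rewrite mule_ge0// lee_fin.
- by apply: measurable_funeM; exact: measurable_modular.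
- by move=> w _; rewrite mule_ge0// lee_fin.
- by apply: measurable_funeM; exact: measurable_modular.
apply: ge0_le_integral => //.
- by apply: measurable_modular; exact/measurable_vecZD/measurable_vecZ.
- by apply: emeasurable_funD; apply: measurable_funeM; exact: measurable_modular.
move=> w _; apply: le_trans (hull_convex Phi_ge0 Phi_convex Phi_sym Phi0 w t01 (N0 _) (N0 _)).
apply: le_hull => //; rewrite !ger0_norm ?addr_ge0 ?mulr_ge0//.
apply: (le_trans (vnormD hN _ _)).
by rewrite /= !vnormZ// !ger0_norm.
Qed.

Lemma modularZ_le (t : R) u : measurable_vec u -> 0 <= t <= 1 ->
  (E (t *: u)%R <= t%:E * E u)%E.
Proof.
move=> mu t01; have := modular_convex mu (measurable_vec_cst 0) t01.
rewrite (_ : (fun=> 0) = (0 : T -> 'rV[R]_n))//.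
by rewrite scaler0 addr0 modular0 mule0 adde0.
Qed.

Lemma modular_le_Efun u : (E u <= Efun P Phi (N \o u))%E.
Proof. by apply: ge0_le_lower_integral => // w; exact: hull_le. Qed.

Lemma Efun_scale_le_modular (t : R) u : 0 <= t < 1 ->
  (Efun P Phi (N \o (t *: u))%R <= E u)%E.
Proof.
move=> t01; apply: ge0_le_lower_integral => // w /=.
rewrite vnormZ// ger0_norm; last by case/andP: t01.
exact: Phi_scale_le_hull.
Qed.

(** Fatou's lemma. Pointwise, the norms of the sequence eventually exceed every [x] below the limit,
    so [hull_lsc] bounds the hull at the limit by the lower limit of the hulls. *)
Lemma modular_lsc (s : nat -> T -> 'rV[R]_n) u (c : \bar R) :
  (forall k, measurable_vec (s k)) -> measurable_vec u ->
  (forall k, E (s k) <= c)%E ->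
  {ae P, forall w, N (s k w) @[k --> \oo] --> N (u w)} -> (E u <= c)%E.
Proof.
move=> ms mu sc su; pose f k w := Psi (N (s k w)) w.
have mf k : measurable_fun setT (f k) by exact: measurable_modular.
apply: (@le_trans _ _ (\int[P]_w limn_einf (f ^~ w))%E).
  apply: ae_ge0_le_integral => //.
  - exact: measurable_modular.
  - by move=> w _; apply: le_limn_einf; apply: nearW => k; exact: Psi0.
  - rewrite /limn_einf; apply: measurableT_comp => //.
    apply: measurable_fun_limn_esup => k /=; exact: measurableT_comp.
  apply: filterS su => w hw _; apply: hull_lsc => //.
    by apply: le_limn_einf; apply: nearW => k; exact: Psi0.
  move=> x x0; rewrite ger0_norm// => xN; apply: le_limn_einf.
  have : \forall k \near \oo, x < N (s k w) by exact: cvgr_gt hw _ xN.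
  apply: filterS => k xk; apply: le_hull => //.
  by rewrite !ger0_norm// ltW.
apply: (le_trans (fatou P measurableT mf _)); first by move=> k w _; exact: Psi0.
by apply: limn_einf_le.
Qed.

Lemma modular_left_continuous u (c : \bar R) : measurable_vec u ->
  (forall t : R, 0 <= t < 1 -> (E (t *: u)%R <= c)%E) -> (E u <= c)%E.
Proof.
move=> mu h.
apply: (@modular_lsc (fun k => (1 - k.+1%:R^-1) *: u)) => //.
- by move=> k; exact: measurable_vecZ.
- move=> k; apply: h; rewrite subr_ge0 invf_le1 ?ler1n//=.

apply: aeW => w.
rewrite [X in X @ _ --> _](_ : _ = fun k => (1 - k.+1%:R^-1) * N (u w)).
  rewrite -[X in _ --> X]mul1r; apply: cvgMl.
  rewrite -[X in _ --> X]subr0; apply: cvgB; first exact: cvg_cst.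
  exact: cvg_harmonic.
apply/funext => k; rewrite /= vnormZ// ger0_norm//.
by rewrite subr_ge0 invf_le1 ?ler1n.
Qed.

Local Notation L := (luxemburg P N Phi).

Lemma Efun_div u (b : R) : 0 < b ->
  Efun P Phi (fun w => N (u w) / b) = Efun P Phi (N \o (b^-1 *: u)).
Proof.
move=> b0; rewrite /Efun; apply: eq_integral => w _ /=.
by rewrite vnormZ// gtr0_norm ?invr_gt0// mulrC.
Qed.

(** Left continuity of the modular makes the infimum attained. Conversely, enlarging [b] to [b + e]
    pays for the passage from the hull back to [Phi]. With this lemma the norm can be handled
    through [E], which is convex and lower semicontinuous. *)
Lemma luxemburg_leP u (b : R) : measurable_vec u -> 0 < b ->
  (L u <= b%:E)%E <-> (E (b^-1 *: u)%R <= 1)%E.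
Proof.
move=> mu b0; split=> [h|h]; last first.
  apply/lee_addgt0Pr => e e0; rewrite -EFinD; apply: ereal_inf_lbound.
  have be : 0 < b + e by lra.
  exists (b + e) => //; split => //; rewrite Efun_div//.
  apply: le_trans h; rewrite -[_ *: u](_ : (b / (b + e)) *: (b^-1 *: u) = _).
    apply: Efun_scale_le_modular; apply/andP; split; first by rewrite divr_ge0// ltW.
    by rewrite ltr_pdivrMr//; lra.
  by rewrite scalerA mulrAC divff ?mul1r// gt_eqF.
apply: modular_left_continuous; first exact: measurable_vecZ.
move=> t /andP[t0 t1]; move: t0; rewrite le_eqVlt => /predU1P[<-|t0].
  by rewrite scale0r modular0.
have bt : b < b / t by rewrite ltr_pdivlMr// gtr_pMr.
have /ereal_inf_lt[_ [c [c0 hc] <-]] : (L u < (b / t)%:E)%E.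
  by apply: (le_lt_trans h); rewrite lte_fin.
rewrite lte_fin => cb; apply: le_trans hc; rewrite Efun_div//.
apply: le_trans (modular_le_Efun _); apply: le_modular.
- by do 2 apply: measurable_vecZ.
- exact: measurable_vecZ.
apply: aeW => w /=; rewrite scalerA !vnormZ// ler_wpM2r//.
rewrite !gtr0_norm ?mulr_gt0 ?invr_gt0// -[t / b]invrK.
by rewrite lef_pV2 ?posrE ?invr_gt0 ?divr_gt0// invf_div ltW.
Qed.

Lemma luxemburg_ge0 u : (0 <= L u)%E.
Proof. by apply: le_ereal_inf_tmp => _ [b [b0 _] <-]; rewrite lee_fin ltW. Qed.

Lemma luxemburg_le u (b : R) : 0 <= b ->
  (forall c, b < c -> (L u <= c%:E)%E) -> (L u <= b%:E)%E.
Proof.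
move=> b0 h; apply/lee_addgt0Pr => e e0; rewrite -EFinD; apply: h.
by rewrite ltrDl.
Qed.

Lemma luxemburgZ_le (c : R) u : measurable_vec u -> (L u < +oo)%E ->
  (L (c *: u)%R <= `|c|%:E * L u)%E.
Proof.
move=> mu uoo; have fu : L u \is a fin_num by rewrite ge0_fin_numE// luxemburg_ge0.
rewrite -(fineK fu) -EFinM; set r := fine (L u).
have r0 : 0 <= r by apply: fine_ge0; exact: luxemburg_ge0.
apply: luxemburg_le => [|b]; first by rewrite mulr_ge0.
have [->|c0] := eqVneq c 0.
  rewrite normr0 mul0r => b0; apply/luxemburg_leP => //; first exact: measurable_vecZ.
  by rewrite scale0r scaler0 modular0.
have c0' : 0 < `|c| by rewrite normr_gt0.
rewrite mulrC -ltr_pdivlMr// => rb; have b0 : 0 < b / `|c| by exact: le_lt_trans rb.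
have bp : 0 < b by move: b0; rewrite pmulr_lgt0// invr_gt0.
apply/luxemburg_leP => //; first exact: measurable_vecZ.
have /luxemburg_leP : (L u <= (b / `|c|)%:E)%E by rewrite -(fineK fu) lee_fin ltW.
move=> /(_ mu b0); apply: le_trans; apply: le_modular.
- by do 2 apply: measurable_vecZ.
- exact: measurable_vecZ.
apply: aeW => w /=; rewrite !vnormZ// mulrA ler_wpM2r//.
by rewrite (gtr0_norm (_ : 0 < (b / `|c|)^-1)) ?invr_gt0// invf_div gtr0_norm ?invr_gt0// mulrC.
Qed.

Lemma luxemburgD_le u v : measurable_vec u -> measurable_vec v ->
  (L (u + v)%R <= L u + L v)%E.
Proof.
move=> mu mv; have := luxemburg_ge0 u; have := luxemburg_ge0 v.
case Eu : (L u) => [a| |//]; case Ev : (L v) => [b| |//] //; rewrite ?leey//.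
rewrite !lee_fin => b0 a0; rewrite -EFinD.
apply: luxemburg_le => [|c abc]; first exact: addr_ge0.
pose e := (c - (a + b)) / 2; have e0 : 0 < e by rewrite /e; lra.
have ae0 : 0 < a + e by lra.
have be0 : 0 < b + e by lra.
have cE : c = (a + e) + (b + e) by rewrite /e; lra.
have c0 : 0 < c by lra.
clearbody e.
apply/luxemburg_leP => //; first exact: measurable_vecD.
have /luxemburg_leP : (L u <= (a + e)%:E)%E by rewrite Eu lee_fin lerDl ltW.
move=> /(_ mu ae0) h1.
have /luxemburg_leP : (L v <= (b + e)%:E)%E by rewrite Ev lee_fin lerDl ltW.
move=> /(_ mv be0) h2.
(* [(u + v) / c] is the convex combination of the two normalized vectors with weights proportional
   to [a + e] and [b + e]. *)
pose t := (a + e) / c.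
have t01 : 0 <= t <= 1.
  apply/andP; split; first by rewrite divr_ge0// ltW.
  by rewrite ler_pdivrMr// mul1r cE; lra.
have -> : c^-1 *: (u + v) = t *: ((a + e)^-1 *: u) + (1 - t) *: ((b + e)^-1 *: v).
  rewrite scalerDr !scalerA; congr (_ *: _ + _ *: _).
    by rewrite /t; field; rewrite !gt_eqF.
  have -> : 1 - t = (b + e) / c by rewrite /t cE; field; rewrite -cE gt_eqF.
  by rewrite mulrAC divff ?mul1r// gt_eqF.
apply: (le_trans (modular_convex _ _ t01)); try exact: measurable_vecZ.
case/andP: t01 => t0 t1.
apply: (@le_trans _ _ (t%:E * 1 + (1 - t)%:E * 1)%E).
  by apply: leeD; rewrite lee_wpmul2l// lee_fin; lra.
by rewrite !mule1 -EFinD addrC subrK.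
Qed.

End modular.

(** * The Orlicz space between L^infty and L^1 *)

Section orlicz_space.
Context {d : measure_display} {T : measurableType d} {R : realType}.
Context {P : probability T R} {n : nat} {N : 'rV[R]_n -> R} (hN : is_norm N).
Context {Phi : R -> T -> \bar R}.
Hypothesis Phi_ge0 : forall xi w, (0 <= Phi xi w)%E.
Hypothesis Phi_convex : random_convex Phi.
Hypothesis Phi_sym : forall xi w, Phi (- xi) w = Phi xi w.
Hypothesis Phi0 : forall w, Phi 0 w = 0%E.
Hypothesis Phi_L1 : exists2 a : R, 0 < a &
  P.-integrable setT (Phi a) /\ P.-integrable setT (conjugate Phi a).
Implicit Types (u v y : T -> 'rV[R]_n).

Local Notation E := (modular P N Phi).
Local Notation L := (luxemburg P N Phi).
Local Notation LPhi := (orlicz P N Phi).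

Let Psi0 x w : (0 <= hull Phi x w)%E. Proof. exact: hull_ge0. Qed.

(* Young's inequality at the a for which Phi^*(a, .) is integrable. *)
Lemma expectation_le_modular : exists a c : R, [/\ 0 < a, 0 <= c &
  forall u, measurable_vec u ->
    (a%:E * \int[P]_w (N (u w))%:E <= E u + c%:E)%E].
Proof.
have [a a0 [_ ci]] := Phi_L1.
have c0 w : (0 <= conjugate Phi a w)%E by exact: conjugate_ge0.
have ic0 : (0 <= \int[P]_w conjugate Phi a w)%E by exact: integral_ge0.
have fc : (\int[P]_w conjugate Phi a w)%E \is a fin_num.
  by apply: integrable_fin_num.
exists a, (fine (\int[P]_w conjugate Phi a w)%E); split=> //; first exact: fine_ge0.
move=> u mu; rewrite fineK// -ge0_integralZl//; last 3 first.
- exact/measurable_EFinP/measurable_vnorm.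
- by move=> w _; rewrite lee_fin vnorm_ge0.
- by rewrite lee_fin ltW.
have mc := measurable_int _ ci.
have mE := measurable_modular hN Phi_ge0 Phi_convex mu.
rewrite -ge0_integralD//; apply: ge0_le_integral => //.
- by move=> w _; rewrite mule_ge0// lee_fin ?vnorm_ge0// ltW.
- by apply: measurable_funeM; exact/measurable_EFinP/measurable_vnorm.
- exact: emeasurable_funD.
by move=> w _; rewrite -EFinM mulrC; apply: hull_conjugate => //; exact: vnorm_ge0.
Qed.

Lemma modular_lty_L1 u (b : R) : 0 < b -> measurable_vec u ->
  (E (b *: u)%R < +oo)%E -> L1 P u.
Proof.
move=> b0 mu Eu; have [a [c [a0 c0 h]]] := expectation_le_modular.
have [C C0 hC] := coord_le_vnorm hN.
have {}h := h _ (measurable_vecZ b mu).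
have iN : P.-integrable setT (fun w => (N ((b *: u) w))%:E).
  apply/integrableP; split; first exact/measurable_EFinP/measurable_vnorm/measurable_vecZ.
  under eq_integral => w _ do rewrite gee0_abs ?lee_fin ?vnorm_ge0//.
  have : (a%:E * \int[P]_w (N ((b *: u) w))%:E < +oo)%E.
    by apply: (le_lt_trans h); rewrite lte_add_pinfty// ltry.
  have : (0 <= \int[P]_w (N ((b *: u) w))%:E)%E.
    by apply: integral_ge0 => w _; rewrite lee_fin vnorm_ge0.
  by case: (integral _ _ _) => [r _ _| |//]; rewrite ?ltry// gt0_muley ?lte_fin.
apply/L1P => j; apply: (le_integrable measurableT _ _ (integrableZl measurableT (C / b) iN)).
  exact/measurable_EFinP/mu.
move=> w _ /=; rewrite lee_fin.
rewrite [leRHS]ger0_norm; last by rewrite mulr_ge0// ?vnorm_ge0// divr_ge0// ltW.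
rewrite /= vnormZ// (gtr0_norm b0) mulrA divfK ?gt_eqF//; exact: hC.
Qed.

(** Convexity bounds the modular by [t] times the integral [q] of [Phi a] when the norms are at most
    [t * a], and [t = 1 / (1 + q)] makes this at most 1. This is the source of the continuous
    inclusion of L^infty. *)
Lemma modular_small : exists2 r : R, 0 < r & forall u, measurable_vec u ->
  {ae P, forall w, N (u w) <= r} -> (E u <= 1)%E.
Proof.
have [a a0 [pi _]] := Phi_L1.
have fp : (\int[P]_w Phi a w)%E \is a fin_num by exact: integrable_fin_num.
have p0 : (0 <= \int[P]_w Phi a w)%E by exact: integral_ge0.
set q := fine (\int[P]_w Phi a w)%E; have q0 : 0 <= q by exact: fine_ge0.
pose t := (1 + q)^-1; have t0 : 0 < t by rewrite invr_gt0; lra.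
exists (t * a) => [|u mu hu]; first exact: mulr_gt0.
have mP : measurable_fun setT (Phi a) := measurable_int _ pi.
apply: (@le_trans _ _ (\int[P]_w (t%:E * Phi a w))%E).
  apply: ae_ge0_le_integral => //.
  - exact: measurable_modular.
  - by move=> w _; rewrite mule_ge0// lee_fin ltW.
  - exact: measurable_funeM.
  apply: filterS hu => w hw _; apply: (@le_trans _ _ (hull Phi (t * a) w)).
    by apply: le_hull; rewrite !ger0_norm ?vnorm_ge0// mulr_ge0// ltW.
  have t01 : 0 <= t <= 1.
    by apply/andP; split; [exact: ltW|rewrite invf_le1; lra].
  apply: (le_trans (hullZ_le Phi_ge0 Phi_convex Phi_sym Phi0 w t01 (ltW a0))).
  by apply: lee_wpmul2l; [rewrite lee_fin ltW|exact: hull_le].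
rewrite ge0_integralZl ?lee_fin ?(ltW t0)// -(fineK fp) -/q -EFinM lee_fin.
by rewrite mulrC ler_pdivrMr; lra.
Qed.

Lemma orlicz_L1 u : LPhi u -> L1 P u. Proof. by case. Qed.

Lemma orlicz_measurable u : LPhi u -> measurable_vec u.
Proof. by move/orlicz_L1/L1_measurable. Qed.

Lemma orliczP u : LPhi u <-> measurable_vec u /\ (L u < +oo)%E.
Proof.
split=> [[Lu uoo]|[mu uoo]]; first by split => //; exact: L1_measurable.
split => //; have [_ [b [b0 _] <-] ub] := ereal_inf_lt uoo.
pose b' := fine (L u) + 1.
have fu : L u \is a fin_num by rewrite ge0_fin_numE// luxemburg_ge0.
have b'0 : 0 < b' by rewrite ltr_wpDl// fine_ge0// luxemburg_ge0.
have /luxemburg_leP : (L u <= b'%:E)%E by rewrite -(fineK fu) lee_fin lerDl.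
move=> /(_ hN Phi_ge0 Phi_convex Phi_sym Phi0 mu b'0) h.
apply: (modular_lty_L1 (b := b'^-1)) => //; first by rewrite invr_gt0.
exact: le_lt_trans h (ltry _).
Qed.

Lemma luxemburg_le_orlicz u (b : R) : measurable_vec u -> (L u <= b%:E)%E -> LPhi u.
Proof. by move=> mu h; apply/orliczP; split => //; exact: le_lt_trans h (ltry _). Qed.

Lemma orliczZD (c : R) u v : LPhi u -> LPhi v -> LPhi (c *: u + v).
Proof.
move=> /orliczP[mu uoo] /orliczP[mv voo]; apply/orliczP; split.
  exact: measurable_vecZD.
apply: le_lt_trans (luxemburgD_le hN Phi_ge0 Phi_convex Phi_sym Phi0 (measurable_vecZ c mu) mv) _.
rewrite lte_add_pinfty//.
apply: le_lt_trans (luxemburgZ_le hN Phi_ge0 Phi_convex Phi_sym Phi0 c mu uoo) _.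
by rewrite lte_mul_pinfty// lee_fin.
Qed.

Lemma luxemburg_le_Linfty_norm : exists2 C : R, 0 <= C & forall u, Linfty P u ->
  (L u <= C%:E * Linfty_norm P N u)%E.
Proof.
have [r r0 hr] := modular_small.
exists r^-1; first by rewrite invr_ge0 ltW.
move=> u Lu; have [M M0 hM] := Linfty_norm_fin hN Lu; rewrite hM -EFinM.
have mu := Linfty_measurable hN Lu.
apply: luxemburg_le => [|c]; first by rewrite mulr_ge0// invr_ge0 ltW.
rewrite ltr_pdivrMl// => Mc.
have c0 : 0 < c by move: (le_lt_trans M0 Mc); rewrite pmulr_rgt0.
apply/luxemburg_leP => //; apply: hr; first exact: measurable_vecZ.
have := Linfty_norm_ae hN hM; apply: filterS => w h /=.
rewrite vnormZ// gtr0_norm ?invr_gt0// ler_pdivrMl//.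
by apply: (le_trans h); rewrite mulrC ltW.
Qed.

Lemma Linfty_orlicz u : Linfty P u -> LPhi u.
Proof.
move=> Lu; have [C C0 hC] := luxemburg_le_Linfty_norm.
have [M M0 hM] := Linfty_norm_fin hN Lu.
apply: (@luxemburg_le_orlicz _ (C * M)); first exact: (Linfty_measurable hN).
by rewrite EFinM -hM; exact: hC.
Qed.

Lemma seminorm_on_orlicz : seminorm_on LPhi L.
Proof.
split.
- exact/Linfty_orlicz/(Linfty0 P hN).
- exact: orliczZD.
- by move=> u [_ uoo]; rewrite luxemburg_ge0.
- move=> c u Lu; have /orliczP[mu uoo] := Lu; apply/le_anti/andP; split.
    exact: luxemburgZ_le.
  have [->|c0] := eqVneq c 0; first by rewrite normr0 mul0e luxemburg_ge0.
  have /orliczP[mcu cuoo] : LPhi (c *: u).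
    rewrite -[c *: u]addr0; apply: orliczZD => //.
    exact/Linfty_orlicz/(Linfty0 P hN).
  rewrite -lee_pdivlMl ?normr_gt0// -normfV.
  have := luxemburgZ_le hN Phi_ge0 Phi_convex Phi_sym Phi0 c^-1 mcu cuoo.
  by rewrite scalerA mulVf// scale1r.
- by move=> u v /orliczP[mu _] /orliczP[mv _]; exact: luxemburgD_le.
Qed.

(** The continuous inclusion in L^1, from Young's inequality at the normalized vector. It yields the
    definiteness of the norm and, in the completeness proof, almost sure limits. *)
Lemma vnorm_integral_le : exists2 K : R, 0 <= K & forall u (b : R),
  measurable_vec u -> 0 < b -> (L u <= b%:E)%E ->
  (\int[P]_w (N (u w))%:E <= (K * b)%:E)%E.
Proof.
have [a [c [a0 c0 h]]] := expectation_le_modular.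
exists ((1 + c) / a); first by rewrite divr_ge0// ?ltW//; lra.
move=> u b mu b0 /luxemburg_leP h1.
have {}h1 := h1 hN Phi_ge0 Phi_convex Phi_sym Phi0 mu b0.
have := h _ (measurable_vecZ b^-1 mu).
have -> : (\int[P]_w (N ((b^-1 *: u) w))%:E = (b^-1)%:E * \int[P]_w (N (u w))%:E)%E.
  rewrite -ge0_integralZl//.
  - by apply: eq_integral => w _; rewrite /= vnormZ// gtr0_norm ?invr_gt0// EFinM.
  - exact/measurable_EFinP/measurable_vnorm.
  - by move=> w _; rewrite lee_fin vnorm_ge0.
  - by rewrite lee_fin invr_ge0 ltW.
move=> /le_trans /(_ (leeD2r c%:E h1)); rewrite muleA -EFinM.
have -> : (1 + c%:E = (1 + c)%:E :> \bar R)%E by [].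
rewrite -lee_pdivlMl ?divr_gt0// -EFinM invf_div.
by have -> : b / a * (1 + c) = (1 + c) / a * b by ring.
Qed.

Lemma luxemburg_eq0 u : LPhi u -> L u = 0%E <-> ae_eq_vec P u 0.
Proof.
move=> /orliczP[mu uoo]; split=> [u0|u0]; last first.
  apply/le_anti; rewrite luxemburg_ge0 andbT; apply: luxemburg_le => // c c0.
  apply/luxemburg_leP => //; apply: (@le_trans _ _ (E 0)); last by rewrite modular0.
  apply: le_modular => //.
  - exact: measurable_vecZ.
  by apply: filterS u0 => w h; rewrite (_ : (c^-1 *: u) w = c^-1 *: u w)// h scaler0.
have [K K0 hK] := vnorm_integral_le.
have iN0 : (\int[P]_w (N (u w))%:E = 0)%E.
  apply/le_anti/andP; split; last by apply: integral_ge0 => w _; rewrite lee_fin vnorm_ge0.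
  apply/lee_addgt0Pr => e e0; rewrite add0e.
  have b0 : 0 < e / (K + 1) by rewrite divr_gt0// ltr_wpDl.
  apply: (le_trans (hK _ _ mu b0 _)); first by rewrite u0 lee_fin ltW.
  by rewrite lee_fin mulrCA ger_pMr// ler_pdivrMr ?ltr_wpDl// mul1r lerDl.
have mN : measurable_fun setT (fun w => (N (u w))%:E).
  exact/measurable_EFinP/measurable_vnorm.
have /(ae_eq_integral_abs P measurableT mN) : (\int[P]_w `|(N (u w))%:E| = 0)%E.
  by rewrite -[RHS]iN0; apply: eq_integral => w _; rewrite gee0_abs// lee_fin vnorm_ge0.
by apply: filterS => w /(_ Logic.I)[] /(vnorm_eq0 hN).
Qed.

End orlicz_space.

(** * Completeness *)

Section completeness.
Context {d : measure_display} {T : measurableType d} {R : realType}.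
Context {P : probability T R} {n : nat} {N : 'rV[R]_n -> R} (hN : is_norm N).
Context {Phi : R -> T -> \bar R}.
Hypothesis Phi_ge0 : forall xi w, (0 <= Phi xi w)%E.
Hypothesis Phi_convex : random_convex Phi.
Hypothesis Phi_sym : forall xi w, Phi (- xi) w = Phi xi w.
Hypothesis Phi0 : forall w, Phi 0 w = 0%E.
Hypothesis Phi_L1 : exists2 a : R, 0 < a &
  P.-integrable setT (Phi a) /\ P.-integrable setT (conjugate Phi a).
Implicit Types (u v y : T -> 'rV[R]_n).

Local Notation E := (modular P N Phi).
Local Notation L := (luxemburg P N Phi).
Local Notation LPhi := (orlicz P N Phi).

(** The sum of the norms of the increments has a finite integral, so it is finite almost surely and
    the coordinates converge there. *)
Lemma ae_cvg_of_summable (s : nat -> T -> 'rV[R]_n) (K : R) : 0 <= K ->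
  (forall k, measurable_vec (s k)) ->
  (forall k, (\int[P]_w (N (s k.+1 w - s k w))%:E <= (K / 2 ^+ k)%:E)%E) ->
  exists u, measurable_vec u /\
    {ae P, forall w j, s k w 0 j @[k --> \oo] --> u w 0 j}.
Proof.
move=> K0 ms hs; have [C C0 hC] := coord_le_vnorm hN.
pose f k w := (N (s k.+1 w - s k w))%:E.
have f0 k w : (0 <= f k w)%E by rewrite lee_fin vnorm_ge0.
have mf k : measurable_fun setT (f k).
  by apply/measurable_EFinP; apply: (measurable_vnorm hN (measurable_vecB _ _)).
pose F w := (\sum_(k <oo) f k w)%E.
have mF : measurable_fun setT F by exact: ge0_emeasurable_sum.
have F0 w : (0 <= F w)%E by apply: nneseries_ge0.
pose G := [set w | (F w < +oo)%E].
have mG : measurable G.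
  by rewrite -[G]setTI; apply: measurable_lte => //; exact: measurable_cst.
have aeG : {ae P, forall w, G w}.
  have iF : P.-integrable setT F.
    apply/integrableP; split => //.
    under eq_integral => w _ do rewrite gee0_abs//.
    rewrite integral_nneseries//; apply: (@le_lt_trans _ _ (2 * K)%:E); last exact: ltry.
    apply: lime_le; first by apply: is_cvg_nneseries => *; exact: integral_ge0.
    apply: nearW => m.
    apply: (@le_trans _ _ (\sum_(0 <= k < m) (K / 2 ^+ k)%:E)%E).
      by apply: lee_sum => k _; exact: hs.
    rewrite sumEFin lee_fin.
    have -> : \sum_(0 <= k < m) K / 2 ^+ k = 2 * K - 2 * (K / 2 ^+ m).
      elim: m => [|m ih]; first by rewrite big_nil expr0 divr1 subrr.
      by rewrite big_nat_recr//= ih exprSr invfM; field; rewrite expf_neq0// pnatr_eq0.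
    by rewrite gerBl mulr_ge0// divr_ge0// exprn_ge0.
  by apply: filterS (integrable_ae measurableT iF) => w /(_ Logic.I); rewrite /G /= ge0_fin_numE.
have cvgs w : G w -> forall j, cvgn (fun k => s k w 0 j).
  move=> Gw j; pose a (k : nat) : R := s k w 0 j.
  have : cvgn (series (telescope a)).
    apply: normed_cvg.
    have Sm m : [normed series (telescope a)] m = \sum_(0 <= k < m) `|telescope a k| by [].
    apply: nondecreasing_is_cvgn.
      by apply/nondecreasing_seqP => k; rewrite !Sm big_nat_recr//= lerDl.
    exists (C * fine (F w)) => _ [m _ <-]; rewrite Sm.
    apply: (@le_trans _ _ (\sum_(0 <= k < m) C * N (s k.+1 w - s k w))).
      apply: ler_sum => k _.
      have -> : telescope a k = (s k.+1 w - s k w) 0 j by rewrite coordB.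
      exact: hC.
    rewrite -mulr_sumr ler_pM2l// -lee_fin fineK ?ge0_fin_numE// -sumEFin.
    by apply: (nneseries_lim_ge m) => k _ _; exact: f0.
  rewrite telescopeK => h.
  have -> : (fun k => s k w 0 j) = (fun k => (a k - a 0%N) + a 0%N).
    by apply/funext => k; rewrite subrK.
  by apply: is_cvgD => //; exact: is_cvg_cst.
(* Replaced by 0 outside [G], the sequence converges everywhere, so its limit is measurable. *)
pose v k := vrestr G (s k).
have cvgv w j : v k w 0 j @[k --> \oo] --> limn (fun k => v k w 0 j).
  have [Gw|nGw] := pselect (G w).
    rewrite (_ : (fun k => v k w 0 j) = (fun k => s k w 0 j)); first exact: cvgs.
    by apply/funext => k; rewrite /v /vrestr indicE mem_set// scale1r.
  rewrite (_ : (fun k => v k w 0 j) = (fun k => 0)); first exact: is_cvg_cst.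
  by apply/funext => k; rewrite /v /vrestr indicE memNset// scale0r mxE.
exists (fun w => \row_j limn (fun k => v k w 0 j)); split.
  move=> j; apply: (@measurable_fun_cvg _ _ _ _ (fun k w => v k w 0 j)).
    by move=> k; apply: measurable_vrestr.
  by move=> w _; rewrite mxE; exact: cvgv.
apply: filterS aeG => w Gw j; rewrite mxE.
have <- : (fun k => v k w 0 j) = (fun k => s k w 0 j); last exact: cvgv.
by apply/funext => k; rewrite /v /vrestr indicE mem_set// scale1r.
Qed.

Lemma vnorm_cvg (s : nat -> 'rV[R]_n) (x : 'rV[R]_n) :
  (forall j, s k 0 j @[k --> \oo] --> x 0 j) -> N (s k) @[k --> \oo] --> N x.
Proof.
have [C C0 hC] := vnorm_le_coord hN.
move=> h; apply/cvgrPdist_lt => e e0.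
have eC0 : 0 < e / (2 * C) by rewrite divr_gt0// mulr_gt0.
have : \forall k \near \oo, forall j, `|x 0 j - s k 0 j| < e / (2 * C).
  by apply: filter_forall => j; have /cvgrPdist_lt := h j; exact.
apply: filterS => k hk; apply: (le_lt_trans (vnorm_dist hN _ _)).
apply: (@le_lt_trans _ _ (C * (e / (2 * C)))).
  by apply: hC => [|j]; [exact: ltW|rewrite coordB ltW].
have -> : C * (e / (2 * C)) = e / 2 by field; rewrite gt_eqF.
lra.
Qed.

(** A subsequence with geometrically small increments converges almost surely, and lower
    semicontinuity of the modular carries the Cauchy estimate over to the limit. *)
Lemma orlicz_complete (s : nat -> T -> 'rV[R]_n) : (forall k, LPhi (s k)) ->
  (forall e : R, 0 < e -> exists k0 : nat, forall k l,
    (k0 <= k)%N -> (k0 <= l)%N -> (L (s k - s l)%R < e%:E)%E) ->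
  exists2 u, LPhi u & (fun k => L (s k - u)) @ \oo --> 0%E.
Proof.
move=> Ls cs; have sn := seminorm_on_orlicz hN Phi_ge0 Phi_convex Phi_sym Phi0 Phi_L1.
have ms k : measurable_vec (s k) by exact: orlicz_measurable (Ls k).
have /choice[k0 hk0] : forall i : nat, exists k0 : nat, forall k l,
    (k0 <= k)%N -> (k0 <= l)%N -> (L (s k - s l)%R < (2 ^- i)%:E)%E.
  by move=> i; apply: cs; rewrite invr_gt0 exprn_gt0.
(* Partial sums are increasing whatever [k0] is, and give [r i] at least [k0 i] and at least [i]. *)
pose r i := (\sum_(j < i.+1) (k0 j).+1)%N.
have rS i : r i.+1 = (r i + (k0 i.+1).+1)%N by rewrite /r big_ord_recr.
have k0r i : (k0 i <= r i)%N by rewrite /r big_ord_recr /= -addSnnS leq_addl.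
have ir i : (i <= r i)%N.
  elim: i => // i ih; rewrite rS addnS ltnS; exact: leq_trans ih (leq_addr _ _).
have [K K0 hK] := vnorm_integral_le hN Phi_ge0 Phi_convex Phi_sym Phi0 Phi_L1.
have [|k|u [mu su]] := ae_cvg_of_summable (s := s \o r) K0.
- by move=> k; exact: ms.
- rewrite /=; apply: (hK (s (r k.+1) - s (r k)) (2 ^- k)).
  + exact: measurable_vecB.
  + by rewrite invr_gt0 exprn_gt0.
  + apply/ltW/hk0; last exact: k0r.
    by rewrite rS; apply: leq_trans (k0r k) (leq_addr _ _).
have lim_le (e : R) (l : nat) : 0 < e ->
    (forall k, (l <= k)%N -> (L (s l - s k)%R < e%:E)%E) -> (L (s l - u)%R <= e%:E)%E.
  move=> e0 hl; apply/luxemburg_leP => //; first exact: measurable_vecB.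
  (* The shift by [l] puts every index of the subsequence beyond [l]. *)
  apply: (modular_lsc hN Phi_ge0 Phi_convex Phi0 (s := fun i => e^-1 *: (s l - s (r (i + l)%N)))).
  - by move=> k; apply/measurable_vecZ/measurable_vecB.
  - exact/measurable_vecZ/measurable_vecB.
  - move=> k; apply/luxemburg_leP => //; first exact: measurable_vecB.
    by apply/ltW/hl; apply: leq_trans (leq_addl k l) (ir _).
  - apply: filterS su => w hw; apply: (vnorm_cvg (s := fun i => (e^-1 *: (s l - s (r (i + l)%N))) w)) => j.
    rewrite [X in X @ _ --> _](_ : _ = fun i => e^-1 * (s l w 0 j - s (r (i + l)%N) w 0 j)); last first.
      by apply/funext => i; rewrite !mxE.
    rewrite !mxE; apply: cvgMr; apply: cvgB; first exact: cvg_cst.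
    have := hw j; rewrite -(cvg_shiftn l); exact.
have Lu : LPhi u.
  have [l hl] := cs 1 ltr01.
  have h := lim_le 1 l ltr01 (fun k lk => hl l k (leqnn _) lk).
  have -> : u = s l - (s l - u) by rewrite opprB addrC subrK.
  apply: (linB (seminorm_onZD sn)) => //.
  exact: (luxemburg_le_orlicz hN Phi_ge0 Phi_convex Phi_sym Phi0 Phi_L1 (measurable_vecB (ms l) mu) h).
exists u => //.
have Lsu k : LPhi (s k - u) by exact: (linB (seminorm_onZD sn)).
apply/fine_cvgP; split.
  by apply: nearW => k; rewrite -(seminorm_fineK sn (Lsu k)).
apply/cvgrPdist_lt => e e0; have e20 : 0 < e / 2 by rewrite divr_gt0.
have [l hl] := cs _ e20; exists l => // k /= lk.
rewrite sub0r normrN ger0_norm; last exact: (seminorm_fine_ge0 sn).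
have := lim_le _ k e20 (fun k' kk' => hl k k' lk (leq_trans lk kk')).
rewrite -(seminorm_fineK sn (Lsu k)) lee_fin /=; lra.
Qed.

Lemma orlicz_banach : is_banach P LPhi L.
Proof.
have sn := seminorm_on_orlicz hN Phi_ge0 Phi_convex Phi_sym Phi0 Phi_L1.
have [S0 SZD Sf SZ SD] := sn.
split => //.
  split=> // u Lu; exact: (luxemburg_eq0 hN Phi_ge0 Phi_convex Phi_sym Phi0 Phi_L1).
exact: orlicz_complete.
Qed.

End completeness.

(** * Densities of absolutely continuous additive set functions *)

Section absolutely_continuous_charge.
Context {d : measure_display} {T : measurableType d} {R : realType}.
Context {P : probability T R} (nu : set T -> R).
Hypothesis nu_add : forall A B, measurable A -> measurable B -> A `&` B = set0 ->
  nu (A `|` B) = nu A + nu B.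
Hypothesis nu_ac : forall e : R, 0 < e -> exists2 r : R, 0 < r &
  forall A, measurable A -> (P A <= r%:E)%E -> `|nu A| <= e.

Let ac_charge_set0 : nu set0 = 0.
Proof.
have := @nu_add set0 set0 measurable0 measurable0 (set0I _).
by rewrite set0U => /eqP; rewrite -subr_eq0 opprD addNKr oppr_eq0 => /eqP.
Qed.

Let ac_charge_sum (F : nat -> set T) m : (forall i, measurable (F i)) ->
  trivIset setT F -> nu (\big[setU/set0]_(i < m) F i) = \sum_(i < m) nu (F i).
Proof.
move=> mF tF; elim: m => [|m ih]; first by rewrite !big_ord0.
rewrite !big_ord_recr /= nu_add ?ih//; first exact: bigsetU_measurable.
apply/seteqP; split=> // w; rewrite -bigcup_mkord => -[[i /= im Fi] Fm].
by have := tF i m Logic.I Logic.I (ex_intro _ w (conj Fi Fm)) => ei; rewrite ei ltnn in im.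
Qed.

(** The term carries the proofs of additivity and absolute continuity, so that the charge structure
    declared below can be attached to it. *)
Definition ac_charge of (forall A B, measurable A -> measurable B ->
    A `&` B = set0 -> nu (A `|` B) = nu A + nu B) &
  (forall e : R, 0 < e -> exists2 r : R, 0 < r &
    forall A, measurable A -> (P A <= r%:E)%E -> `|nu A| <= e) : set T -> \bar R :=
  fun A => (nu A)%:E.

Local Notation c := (ac_charge nu_add nu_ac).

Let c0 : c set0 = 0%E. Proof. by rewrite /ac_charge ac_charge_set0. Qed.

Let c_finite A : measurable A -> c A \is a fin_num. Proof. by []. Qed.

(** The probability of what the first [m] sets leave out tends to 0, and then so does [nu] of it:
    absolute continuity turns finite additivity into countable additivity. *)
Let c_sigma_additive : semi_sigma_additive c.
Proof.
move=> F mF tF mU; pose G m := \big[setU/set0]_(i < m) F i.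
rewrite [X in X @ _ --> _](_ : _ = (fun m => (nu (G m))%:E)); last first.
  by apply/funext => m; rewrite ac_charge_sum// big_mkord sumEFin.
have mG m : measurable (G m) by exact: bigsetU_measurable.
have subG m : G m `<=` \bigcup_i F i.
  by rewrite /G -bigcup_mkord; exact: bigcup_subset.
have UG : \bigcup_m G m = \bigcup_i F i.
  apply/seteqP; split=> [w [m _ /subG]//|w [i _ Fi]].
  by exists i.+1 => //; rewrite /G -bigcup_mkord; exists i => /=.
have ndG : nondecreasing_seq G.
  move=> k l kl; apply/subsetPset; rewrite /G -!bigcup_mkord.
  by apply: bigcup_subset => i /= ik; exact: leq_trans ik kl.
apply/cvg_EFin; first exact: nearW.
apply/cvgrPdist_le => e /nu_ac[r r0 hr].
have := @nondecreasing_cvg_mu _ _ _ P G mG; rewrite UG => /(_ mU ndG) PG.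
have /fine_cvgP[_ /cvgrPdist_le /(_ r r0)] :
    (P \o G) m @[m --> \oo] --> (fine (P (\bigcup_i F i)))%:E.
  by rewrite fineK ?fin_num_measure.
apply: filterS => m /= hm.
have mD : measurable (\bigcup_i F i `&` ~` G m) by exact/measurableI/measurableC.
have UE : \bigcup_i F i = G m `|` (\bigcup_i F i `&` ~` G m).
  by rewrite -setDE setDUK.
have dG : G m `&` (\bigcup_i F i `&` ~` G m) = set0.
  by rewrite setICA setICr setI0.
have -> : nu (\bigcup_i F i) - nu (G m) = nu (\bigcup_i F i `&` ~` G m).
  by rewrite {1}UE nu_add// addrAC subrr add0r.
apply: hr => //; apply: le_trans (_ : (fine (P (\bigcup_i F i)) - fine (P (G m)))%:E <= _)%E.
  rewrite EFinB !fineK ?fin_num_measure// -setDE measureD//; last first.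
    by rewrite -ge0_fin_numE// fin_num_measure.
  by rewrite setIidr.
by rewrite lee_fin; apply: le_trans hm; exact: ler_norm.
Qed.

HB.instance Definition _ := isCharge.Build _ _ _ c c0 c_finite c_sigma_additive.

Lemma ac_charge_density : exists2 y : T -> R, P.-integrable setT (EFin \o y) &
  forall A, measurable A -> (nu A)%:E = (\int[P]_(w in A) (y w)%:E)%E.
Proof.
have dom : c `<< P.
  apply/null_content_dominatesP => A mA PA0; rewrite /ac_charge.
  suff -> : nu A = 0 by [].
  apply/eqP; rewrite -normr_le0; apply/ler_addgt0Pr => e e0; rewrite add0r.
  have [r r0 hr] := nu_ac e0; apply: hr => //.
  by rewrite PA0 lee_fin ltW.
have f_fin w := Radon_Nikodym_fin_num w dom.
exists (fine \o Radon_Nikodym c P).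
  apply: (@eq_integrable _ _ _ _ _ measurableT (Radon_Nikodym c P)).
    by move=> w _; rewrite /= fineK.
  exact: Radon_Nikodym_integrable.
move=> A mA; apply: etrans (Radon_Nikodym_integral dom mA) _.
by apply: eq_integral => w _; rewrite /= fineK.
Qed.

End absolutely_continuous_charge.

(** * The Yosida-Hewitt decomposition *)

Section yosida_hewitt.
Context {d : measure_display} {T : measurableType d} {R : realType}.
Context {P : probability T R} {n : nat}.
Implicit Types (A B : set T) (m : set T -> 'rV[R]_n).

(* A_k nearly maximizes mu among the sets of probability at most 2^-k; the
   tails B_k = U_{i >= k} A_i absorb all the singular mass of mu. *)
Lemma singular_tails (mu : set T -> R) :
  (forall A, measurable A -> 0 <= mu A) ->
  (forall A B, measurable A -> measurable B -> A `&` B = set0 ->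
    mu (A `|` B) = mu A + mu B) ->
  exists B : nat -> set T,
    [/\ forall k, measurable (B k), forall k, B k.+1 `<=` B k,
        P \o B @ \oo --> 0%E
      & forall e : R, 0 < e -> exists2 r : R, 0 < r & forall C, measurable C ->
          (P C <= r%:E)%E -> \forall k \near \oo, mu (C `&` ~` B k) <= e].
Proof.
move=> mu0 muU.
have mu_mono A B : measurable A -> measurable B -> A `<=` B -> mu A <= mu B.
  move=> mA mB AB; have -> : B = A `|` (B `&` ~` A) by rewrite -setDE setDUK.
  have mBA : measurable (B `&` ~` A) by exact/measurableI/measurableC.
  rewrite muU ?lerDl ?mu0//.
  by rewrite setICA setICr setI0.
have r0 k : 0 < 2 ^- k :> R by rewrite invr_gt0 exprn_gt0.
have /choice[A hA] : forall k : nat, exists A, [/\ measurable A, (P A <= (2 ^- k)%:E)%E &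
    forall C, measurable C -> (P C <= (2 ^- k)%:E)%E -> mu C <= mu A + 2 ^- k].
  move=> k; pose S := [set mu A | A in [set A | measurable A /\ (P A <= (2 ^- k)%:E)%E]].
  have hS : has_sup S.
    split; first by exists (mu set0), set0 => //; split => //; rewrite measure0 lee_fin ltW.
    by exists (mu setT) => _ [A [mA _] <-]; exact: mu_mono.
  have [_ [A [mA PA] <-] hA] := sup_adherent (r0 k) hS.
  exists A; split => // C mC PC; rewrite -lerBlDr; apply: (le_trans _ (ltW hA)).
  by rewrite lerB//; apply: (ub_le_sup hS.2); exists C.
have mA k : measurable (A k) by case: (hA k).
have PA k : (P (A k) <= (2 ^- k)%:E)%E by case: (hA k).
pose B k := \bigcup_i A (k + i)%N.
have mB k : measurable (B k) by exact: bigcup_measurable.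
have AB k : A k `<=` B k by move=> w Aw; exists 0%N => //; rewrite addn0.
have decB k : B k.+1 `<=` B k by move=> w [i _ Aw]; exists i.+1 => //; rewrite -addSnnS.
have PB k : (P (B k) <= (2 * 2 ^- k)%:E)%E.
  apply: (le_trans (measure_sigma_subadditive P (F := fun i => A (k + i)%N) (fun i => mA _) (mB k) (@subset_refl _ _))) => //.
  apply: lime_le; first exact: is_cvg_nneseries.
  apply: nearW => m; apply: (@le_trans _ _ (\sum_(0 <= i < m) (2 ^- (k + i))%:E)%E).
    by apply: lee_sum => i _; exact: PA.
  rewrite sumEFin lee_fin.
  have -> : \sum_(0 <= i < m) 2 ^- (k + i) = 2 * 2 ^- k - 2 * 2 ^- (k + m) :> R.
    elim: m => [|m ih]; first by rewrite big_nil addn0 subrr.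
    rewrite big_nat_recr//= ih addnS exprS invfM; field.
    by rewrite !expf_neq0// ?pnatr_eq0.
  by rewrite gerBl mulr_ge0// ltW.
have P0 : P \o B @ \oo --> 0%E.
  apply: (@squeeze_cvge _ _ _ _ (cst 0%E) _ (fun k => (2 * 2 ^- k)%:E)).
  - by apply: nearW => k; rewrite /= measure_ge0 PB.
  - exact: cvg_cst.
  - apply/cvg_EFin; first exact: nearW.
    rewrite -[X in _ --> X](mulr0 2); apply: cvgMr.
    rewrite (_ : (fun k => _) = (fun k => (2^-1 : R) ^+ k)).
      by apply: cvg_expr; rewrite ger0_norm ?invr_ge0// invf_lt1// ltr1n.
    by apply/funext => k; rewrite exprVn.
have muBS k l : (k <= l)%N -> mu (B l) <= mu (B k).
  by move=> kl; apply: mu_mono => //; exact: decreasing_le.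
exists B; split => // e e0; have e20 : 0 < e / 2 by rewrite divr_gt0.
(* [mu (B k)] decreases and is bounded below by 0, so it is Cauchy. *)
have [k0 hk0] : exists k0, forall k l, (k0 <= k)%N -> (k0 <= l)%N -> mu (B k) - mu (B l) <= e / 2.
  pose S := [set mu (B k) | k in [set: nat]].
  have hS : has_inf S.
    split; first by exists (mu (B 0%N)), 0%N.
    by exists 0 => _ [k _ <-]; exact: mu0.
  have [_ [k0 _ <-] hk0] := inf_adherent e20 hS.
  exists k0 => k l kk kl; have := muBS _ _ kk.
  have : inf S <= mu (B l) by apply: (ge_inf hS.2); exists l.
  lra.
have [k1 hk1] : exists k1, 2 ^- k1 <= e / 2.
  exists (Num.bound (e / 2)^-1).
  rewrite -[leRHS]invrK lef_pV2 ?posrE ?exprn_gt0// ?invr_gt0//.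
  apply: (le_trans (ltW (archi_boundP _))); first by rewrite invr_ge0 ltW.
  by rewrite -natrX ler_nat ltnW// ltn_expl.
pose k := maxn k0 k1.
have hk : 2 ^- k <= e / 2.
  apply: le_trans hk1; rewrite lef_pV2 ?posrE ?exprn_gt0//.
  by rewrite ler_eXn2l ?ltr1n// leq_maxr.
(* For [l >= k + 2] the set [B l] has probability at most [2 ^- k.+1], so that of the union of [C]
   and [B l] is at most [2 ^- k] and the near-maximality of [A k] applies to it. Subtracting
   [mu (B l)] leaves two errors of [e / 2]. *)
exists (2 ^- k.+1) => // C mC PC; exists k.+2 => // l /= kl.
have mCB : measurable (C `&` ~` B l) by exact/measurableI/measurableC.
have PCB : (P (C `|` B l) <= (2 ^- k)%:E)%E.
  apply: (le_trans (measureU2 _ _ _)) => //.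
  apply: (le_trans (leeD PC (PB l))); rewrite -EFinD lee_fin.
  have : 2 * 2 ^- l <= 2 ^- k.+1 :> R.
    rewrite -(@ler_pM2l _ (2 ^+ k.+1)) ?exprn_gt0// mulfV ?expf_neq0 ?pnatr_eq0//.
    rewrite mulrA -exprSr ler_pdivrMr ?exprn_gt0// mul1r.
    by rewrite ler_eXn2l ?ltr1n.
  rewrite exprS invfM; lra.
have [_ _ /(_ _ (measurableU _ _ mC (mB l)) PCB)] := hA k.
have -> : C `|` B l = (C `&` ~` B l) `|` B l by rewrite setUIl setUCl setIT.
have := mu_mono _ _ (mA k) (mB k) (AB k).
have := hk0 k l (leq_maxl _ _) (leq_trans (leq_maxl _ _) (ltnW (ltnW kl))).
rewrite muU// ?setIA -?setIA ?setICl ?setI0//.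
lra.
Qed.

(** [m B] and [m] of the complement of [B] in [A] add up to [m A], so making one large makes the
    other small. *)
Lemma jordan_decomposition m (hm : M1 P m) (A : set T) (j : 'I_n) : measurable A ->
  m A 0 j = pos_part m A 0 j - neg_part m A 0 j :> R.
Proof.
move=> mA; have hm' := M1N hm.
have mE B : measurable B -> B `<=` A -> m A 0 j = m B 0 j + m (A `&` ~` B) 0 j.
  move=> mB BA; rewrite (M1_setIC hm mA mB) mxE; congr (m _ _ _ + _).
  exact: setIidr.
apply/le_anti/andP; split.
  suff : neg_part m A 0 j <= pos_part m A 0 j - m A 0 j by lra.
  apply: (pos_part_le hm') => B mB BA.
  have := le_pos_part hm j (measurableI _ _ mA (measurableC mB)) (@subIsetl _ A (~` B)).
  by have := mE _ mB BA; rewrite [(- m B) 0 j]mxE; lra.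
suff : pos_part m A 0 j <= neg_part m A 0 j + m A 0 j by lra.
apply: (pos_part_le hm) => B mB BA.
have := le_pos_part hm' j (measurableI _ _ mA (measurableC mB)) (@subIsetl _ A (~` B)).
by have := mE _ mB BA; rewrite /neg_part [(- m _) 0 j]mxE; lra.
Qed.

Lemma M1_abs_le m (hm : M1 P m) A : measurable A -> forall j,
  `|m A 0 j| <= \sum_i total_variation m i A.
Proof.
move=> mA j; apply: (le_trans (norm_le_total_variation hm j mA (@subset_refl _ A))).
by rewrite (bigD1 j)//= lerDl sumr_ge0// => i _; exact: (total_variation_ge0 hm).
Qed.

Context {N : 'rV[R]_n -> R} (hN : is_norm N).

Lemma M1sP m : M1s P N m <-> M1 P m /\ exists B : nat -> set T,
  [/\ forall k, measurable (B k), forall k, B k.+1 `<=` B k, P \o B @ \oo --> 0%E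
    & forall k A, measurable A -> A `&` B k = set0 -> m A = 0].
Proof.
split=> -[hm [B [mB decB PB mB0]]]; split=> //; exists B; split=> //.
  move=> k A mA AB; have /(abs_meas_eq0 hm hN) := mB0 k; apply => //.
  by move=> w Aw Bw; have : (A `&` B k) w by []; rewrite AB.
move=> k; apply/(abs_meas_eq0 hm hN) => A mA AB; apply: (mB0 k) => //.
by apply/seteqP; split=> // w [/AB].
Qed.

(** The singular part is the limit of [m] along the tails [B k]; the limit exists because the
    positive and negative parts are monotone. The remainder is small on sets of small probability
    and so has a density. Summing the total variations over the coordinates provides the same tails
    for all of them. *)
Lemma yosida_hewitt m : M1 P m -> exists2 ms : set T -> 'rV[R]_n, M1s P N ms &
  exists2 y : T -> 'rV[R]_n, L1 P y & forall A j, measurable A ->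
    (m A 0 j - ms A 0 j)%:E = (\int[P]_(w in A) (y w 0 j)%:E)%E.
Proof.
move=> hm; have hm' := M1N hm; pose mu A := \sum_j total_variation m j A.
have mu0 A : measurable A -> 0 <= mu A.
  by move=> mA; apply: sumr_ge0 => j _; exact: (total_variation_ge0 hm).
have muU A B : measurable A -> measurable B -> A `&` B = set0 -> mu (A `|` B) = mu A + mu B.
  by move=> mA mB AB; rewrite -big_split; apply: eq_bigr => j _; rewrite (total_variationU hm).
have [B [mB decB PB acB]] := singular_tails mu0 muU.
have mAB A k : measurable A -> measurable (A `&` B k) by move=> mA; exact: measurableI.
have mABC A k : measurable A -> measurable (A `&` ~` B k).
  by move=> mA; exact/measurableI/measurableC.
pose msA A j := limn (fun k => m (A `&` B k) 0 j).
have pos_cvg m' A j : M1 P m' -> measurable A -> cvgn (fun k => pos_part m' (A `&` B k) 0 j).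
  move=> h mA; apply: nonincreasing_is_cvgn.
    move=> k l kl; apply: (pos_part_le h) => C mC CA; apply: (le_pos_part h) => //.
    by apply: (subset_trans CA); apply: setIS; exact: decreasing_le.
  by exists 0 => _ [k _ <-]; exact: (pos_part_ge0 h).
have ms_cvg A j : measurable A -> m (A `&` B k) 0 j @[k --> \oo] --> msA A j.
  move=> mA; apply: cvgP.
  rewrite (_ : (fun k => _) = (fun k => pos_part m (A `&` B k) 0 j) -
      (fun k => neg_part m (A `&` B k) 0 j)).
    by apply: is_cvgB; apply: pos_cvg.
  by apply/funext => k; rewrite (jordan_decomposition hm)//; exact: mAB.
pose ms A : 'rV[R]_n := if `[< measurable A >] then \row_j msA A j else 0.
have msE A j : measurable A -> ms A 0 j = msA A j.
  by move=> mA; rewrite /ms asboolT// mxE.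
have ms_eq A j x : measurable A -> (\forall k \near \oo, m (A `&` B k) 0 j = x) -> ms A 0 j = x.
  move=> mA h; rewrite msE//; apply/cvg_lim => //; apply: cvg_near_cst; exact: h.
have hms : M1 P ms.
  apply/M1P; split.
  - by move=> A mA; rewrite /ms asboolF.
  - move=> A C mA mC AC; apply/rowP => j; rewrite mxE !msE//; last exact: measurableU.
    apply/cvg_lim => //.
    rewrite (_ : (fun k => _) = (fun k => m (A `&` B k) 0 j) + (fun k => m (C `&` B k) 0 j)).
      by apply: cvgD; exact: ms_cvg.
    apply/funext => k; rewrite setIUl (M1_setU hm) ?mxE//; try exact: mAB.
    by rewrite setIACA AC set0I.
  - exists (mu setT) => A j mA; rewrite msE// ler_norml; apply/andP; split.
      apply: limr_ge; first by apply: cvgP; exact: ms_cvg.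
      apply: nearW => k; have := M1_abs_le hm (mAB A k mA) j; rewrite ler_norml => /andP[h _].
      apply: le_trans h; rewrite lerN2; apply: ler_sum => i _.
      by apply: (total_variation_mono hm) => //; exact: mAB.
    apply: limr_le; first by apply: cvgP; exact: ms_cvg.
    apply: nearW => k; have := M1_abs_le hm (mAB A k mA) j; rewrite ler_norml => /andP[_ h].
    apply: (le_trans h); apply: ler_sum => i _.
    by apply: (total_variation_mono hm) => //; exact: mAB.
  - move=> A mA A0; apply/rowP => j; rewrite mxE; apply: ms_eq => //; apply: nearW => k.
    rewrite (M1_null hm) ?mxE//; first exact: mAB.
    exact: (subset_measure0 (mAB A k mA) mA (@subIsetl _ _ _) A0).
have hmss : M1s P N ms.
  apply/M1sP; split => //; exists B; split => // k A mA AB; apply/rowP => j; rewrite mxE.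
  apply: ms_eq => //; exists k => // l /= kl.
  rewrite (_ : A `&` B l = set0) ?(M1_set0 hm) ?mxE//.
  by apply/seteqP; split=> // w [Aw /(decreasing_le decB kl) Bw]; rewrite -AB.
exists ms => //.
pose nu j A := m A 0 j - ms A 0 j.
have nu_add j A C : measurable A -> measurable C -> A `&` C = set0 ->
    nu j (A `|` C) = nu j A + nu j C.
  move=> mA mC AC; rewrite /nu (M1_setU hm)// (M1_setU hms)// !mxE; ring.
have nu_ac j (e : R) : 0 < e -> exists2 r : R, 0 < r &
    forall A, measurable A -> (P A <= r%:E)%E -> `|nu j A| <= e.
  move=> /acB[r r0 hr]; exists r => // A mA /(hr _ mA) h.
  have nuE : m (A `&` ~` B k) 0 j @[k --> \oo] --> nu j A.
    rewrite (_ : (fun k => _) = (fun k => m A 0 j - m (A `&` B k) 0 j)).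
      by apply: cvgB; [exact: cvg_cst|rewrite msE//; exact: ms_cvg].
    by apply/funext => k; rewrite (M1_setIC hm mA (mB k)) mxE addrAC subrr add0r.
  rewrite -(cvg_lim _ nuE)// ler_norml; apply/andP; split.
    apply: limr_ge; first by apply: cvgP; exact: nuE.
    apply: filterS h => k h; have := M1_abs_le hm (mABC A k mA) j.
    by rewrite ler_norml => /andP[+ _]; apply: le_trans; rewrite lerN2.
  apply: limr_le; first by apply: cvgP; exact: nuE.
  apply: filterS h => k h; have := M1_abs_le hm (mABC A k mA) j.
  by rewrite ler_norml => /andP[_ /le_trans]; apply.
have /choice[y hy] : forall j, exists y : T -> R, P.-integrable setT (EFin \o y) /\
    forall A, measurable A -> (nu j A)%:E = (\int[P]_(w in A) (y w)%:E)%E.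
  by move=> j; have [y yi yE] := ac_charge_density (nu_add j) (nu_ac j); exists y.
exists (fun w => \row_j y j w).
  apply/L1P => j; have [yi _] := hy j.
  by apply: (@eq_integrable _ _ _ _ _ measurableT (EFin \o y j)) => // w _; rewrite mxE.
move=> A j mA; have [_ /(_ _ mA) hE] := hy j.
by rewrite -/(nu j A) hE; apply: eq_integral => w _; rewrite mxE.
Qed.

End yosida_hewitt.

(** * The conjugate integrand and the pairing with densities *)

Section conjugate_integrals.
Context {d : measure_display} {T : measurableType d} {R : realType}.
Context {P : probability T R} {n : nat} {N : 'rV[R]_n -> R} (hN : is_norm N).
Context {Phi : R -> T -> \bar R}.
Hypothesis Phi_ge0 : forall xi w, (0 <= Phi xi w)%E.
Hypothesis Phi_convex : random_convex Phi.
Hypothesis Phi_sym : forall xi w, Phi (- xi) w = Phi xi w.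
Hypothesis Phi0 : forall w, Phi 0 w = 0%E.
Implicit Types (u v y : T -> 'rV[R]_n).

Local Notation E := (modular P N Phi).
Local Notation Nd := (dual_vnorm N).

Let Psi0 x w : (0 <= hull Phi x w)%E. Proof. exact: hull_ge0. Qed.

Let conj0 x w : (0 <= conjugate Phi x w)%E. Proof. exact: conjugate_ge0. Qed.

Lemma young (x y : 'rV[R]_n) (b : R) (w : T) : 0 < b ->
  ((dotp x y)%:E <= b%:E * (hull Phi (N x) w + conjugate Phi (Nd y / b) w))%E.
Proof.
move=> b0; apply: (@le_trans _ _ (b%:E * (N x * (Nd y / b))%:E)%E); last first.
  apply: lee_wpmul2l; first by rewrite lee_fin ltW.
  by apply: hull_conjugate => //; exact: vnorm_ge0.
rewrite -EFinM lee_fin; have -> : b * (N x * (Nd y / b)) = N x * Nd y.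
  by field; rewrite gt_eqF.
exact: dotp_le_dual_vnorm.
Qed.

(* Strict inequality below xi keeps N r inside the domain of the hull. *)
Lemma rational_vec_dual (y : 'rV[R]_n) (xi e : R) : 0 < xi -> 0 < e ->
  exists k, N (rational_vec k) < xi /\ xi * Nd y - e <= dotp (rational_vec k) y.
Proof.
move=> xi0 e0; pose D := Nd y; have D0 : 0 <= D by exact: dual_vnorm_ge0.
have e'0 : 0 < e / (2 * xi) by rewrite divr_gt0// mulr_gt0.
have [x x1 hx] := dual_vnorm_approx hN y e'0.
(* [r] is the room below [xi] for the rational approximation. Shrinking and approximating each cost
   at most [r * D <= e / 4], and the near-optimal [x] costs [e / 2]. *)
pose r := Num.min xi (e / (4 * (D + 1))).
have D1 : 0 < 4 * (D + 1) by rewrite mulr_gt0// ltr_wpDl.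
have r0 : 0 < r by rewrite lt_min xi0 divr_gt0.
have rxi : r <= xi by rewrite ge_min lexx.
have rD : r * (4 * (D + 1)) <= e by rewrite -ler_pdivlMr// ge_min lexx orbT.
have [k hk] := rational_vec_vnorm_dense hN ((xi - r) *: x) r0.
exists k; have xr : 0 <= xi - r by lra.
have xiE : xi * (e / (2 * xi)) = e / 2 by field; rewrite gt_eqF.
split.
  have := vnormD hN ((xi - r) *: x) (rational_vec k - (xi - r) *: x).
  rewrite addrC subrK -(vnormN hN (_ - _)) opprB vnormZ// ger0_norm//.
  have : (xi - r) * N x <= xi - r by rewrite ler_piMr.
  lra.
have := dotp_le_dual_vnorm hN ((xi - r) *: x - rational_vec k) y.
have -> : dotp ((xi - r) *: x - rational_vec k) y =
    (xi - r) * dotp x y - dotp (rational_vec k) y.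
  by rewrite dotpBl dotpZl.
rewrite -/D => h1; move: hx; rewrite -/D => hx.
have h2 : N ((xi - r) *: x - rational_vec k) * D <= r * D.
  by rewrite ler_wpM2r// ltW.
have h3 : (xi - r) * (D - e / (2 * xi)) <= (xi - r) * dotp x y.
  by rewrite ler_wpM2l// ltW.
have h4 : 0 <= r * (e / (2 * xi)) by rewrite mulr_ge0// ltW.
have : 0 <= r * D by rewrite mulr_ge0// ltW.
move: h3; rewrite mulrBr !mulrBl xiE; lra.
Qed.

(** A countable supremum over vectors, needed both for measurability and for the greedy selection in
    [Efun_conj_le]. As the dual norm is nonnegative, only [|xi|] matters, and a rational vector of
    norm below [|xi|] whose pairing with [y] is nearly [|xi| * Nd y] can replace [xi]. *)
Lemma conjugate_dual_vnormE (y : 'rV[R]_n) (b : R) (w : T) : 0 < b ->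
  conjugate Phi (Nd y / b) w = ereal_sup (range (fun k =>
    (dotp (rational_vec k) y / b)%:E - hull Phi (N (rational_vec k)) w)%E).
Proof.
move=> b0; apply/le_anti/andP; split; last first.
  apply: ge_ereal_sup => _ [k _ <-].
  have := young (rational_vec k) y w b0; have := Psi0 (N (rational_vec k)) w.
  have := conj0 (Nd y / b) w.
  case: (hull _ _ _) => [h| |//]; last by rewrite /= leNye.
  case: (conjugate _ _ _) => [c| |//] _ _; last by rewrite leey.
  rewrite -EFinD -EFinM lee_fin -EFinB lee_fin => h1.
  by rewrite lerBlDr ler_pdivrMr// mulrC addrC.
set S := ereal_sup _.
have S0 : (0 <= S)%E.
  apply: ereal_sup_ubound; exists (pickle (0 : 'rV[rat]_n)) => //.
  by rewrite /rational_vec pickleK /= map_mx0 dotp0l mul0r (vnorm0 hN) hull0// sube0.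
apply: ge_ereal_sup => _ [xi _ <-].
have := Phi_ge0 xi w; case Exi : (Phi xi w) => [a| |//] a0; last by rewrite leNye.
have xia : (hull Phi `|xi| w <= a%:E)%E.
  rewrite -Exi; apply: (@le_trans _ _ (hull Phi xi w)); last exact: hull_le.
  by apply: le_hull => //; rewrite normr_id.
have Ndb : 0 <= Nd y / b by rewrite divr_ge0 ?(dual_vnorm_ge0 hN)// ltW.
apply: (@le_trans _ _ (`|xi| * (Nd y / b) - a)%:E).
  by rewrite -EFinB lee_fin lerB// ler_wpM2r// ler_norm.
have [->|xi0] := eqVneq xi 0.
  apply: le_trans S0; rewrite lee_fin normr0 mul0r sub0r oppr_le0.
  by rewrite -lee_fin.
apply/lee_addgt0Pr => e e0.
have xip : 0 < `|xi| by rewrite normr_gt0.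
have [k [Nk hk]] := rational_vec_dual y xip (mulr_gt0 e0 b0).
apply: (@le_trans _ _ (((dotp (rational_vec k) y / b)%:E - hull Phi (N (rational_vec k)) w) + e%:E)%E); last first.
  by rewrite leeD2r//; apply: ereal_sup_ubound; exists k.
have : (hull Phi (N (rational_vec k)) w <= a%:E)%E.
  apply: le_trans xia; apply: le_hull => //.
  by rewrite normr_id ger0_norm ?vnorm_ge0// ltW.
have := Psi0 (N (rational_vec k)) w.
case: (hull _ _ _) => [h| |//] // h0; rewrite lee_fin => ha.
rewrite -EFinB -EFinD lee_fin.
have : `|xi| * (Nd y / b) - e <= dotp (rational_vec k) y / b.
  by rewrite ler_pdivlMr// mulrBl mulrA divfK// gt_eqF.
lra.
Qed.

Lemma measurable_conjugate_vnorm y (b : R) : 0 < b -> measurable_vec y ->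
  measurable_fun setT (fun w => conjugate Phi (Nd (y w) / b) w).
Proof.
move=> b0 my; under eq_fun do rewrite conjugate_dual_vnormE//.
apply: measurable_ereal_sup_seq => k; apply: emeasurable_funB.
  apply/measurable_EFinP; apply: measurable_funM => //.
  by apply: measurable_dotp => //; exact: measurable_vec_cst.
exact: measurable_hull.
Qed.

Local Notation Ec y b := (Efun P (conjugate Phi) (fun w => Nd (y w) / b)).

Lemma Efun_conj_ge0 y b : (0 <= Ec y b)%E.
Proof. by apply: integral_ge0. Qed.

Lemma abs_young (x y : 'rV[R]_n) (b : R) (w : T) : 0 < b ->
  (`|(dotp x y)%:E| <= b%:E * (hull Phi (N x) w + conjugate Phi (Nd y / b) w))%E.
Proof.
move=> b0; have h1 := young x y w b0; have := young (- x) y w b0.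
rewrite (vnormN hN) -scaleN1r dotpZl mulN1r => h2.
by have [s|s] := leP 0 (dotp x y);
  [rewrite abse_EFin ger0_norm|rewrite abse_EFin ltr0_norm].
Qed.

Lemma integrable_dotp u y (b : R) : measurable_vec u -> measurable_vec y -> 0 < b ->
  (E u < +oo)%E -> (Ec y b < +oo)%E ->
  P.-integrable setT (fun w => (dotp (u w) (y w))%:E).
Proof.
move=> mu my b0 Eu Ey.
have mE := measurable_modular hN Phi_ge0 Phi_convex mu.
have mC := measurable_conjugate_vnorm b0 my.
have iE : P.-integrable setT (fun w => hull Phi (N (u w)) w).
  apply/integrableP; split => //; apply: le_lt_trans Eu.
  by rewrite le_eqVlt; apply/orP; left; apply/eqP; apply: eq_integral => w _; rewrite gee0_abs.
have iC : P.-integrable setT (fun w => conjugate Phi (Nd (y w) / b) w).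
  apply/integrableP; split => //; apply: le_lt_trans Ey.
  by rewrite le_eqVlt; apply/orP; left; apply/eqP; apply: eq_integral => w _; rewrite gee0_abs.
apply: (le_integrable measurableT _ _ (integrableZl measurableT b (integrableD measurableT iE iC))).
  by apply/measurable_EFinP; exact: measurable_dotp.
move=> w _; apply: (le_trans (abs_young _ _ _ b0)); exact: lee_abs.
Qed.

Lemma EdotE u y : P.-integrable setT (fun w => (dotp (u w) (y w))%:E) ->
  (Edot P y u)%:E = (\int[P]_w (dotp (u w) (y w))%:E)%E.
Proof.
move=> i; rewrite /Edot unlock fineK//.
exact: (integrable_fin_num measurableT i).
Qed.

Lemma Edot_young u y (b : R) : measurable_vec u -> measurable_vec y -> 0 < b ->
  (E u < +oo)%E -> (Ec y b < +oo)%E ->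
  ((Edot P y u)%:E <= b%:E * (E u + Ec y b))%E.
Proof.
move=> mu my b0 Eu Ey; have i := integrable_dotp mu my b0 Eu Ey.
have mE := measurable_modular hN Phi_ge0 Phi_convex mu.
have mC := measurable_conjugate_vnorm b0 my.
rewrite EdotE// /modular /Efun -ge0_integralD// -ge0_integralZl//; last 3 first.
- exact: emeasurable_funD.
- by move=> w _; rewrite adde_ge0.
- by rewrite lee_fin ltW.
apply: (le_trans (lee_abs _)).
apply: (le_trans (le_abse_integral P measurableT (measurable_int _ i))).
apply: ge0_le_integral => //.
- exact/measurableT_comp/(measurable_int _ i).
- by apply: measurable_funeM; exact: emeasurable_funD.
by move=> w _; exact: abs_young.
Qed.

Lemma Edot_linear (c : R) u v y :
  P.-integrable setT (fun w => (dotp (u w) (y w))%:E) ->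
  P.-integrable setT (fun w => (dotp (v w) (y w))%:E) ->
  Edot P y (c *: u + v) = c * Edot P y u + Edot P y v.
Proof.
move=> iu iv; apply: EFin_inj; rewrite EFinD EFinM !EdotE//.
  rewrite -integralZl// -integralD//; last exact: integrableZl.
  by apply: eq_integral => w _; rewrite -EFinM -EFinD dotpDl dotpZl.
apply: (@eq_integrable _ _ _ _ _ measurableT
  ((fun w => c%:E * (dotp (u w) (y w))%:E) \+ (fun w => (dotp (v w) (y w))%:E))%E).
  by move=> w _; rewrite -EFinM -EFinD dotpDl dotpZl.
by apply: integrableD => //; exact: integrableZl.
Qed.

Lemma Linfty_integrable_dotp u y : Linfty P u -> L1 P y ->
  P.-integrable setT (fun w => (dotp (u w) (y w))%:E).
Proof.
move=> /(Linfty_coordP P hN)[mu [M [M0 hM]]] Ly; have my := L1_measurable Ly.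
have /L1P iy := Ly.
have iabs : P.-integrable setT (fun w => \sum_j `|(y w 0 j)%:E|)%E.
  by apply: integrable_sum => // j _; exact/integrable_abse.
have mS : measurable_fun setT (fun w => \sum_j `|(y w 0 j)%:E|)%E.
  exact: measurable_int iabs.
apply/integrableP; split; first by apply/measurable_EFinP; exact: measurable_dotp.
apply: (@le_lt_trans _ _ (\int[P]_w (M%:E * \sum_j `|(y w 0 j)%:E|))%E).
  apply: ae_ge0_le_integral => //.
  - by apply: measurableT_comp => //; apply/measurable_EFinP; exact: measurable_dotp.
  - by move=> w _; rewrite mule_ge0 ?lee_fin// sume_ge0.
  - exact: measurable_funeM.
  apply: filterS hM => w hM _; rewrite abse_EFin.
  under eq_bigr do rewrite abse_EFin.
  rewrite sumEFin -EFinM lee_fin mulr_sumr; apply: (le_trans (ler_norm_sum _ _ _)).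
  by apply: ler_sum => j _; rewrite normrM ler_wpM2r.
by apply: (integrable_lty measurableT); exact: integrableZl.
Qed.

End conjugate_integrals.

(** * Duality *)

Section orlicz_duality.
Context {d : measure_display} {T : measurableType d} {R : realType}.
Context {P : probability T R} {n : nat} {N : 'rV[R]_n -> R} (hN : is_norm N).
Context {Phi : R -> T -> \bar R}.
Hypothesis Phi_ge0 : forall xi w, (0 <= Phi xi w)%E.
Hypothesis Phi_convex : random_convex Phi.
Hypothesis Phi_sym : forall xi w, Phi (- xi) w = Phi xi w.
Hypothesis Phi0 : forall w, Phi 0 w = 0%E.
Hypothesis Phi_L1 : exists2 a : R, 0 < a &
  P.-integrable setT (Phi a) /\ P.-integrable setT (conjugate Phi a).
Implicit Types (u v y : T -> 'rV[R]_n) (m : set T -> 'rV[R]_n).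

Local Notation E := (modular P N Phi).
Local Notation L := (luxemburg P N Phi).
Local Notation LPhi := (orlicz P N Phi).
Local Notation Nd := (dual_vnorm N).
Local Notation Ec y b := (Efun P (conjugate Phi) (fun w => Nd (y w) / b)).

Let LP u b := @luxemburg_leP _ _ _ P _ _ hN _ Phi_ge0 Phi_convex Phi_sym Phi0 u b.
Let sL := seminorm_on_orlicz hN Phi_ge0 Phi_convex Phi_sym Phi0 Phi_L1.
Let sI := @seminorm_on_Linfty _ _ _ P _ _ hN.
Let mE u := @measurable_modular _ _ _ _ _ hN _ Phi_ge0 Phi_convex u.
Let leE u v := @le_modular _ _ _ P _ _ hN _ Phi_ge0 Phi_convex u v.
Let E0 u : (0 <= E u)%E. Proof. exact: modular_ge0. Qed.
Let ILP u := Linfty_orlicz hN Phi_ge0 Phi_convex Phi_sym Phi0 Phi_L1 (u:=u).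
Let mI u (Lu : Linfty P u) := Linfty_measurable hN Lu.
Let L0 u : (0 <= L u)%E. Proof. exact: luxemburg_ge0. Qed.

Lemma vrestr_in A u w : A w -> vrestr A u w = u w.
Proof. by move=> Aw; rewrite /vrestr indicE mem_set// scale1r. Qed.

Lemma vrestr_notin A u w : ~ A w -> vrestr A u w = 0.
Proof. by move=> Aw; rewrite /vrestr indicE memNset// scale0r. Qed.

(* A greedy choice among rational vectors gives bounded u_k for which the
   integrand of the conjugate increases to its supremum. *)
Lemma Efun_conj_le y (b c : R) : L1 P y -> 0 < b ->
  (forall u, Linfty P u -> (E u < +oo)%E -> ((Edot P y u)%:E <= c%:E + b%:E * E u)%E) ->
  (Ec y b <= (c / b)%:E)%E.
Proof.
move=> Ly b0 h; have my := L1_measurable Ly.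
pose G x w := ((dotp x (y w) / b)%:E - hull Phi (N x) w)%E.
have mG v : measurable_vec v -> measurable_fun setT (fun w => G (v w) w).
  move=> mv; apply: emeasurable_funB; last exact: mE.
  by apply/measurable_EFinP; apply: measurable_funM => //; exact: measurable_dotp.
pose A v k := [set w | (G (v w) w < G (rational_vec k) w)%E].
have mA v k : measurable_vec v -> measurable (A v k).
  move=> mv; rewrite -[A v k]setTI; apply: emeasurable_fun_lt => //; first exact: mG.
  exact: (mG _ (measurable_vec_cst _)).
pose u := fix u k : T -> 'rV[R]_n := if k is k'.+1 then
  vrestr (A (u k') k') (fun=> rational_vec k') + vrestr (~` A (u k') k') (u k') else 0.
have Lu k : Linfty P (u k).
  elim: k => [|k ih]; first exact: (Linfty0 P hN).
  have mAk : measurable (A (u k) k) by apply: mA; exact: mI.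
  apply: (LinftyD hN); apply: (Linfty_vrestr hN) => //; last exact: measurableC.
  exact: (Linfty_cst P hN).
have uA k w : A (u k) k w -> u k.+1 w = rational_vec k.
  by move=> Aw; rewrite /= !fctE vrestr_in// vrestr_notin ?addr0//; exact.
have uNA k w : ~ A (u k) k w -> u k.+1 w = u k w.
  by move=> Aw; rewrite /= !fctE vrestr_notin// vrestr_in ?add0r.
have G0 w : G 0 w = 0%E by rewrite /G dotp0l mul0r (vnorm0 hN) hull0// sube0.
have Gle k w : (G (u k w) w <= G (u k.+1 w) w)%E.
  have [Aw|Aw] := pselect (A (u k) k w); first by rewrite (uA _ _ Aw); exact: ltW.
  by rewrite (uNA _ _ Aw).
have rle k w : (G (rational_vec k) w <= G (u k.+1 w) w)%E.
  have [Aw|Aw] := pselect (A (u k) k w); first by rewrite (uA _ _ Aw).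
  by rewrite (uNA _ _ Aw) leNgt; apply/negP.
have ndG w : {homo (fun k => G (u k w) w) : k l / (k <= l)%N >-> (k <= l)%E}.
  by apply/nondecreasing_seqP => k; exact: Gle.
have Gge0 k w : (0 <= G (u k w) w)%E by rewrite -(G0 w); exact: (ndG w 0%N k).
have IG k : (\int[P]_w G (u k w) w <= (c / b)%:E)%E.
  have iD := Linfty_integrable_dotp hN (Lu k) Ly.
  (* [G] is nonnegative along the greedy sequence, so the modular of [u k] is bounded by a finite
     pairing; this is what makes [h] applicable to [u k]. *)
  have IE : (\int[P]_w G (u k w) w + E (u k) = (Edot P y (u k) / b)%:E)%E.
    rewrite /modular -ge0_integralD//; last 3 first.
    - by apply: mG; exact: mI.
    - by move=> w _; exact: hull_ge0.
    - by apply: mE; exact: mI.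
    rewrite mulrC EFinM EdotE// -integralZl//; apply: eq_integral => w _.
    have := Gge0 k w; have := hull_ge0 Phi (N (u k w)) w; rewrite /G.
    by case: (hull _ _ _) => [q| |] // _ _; rewrite -EFinB -EFinD subrK mulrC EFinM.
  have I0 : (0 <= \int[P]_w G (u k w) w)%E by apply: integral_ge0 => w _; exact: Gge0.
  have Eoo : (E (u k) < +oo)%E.
    by apply: (@le_lt_trans _ _ (Edot P y (u k) / b)%:E); rewrite ?ltry// -IE leeDr.
  have := h _ (Lu k) Eoo; move: IE I0 (E0 (u k)) Eoo.
  case: (integral _ _ _) => [q| |] //; case: (E (u k)) => [e| |] //.
  rewrite -EFinD => -[IE] _ _ _; rewrite -EFinM -EFinD !lee_fin => hk.
  rewrite ler_pdivlMr//; have : b * (q + e) = Edot P y (u k).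
    by rewrite IE; field; rewrite gt_eqF.
  lra.
apply: (@le_trans _ _ (\int[P]_w (limn (fun k => G (u k w) w)))%E).
  apply: ge0_le_integral => //.
  - by move=> w _; exact: conjugate_ge0.
  - exact: measurable_conjugate_vnorm.
  - apply: (emeasurable_fun_cvg (fun k w => G (u k w) w)) => [k|w _].
      by apply: mG; exact: mI.
    by apply: ereal_nondecreasing_is_cvgn; exact: ndG.
  move=> w _; rewrite (conjugate_dual_vnormE hN Phi_ge0 Phi_convex Phi_sym Phi0)//.
  apply: ge_ereal_sup => _ [k _ <-]; apply: (le_trans (rle k w)).
  apply: lime_ge; first exact: ereal_nondecreasing_is_cvgn (ndG w).
  by exists k.+1 => // l kl; exact: (ndG w k.+1 l kl).
rewrite (monotone_convergence P measurableT)//; last by move=> k; apply: mG; exact: mI.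
apply: lime_le; last exact: nearW.
apply: ereal_nondecreasing_is_cvgn => k l kl; apply: ge0_le_integral => //.
- by apply: mG; exact: mI.
- by apply: mG; exact: mI.
by move=> w _; exact: ndG.
Qed.
Lemma orlicz_conjP y : orlicz_conj P N Phi y ->
  L1 P y /\ exists2 b : R, 0 < b & (Ec y b <= 1)%E.
Proof.
move=> [Ly /ereal_inf_lt[_ [b [b0 hb] <-] _]]; split => //.
by exists b.
Qed.

Lemma Efun_conj_orlicz y (b : R) : L1 P y -> 0 < b -> (Ec y b <= 1)%E ->
  orlicz_conj P N Phi y.
Proof.
move=> Ly b0 hb; split => //; apply: (@le_lt_trans _ _ b%:E); last exact: ltry.
by apply: ereal_inf_lbound; exists b.
Qed.

Lemma luxemburg_ltP u (b : R) : LPhi u -> fine (L u) < b ->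
  0 < b /\ (E (b^-1 *: u)%R <= 1)%E.
Proof.
move=> Lu ub; have b0 : 0 < b by apply: le_lt_trans ub; exact: (seminorm_fine_ge0 sL).
split=> //; apply/LP => //; first exact: orlicz_measurable Lu.
by rewrite -(seminorm_fineK sL Lu) lee_fin ltW.
Qed.

Lemma orlicz_conj_integrable y u : orlicz_conj P N Phi y -> LPhi u ->
  P.-integrable setT (fun w => (dotp (u w) (y w))%:E).
Proof.
move=> /orlicz_conjP[Ly [b b0 hb]] Lu.
have [|a0 ha] := luxemburg_ltP (b := fine (L u) + 1) Lu; first by rewrite ltrDl.
set a := _ + 1 in a0 ha; have mu := orlicz_measurable Lu.
have i := integrable_dotp hN Phi_ge0 Phi_convex Phi_sym Phi0
  (measurable_vecZ a^-1 mu) (L1_measurable Ly) b0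
  (le_lt_trans ha (ltry 1)) (le_lt_trans hb (ltry 1)).
apply: (@eq_integrable _ _ _ _ _ measurableT
  (fun w => a%:E * (dotp ((a^-1 *: u) w) (y w))%:E)%E); last exact: integrableZl.
by move=> w _; rewrite -EFinM !fctE dotpZl mulVKf// gt_eqF.
Qed.

(** Young's inequality for the normalized vector, where the modular and the conjugate integral are
    both at most 1; their sum is the factor 2. *)
Lemma Edot_orlicz_le y (b : R) u : L1 P y -> 0 < b -> (Ec y b <= 1)%E -> LPhi u ->
  (`|Edot P y u|%:E <= (2 * b)%:E * L u)%E.
Proof.
move=> Ly b0 hb Lu; have Lsy := Efun_conj_orlicz Ly b0 hb.
have half v : LPhi v -> Edot P y v <= 2 * b * fine (L v).
  move=> Lv; have iv := orlicz_conj_integrable Lsy Lv.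
  apply/ler_addgt0Pr => e e0.
  have e20 : 0 < e / (2 * b) by rewrite divr_gt0// mulr_gt0.
  have [|a0 ha] := luxemburg_ltP (b := fine (L v) + e / (2 * b)) Lv.
    by rewrite ltrDl.
  set a := _ + _ in a0 ha; have mv := orlicz_measurable Lv.
  have := Edot_young hN Phi_ge0 Phi_convex Phi_sym Phi0
    (measurable_vecZ a^-1 mv) (L1_measurable Ly) b0
    (le_lt_trans ha (ltry 1)) (le_lt_trans hb (ltry 1)).
  have -> : Edot P y (a^-1 *: v) = a^-1 * Edot P y v.
    have i0 : P.-integrable setT (fun w => (dotp ((0 : T -> 'rV[R]_n) w) (y w))%:E).
      apply: (orlicz_conj_integrable Lsy); exact: (seminorm_on0 sL).
    rewrite -[X in Edot P y X]addr0 (Edot_linear _ iv i0).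
    suff -> : Edot P y 0 = 0 by rewrite addr0.
    have := Edot_linear 0 i0 i0; rewrite scale0r add0r mul0r add0r => _.
    have := Edot_linear 1 i0 i0; rewrite scale1r mul1r addr0; lra.
  move=> /le_trans/(_ (lee_wpmul2l _ (leeD ha hb))).
  rewrite lee_fin => /(_ (ltW b0)); rewrite -EFinD -EFinM lee_fin mulrC ler_pdivrMr//.
  have -> : 2 * b * fine (L v) + e = b * (1 + 1) * a.
    by rewrite /a; field; rewrite gt_eqF.
  by [].
rewrite -(seminorm_fineK sL Lu) -EFinM lee_fin; have := half _ Lu.
have Lnu : LPhi (- u) by rewrite -scaleN1r; apply: (linZ (seminorm_on0 sL) (seminorm_onZD sL)).
have := half _ Lnu; rewrite (seminorm_fineN sL)//.
have -> : Edot P y (- u) = - Edot P y u.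
  have iu := orlicz_conj_integrable Lsy Lu.
  have := Edot_linear (-1) iu iu; rewrite scaleN1r addNr.
  have := Edot_linear 1 iu (orlicz_conj_integrable Lsy Lnu); rewrite scale1r addrN; lra.
by rewrite ler_norml => h1 h2; apply/andP; split; lra.
Qed.

Lemma Edot_orlicz y : orlicz_conj P N Phi y ->
  linear_on LPhi (Edot P y) /\ bounded_on LPhi L (Edot P y).
Proof.
move=> Lsy; split=> [c u v Lu Lv|].
  by apply: Edot_linear; exact: orlicz_conj_integrable.
have [Ly [b b0 hb]] := orlicz_conjP Lsy.
by exists (2 * b); [rewrite mulr_ge0// ltW|move=> u; exact: Edot_orlicz_le].
Qed.

(** Recovers the factor [t < 1] lost in passing from the hull to [Phi]. *)
Lemma ler_of_scale (x s : R) : 0 <= s -> (forall t, 0 <= t < 1 -> t * x <= s) -> x <= s.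
Proof.
move=> s0 h; rewrite leNgt; apply/negP => sx; have x0 : 0 < x by exact: le_lt_trans sx.
have sx1 : s / x < 1 by rewrite ltr_pdivrMr// mul1r.
have sx0 : 0 <= s / x by rewrite divr_ge0// ltW.
have := h ((s / x + 1) / 2) _; have -> : (s / x + 1) / 2 * x = (s + x) / 2.
  by field; rewrite gt_eqF.
suff -> : 0 <= (s / x + 1) / 2 < 1 by move=> /(_ isT); lra.
by apply/andP; split; lra.
Qed.

Lemma sigma_ge0 m : M1 P m -> (0 <= sigma P N Phi m)%E.
Proof.
move=> hm; apply: ereal_sup_ubound; exists 0.
  split; first exact: (Linfty0 P hN).
  rewrite /Efun; under eq_integral => w _ do rewrite /= (vnorm0 hN) Phi0.
  by rewrite integral0 ltry.
have [ml _ _] := mint_spec hN hm.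
by rewrite (linear_on0 ml (seminorm_on0 (seminorm_on_rho hN hm))).
Qed.

(** The constraint in [sigma] is stated with [Phi], the one here with the hull; [t *: u] satisfies
    the former for every [t < 1]. *)
Lemma mint_le_sigma_Linfty m u : M1 P m -> Linfty P u -> (E u < +oo)%E ->
  ((mint P N m u)%:E <= sigma P N Phi m)%E.
Proof.
move=> hm Lu Eu; have [ml _ _] := mint_spec hN hm.
have S0 := seminorm_on0 (seminorm_on_rho hN hm).
have scl t : 0 <= t < 1 -> ((t * mint P N m u)%:E <= sigma P N Phi m)%E.
  move=> t01; rewrite -(linear_onZ ml S0)//; last exact: (Linfty_dom_rho hN hm).
  apply: ereal_sup_ubound; exists (t *: u) => //; split.
    exact: (LinftyZ hN).
  apply: le_lt_trans Eu.
  exact: (Efun_scale_le_modular hN Phi_ge0 Phi_convex Phi_sym Phi0).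
move: scl; have := sigma_ge0 hm; case: (sigma _ _ _ _) => [s| |] // => [|_ _]; last by rewrite leey.
by rewrite lee_fin => s0 scl; apply: ler_of_scale => // t /scl; rewrite lee_fin.
Qed.

(** A competitor for [rho u], scaled to modular at most 1, is bounded by the finite value of
    [sigma]. Domination of the coordinates need not give domination of [N], hence the factor
    [C * C'] from comparing [N] with the largest coordinate. *)
Lemma rho_orlicz_le m : Ms P N Phi m -> exists2 K : R, 0 <= K & forall u, LPhi u ->
  (rho P N m u <= K%:E * L u)%E.
Proof.
move=> [[hm _]]; have := sigma_ge0 hm; case Es : (sigma _ _ _ _) => [s| |//] // s0 _.
rewrite lee_fin in s0.
have [C C0 hC] := vnorm_le_coord hN; have [C' C'0 hC'] := coord_le_vnorm hN.
have CC : 0 < C * C' by exact: mulr_gt0.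
exists (s * (C * C')); first by rewrite mulr_ge0// ltW.
have [ml _ mb] := mint_spec hN hm.
have S0 := seminorm_on0 (seminorm_on_rho hN hm).
move=> u Lu; rewrite -(seminorm_fineK sL Lu) -EFinM.
apply: rho_le => v Lv vu; rewrite lee_fin; apply/ler_addgt0Pr => e e0.
have mu := orlicz_measurable Lu; have mv := mI Lv.
have K1 : 0 < s * (C * C') + 1 by rewrite ltr_wpDl// mulr_ge0// ltW.
pose e' := e / (s * (C * C') + 1); have e'0 : 0 < e' by exact: divr_gt0.
have [|b0 hb] := luxemburg_ltP (b := fine (L u) + e') Lu; first by rewrite ltrDl.
set b := _ + e' in b0 hb.
pose t := (C * C' * b)^-1; have t0 : 0 < t by rewrite invr_gt0 mulr_gt0.
have Lt : Linfty P (t *: v) by exact: (LinftyZ hN).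
have Et : (E (t *: v)%R <= 1)%E.
  apply: le_trans hb; apply: leE; [exact: measurable_vecZ|exact: measurable_vecZ|].
  apply: filterS vu => w hw; rewrite !fctE !(vnormZ hN) (gtr0_norm t0) gtr0_norm ?invr_gt0//.
  have : N (v w) <= C * (C' * N (u w)).
    apply: hC => [|j]; first by rewrite mulr_ge0 ?(vnorm_ge0 hN)// ltW.
    exact: le_trans (hw j) (hC' _ _).
  have -> : b^-1 * N (u w) = t * (C * (C' * N (u w))).
    by rewrite /t; field; rewrite !gt_eqF.
  by rewrite ler_pM2l.
have := mint_le_sigma_Linfty hm Lt (le_lt_trans Et (ltry 1)).
rewrite Es lee_fin (linear_onZ ml S0); last exact: (Linfty_dom_rho hN hm).
rewrite mb// /t mulrC ler_pdivrMr ?mulr_gt0// => h1; apply: (le_trans h1).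
have : s * (C * C') * e' <= e.
  have : e' * (s * (C * C') + 1) = e by rewrite /e' divfK// gt_eqF.
  by rewrite mulrDr mulr1 mulrC; lra.
have -> : s * (C * C' * b) = s * (C * C') * b by rewrite !mulrA.
rewrite /b mulrDr; lra.
Qed.

Lemma orlicz_dom_rho m u : Ms P N Phi m -> LPhi u -> dom_rho P N m u.
Proof.
move=> /rho_orlicz_le[K K0 hK] Lu; split; first exact: orlicz_L1 Lu.
by apply: (le_lt_trans (hK _ Lu)); rewrite -(seminorm_fineK sL Lu) -EFinM ltry.
Qed.

Lemma mint_orlicz m : Ms P N Phi m ->
  linear_on LPhi (mint P N m) /\ bounded_on LPhi L (mint P N m).
Proof.
move=> hMs; have [[hm _] _] := hMs; have [ml mr _] := mint_spec hN hm.
have D u := @orlicz_dom_rho _ u hMs.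
split=> [c u v /D Du /D Dv|]; first exact: ml.
have [K K0 hK] := rho_orlicz_le hMs; exists K => // u Lu.
by apply: le_trans (hK _ Lu); apply: mr; exact: D.
Qed.

Lemma ypair_orlicz y m : orlicz_conj P N Phi y -> Ms P N Phi m ->
  linear_on LPhi (ypair P N y m) /\ bounded_on LPhi L (ypair P N y m).
Proof.
move=> /Edot_orlicz[el [K K0 eb]] /mint_orlicz[ml [K' K'0 mb]]; split=> [c u v Lu Lv|].
  by rewrite /ypair el// ml// mulrDr addrACA.
exists (K + K'); first exact: addr_ge0.
move=> u Lu; have := eb _ Lu; have := mb _ Lu.
rewrite -(seminorm_fineK sL Lu) -!EFinM !lee_fin mulrDl => h1 h2.
by apply: (le_trans (ler_normD _ _)); lra.
Qed.
(** Here [y] is merely in L^1: the density of the Yosida-Hewitt decomposition is paired with bounded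
    vectors before it is known to lie in the conjugate space. *)
Lemma Edot_Linfty y : L1 P y ->
  linear_on (Linfty P) (Edot P y) /\ bounded_on (Linfty P) (Linfty_norm P N) (Edot P y).
Proof.
move=> Ly; split=> [c u v Lu Lv|].
  by apply: Edot_linear; exact: (Linfty_integrable_dotp hN).
have [C C0 hC] := coord_le_vnorm hN; have my := L1_measurable Ly.
have /L1P iy := Ly.
have iabs : P.-integrable setT (fun w => \sum_j `|(y w 0 j)%:E|)%E.
  by apply: integrable_sum => // j _; exact/integrable_abse.
have S0 : (0 <= \int[P]_w (\sum_j `|(y w 0 j)%:E|))%E.
  by apply: integral_ge0 => w _; exact: sume_ge0.
have Sf : (\int[P]_w (\sum_j `|(y w 0 j)%:E|))%E \is a fin_num.
  exact: integrable_fin_num.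
exists (C * fine (\int[P]_w (\sum_j `|(y w 0 j)%:E|))%E).
  by rewrite mulr_ge0 ?fine_ge0// ltW.
move=> u Lu; have [M M0 hM] := Linfty_norm_fin hN Lu.
have i := Linfty_integrable_dotp hN Lu Ly.
rewrite -abse_EFin EdotE//; apply: (le_trans (le_abse_integral P measurableT (measurable_int _ i))).
rewrite hM EFinM fineK// muleAC -EFinM -ge0_integralZl//; last 3 first.
- exact: measurable_int iabs.
- by move=> w _; exact: sume_ge0.
- by rewrite lee_fin mulr_ge0// ltW.
apply: ae_ge0_le_integral => //.
- by apply: measurableT_comp => //; exact: measurable_int i.
- by move=> w _; rewrite mule_ge0 ?lee_fin ?mulr_ge0 ?sume_ge0// ltW.
- by apply: measurable_funeM; exact: measurable_int iabs.
apply: filterS (Linfty_norm_ae hN hM) => w hw _; rewrite abse_EFin.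
under eq_bigr do rewrite abse_EFin.
rewrite sumEFin -EFinM lee_fin mulr_sumr; apply: (le_trans (ler_norm_sum _ _ _)).
apply: ler_sum => j _; rewrite normrM ler_wpM2r//; apply: (le_trans (hC _ _)).
by rewrite ler_pM2l.
Qed.

Lemma dotp_vrestr A u y w : dotp (vrestr A u w) (y w) = \1_A w * dotp (u w) (y w).
Proof. by rewrite /vrestr dotpZl. Qed.

Lemma vrestrI A B u : vrestr A (vrestr B u) = vrestr (A `&` B) u.
Proof. by apply/funext => w; rewrite /vrestr scalerA indicI. Qed.

Lemma vrestrZD A (c : R) u v : vrestr A (c *: u + v) = c *: vrestr A u + vrestr A v.
Proof.
apply/funext => w; rewrite /vrestr !fctE scalerDr !scalerA; congr (_ + _).
by rewrite mulrC.
Qed.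

Lemma vrestrDC A u : vrestr A u + vrestr (~` A) u = u.
Proof.
apply/funext => w; rewrite !fctE; have [Aw|Aw] := pselect (A w).
  by rewrite vrestr_in// vrestr_notin ?addr0//; exact.
by rewrite vrestr_notin// vrestr_in ?add0r.
Qed.

Lemma linear_vrestr_cst (l : (T -> 'rV[R]_n) -> R) A x : measurable A ->
  linear_on (Linfty P) l ->
  l (vrestr A (fun=> x)) = \sum_j x 0 j * l (vrestr A (fun=> delta_mx 0 j)).
Proof.
move=> mA ll; have S0 := seminorm_on0 sI.
have LA (z : 'rV[R]_n) : Linfty P (vrestr A (fun=> z)).
  exact: (Linfty_vrestr hN mA (Linfty_cst P hN z)).
rewrite {1}[x]row_sum_delta.
have fD (z z' : 'rV[R]_n) : l (vrestr A (fun=> z + z')) = l (vrestr A (fun=> z)) + l (vrestr A (fun=> z')).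
  rewrite -(linear_onD ll)//; congr l; apply/funext => w.
  by rewrite !fctE /vrestr scalerDr.
have f0 : l (vrestr A (fun=> 0)) = 0.
  rewrite -[RHS](linear_on0 ll S0); congr l; apply/funext => w.
  by rewrite /vrestr scaler0.
rewrite (big_morph (fun z => l (vrestr A (fun=> z))) fD f0).
apply: eq_bigr => j _; rewrite -(linear_onZ ll S0)//; congr l.
by apply/funext => w; rewrite !fctE /vrestr !scalerA mulrC.
Qed.

Lemma mint_bdd_vrestr0 m A u : M1 P m -> measurable A ->
  (forall B, measurable B -> B `<=` A -> m B = 0) -> Linfty P u ->
  mint_bdd P N m (vrestr A u) = 0.
Proof.
move=> hm mA m0 Lu; have [ml [K K0 mb] mE'] := mint_bdd_spec hm hN.
apply: (@Linfty_linear_eq0 _ _ _ P _ _ hN (fun v => mint_bdd P N m (vrestr A v))) => //.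
- move=> c v v' Lv Lv'; rewrite vrestrZD ml//; exact: (Linfty_vrestr hN).
- exists K => // v Lv; apply: (le_trans (mb _ (Linfty_vrestr hN mA Lv))).
  apply: lee_wpmul2l; first by rewrite lee_fin.
  have [M M0 hM] := Linfty_norm_fin hN Lv; rewrite hM; apply/(Linfty_norm_leP P hN) => //.
  apply: filterS (Linfty_norm_ae hN hM) => w; exact/le_trans/(vnorm_vrestr_le hN).
move=> B x mB; rewrite vrestrI mE' ?m0//; try exact: measurableI.
by rewrite /dotp big1// => j _; rewrite mxE mulr0.
Qed.

Lemma mint_bdd_vrestr m A u : M1 P m -> measurable A ->
  (forall B, measurable B -> B `&` A = set0 -> m B = 0) -> Linfty P u ->
  mint_bdd P N m (vrestr A u) = mint_bdd P N m u.
Proof.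
move=> hm mA m0 Lu; have [ml _ _] := mint_bdd_spec hm hN.
rewrite -[in RHS](vrestrDC A u) (linear_onD ml).
- rewrite (mint_bdd_vrestr0 (A := ~` A))// ?addr0//; first exact: measurableC.
  by move=> B mB BA; apply: m0 => //; apply/disjoints_subset.
- exact: (Linfty_vrestr hN).
- by apply: (Linfty_vrestr hN) => //; exact: measurableC.
Qed.

(** * Restriction to sets of vanishing probability *)

Section restriction_to_tails.
Context {A : nat -> set T} (mA : forall k, measurable (A k))
  (decA : forall k, A k.+1 `<=` A k) (A0 : P \o A @ \oo --> 0%E).

Lemma Edot_vrestr_cvg0 u y : P.-integrable setT (fun w => (dotp (u w) (y w))%:E) ->
  Edot P y (vrestr (A k) u) @[k --> \oo] --> (0 : R).
Proof.
move=> i; have := tail_integral_cvg0 mA decA A0 i.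
suff e k : (\int[P]_w ((\1_(A k) w)%:E * (dotp (u w) (y w))%:E))%E =
    (Edot P y (vrestr (A k) u))%:E.
  by under eq_fun do rewrite e; move/fine_cvg.
rewrite EdotE; first by apply: eq_integral => w _; rewrite -EFinM dotp_vrestr.
apply: (le_integrable measurableT _ _ i).
  under eq_fun do rewrite dotp_vrestr EFinM; apply: emeasurable_funM.
    by apply/measurable_EFinP; exact: measurable_indic.
  exact: measurable_int i.
move=> w _; rewrite !abse_EFin lee_fin dotp_vrestr normrM ler_piMl//.
by rewrite indicE; case: (_ \in _); rewrite ?normr0 ?normr1.
Qed.

Lemma modular_vrestr_cvg0 u : measurable_vec u -> (E u < +oo)%E ->
  E (vrestr (A k) u) @[k --> \oo] --> 0%E.
Proof.
move=> mu Eu.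
have i : P.-integrable setT (fun w => hull Phi (N (u w)) w).
  apply/integrableP; split; first exact: mE.
  by under eq_integral do rewrite gee0_abs ?hull_ge0//.
have := tail_integral_cvg0 mA decA A0 i.
suff e k : (\int[P]_w ((\1_(A k) w)%:E * hull Phi (N (u w)) w))%E = E (vrestr (A k) u).
  by under eq_fun do rewrite e.
apply: eq_integral => w _; have [Aw|Aw] := pselect (A k w).
  by rewrite vrestr_in// indicE mem_set// mul1e.
by rewrite vrestr_notin// indicE memNset// mul0e (vnorm0 hN) hull0.
Qed.

End restriction_to_tails.

(** By convexity, dividing [u] by [1 + E u] brings the modular down to at most 1. This turns a bound
    by the norm into the affine bound in [E u] that [Efun_conj_le] takes. *)
Lemma modular_lt_luxemburg u : measurable_vec u -> (E u < +oo)%E -> (L u <= 1 + E u)%E.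
Proof.
move=> mu Eu; have := E0 u; move: Eu; case Ee : (E u) => [e| |] // _.
rewrite lee_fin => e0; rewrite -EFinD.
have e1 : 0 < 1 + e by rewrite ltr_wpDr.
apply/LP => //; have t01 : 0 <= (1 + e)^-1 <= 1.
  by rewrite invr_ge0 ltW//= invf_le1// lerDl.
apply: (le_trans (modularZ_le hN Phi_ge0 Phi_convex Phi_sym Phi0 mu t01)).
by rewrite Ee -EFinM lee_fin mulrC ler_pdivrMr// mul1r lerDr.
Qed.

Lemma luxemburg_vrestr_le A u : measurable A -> measurable_vec u ->
  (L (vrestr A u) <= L u)%E.
Proof.
move=> mA mu; have := L0 u; case Er : (L u) => [r| |//] r0; last by rewrite leey.
rewrite lee_fin in r0; apply: luxemburg_le => // c rc.
have c0 : 0 < c by exact: le_lt_trans rc.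
have mr := measurable_vrestr mA mu.
apply/LP => //; have : (L u <= c%:E)%E by rewrite Er lee_fin ltW.
move=> /(LP mu c0); apply: le_trans; apply: leE; try exact: measurable_vecZ.
apply: aeW => w; rewrite (vnormZ hN _ (u w)) (vnormZ hN _ (vrestr A u w)) ler_wpM2l//.
exact: (vnorm_vrestr_le hN).
Qed.
Lemma cvge_near_lt (f : nat -> \bar R) (a b : \bar R) : f k @[k --> \oo] --> a -> (a < b)%E ->
  \forall k \near \oo, (f k < b)%E.
Proof.
move=> fa ab; apply: (fa [set x | (x < b)%E]); apply: open_nbhs_nbhs.
by split => //; exact: open_ereal_lt_ereal.
Qed.

Lemma Edot_vrestrDC u y A : Linfty P u -> L1 P y -> measurable A ->
  Edot P y u = Edot P y (vrestr A u) + Edot P y (vrestr (~` A) u).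
Proof.
move=> Lu Ly mA; have [el _] := Edot_Linfty Ly.
rewrite -(linear_onD el) ?vrestrDC//; first exact: (Linfty_vrestr hN).
by apply: (Linfty_vrestr hN) => //; exact: measurableC.
Qed.

Lemma Edot_delta y A j : L1 P y -> measurable A ->
  (Edot P y (vrestr A (fun=> delta_mx 0 j)))%:E = (\int[P]_(w in A) (y w 0 j)%:E)%E.
Proof.
move=> Ly mA; rewrite EdotE; last first.
  apply: (Linfty_integrable_dotp hN) => //.
  exact: (Linfty_vrestr hN mA (Linfty_cst P hN _)).
rewrite [RHS]integral_mkcond; apply: eq_integral => w _.
rewrite dotp_vrestr -[delta_mx 0 j]scale1r dotp_delta mul1r patchE indicE.
by case: (_ \in _); rewrite ?mul1r ?mul0r.
Qed.

Lemma mint_bdd_delta m A j : M1 P m -> measurable A ->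
  mint_bdd P N m (vrestr A (fun=> delta_mx 0 j)) = m A 0 j.
Proof.
move=> hm mA; have [_ _ ->//] := mint_bdd_spec hm hN.
by rewrite -[delta_mx 0 j]scale1r dotp_delta mul1r.
Qed.

(** * Functionals on L^infty that are bounded for the Luxemburg norm *)

Section representation_of_bounded_functionals.
Context {l : (T -> 'rV[R]_n) -> R} (ll : linear_on (Linfty P) l) {K : R} (K0 : 0 < K)
  (lK : forall u, Linfty P u -> (`|l u|%:E <= K%:E * L u)%E).

Let m0 (A : set T) : 'rV[R]_n :=
  if `[< measurable A >] then \row_j l (vrestr A (fun=> delta_mx 0 j)) else 0.

Let m0E A j : measurable A -> m0 A 0 j = l (vrestr A (fun=> delta_mx 0 j)).
Proof. by move=> mA; rewrite /m0 asboolT// mxE. Qed.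

Let LA A (x : 'rV[R]_n) : measurable A -> Linfty P (vrestr A (fun=> x)).
Proof. by move=> mA; exact: (Linfty_vrestr hN mA (Linfty_cst P hN x)). Qed.

Let M1_m0 : M1 P m0.
Proof.
apply/M1P; split.
- by move=> A nA; rewrite /m0 asboolF.
- move=> A B mA mB AB; apply/rowP => j; rewrite mxE !m0E//; last exact: measurableU.
  rewrite -(linear_onD ll)//; try exact: LA; congr l; apply/funext => w.
  rewrite !fctE; have [Aw|Aw] := pselect (A w).
    rewrite vrestr_in; last by left.
    rewrite vrestr_in// vrestr_notin ?addr0// => Bw.
    by have : (A `&` B) w by []; rewrite AB.
  rewrite [X in _ = X + _]vrestr_notin// add0r.
  have [Bw|Bw] := pselect (B w); first by rewrite !vrestr_in//; right.
  by rewrite !vrestr_notin// => -[].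
- have [C C0 hC] := luxemburg_le_Linfty_norm hN Phi_ge0 Phi_convex Phi_sym Phi0 Phi_L1.
  have [C' C'0 hC'] := vnorm_le_coord hN.
  exists (K * (C * C')) => A j mA; rewrite m0E// -lee_fin.
  apply: (le_trans (lK (LA _ mA))); rewrite EFinM.
  apply: lee_wpmul2l; first by rewrite lee_fin ltW.
  apply: (le_trans (hC _ (LA _ mA))); rewrite EFinM.
  apply: lee_wpmul2l; first by rewrite lee_fin.
  apply/(Linfty_norm_leP P hN); first exact: ltW.
  apply: aeW => w; apply: (le_trans (vnorm_vrestr_le hN _ _ _)).
  rewrite -[C']mulr1; apply: hC' => // i; rewrite mxE.
  by case: (_ && _); rewrite ?normr0 ?normr1.
- move=> A mA A0; apply/rowP => j; rewrite [RHS]mxE m0E//.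
  apply/eqP; rewrite -normr_le0 -lee_fin; apply: (le_trans (lK (LA _ mA))).
  suff -> : L (vrestr A (fun=> delta_mx 0 j)) = 0%E by rewrite mule0.
  apply/(luxemburg_eq0 hN Phi_ge0 Phi_convex Phi_sym Phi0 Phi_L1); first exact/ILP/LA.
  exists A; split => // w /= h; apply: contrapT => nA; apply: h.
  by rewrite vrestr_notin.
Qed.

Lemma Linfty_representation : exists y m, [/\ orlicz_conj P N Phi y, Ms P N Phi m
  & forall u, Linfty P u -> l u = ypair P N y m u].
Proof.
have [m ms [y Ly my]] := yosida_hewitt hN M1_m0.
have [hm [B [mB decB PB mB0]]] := (M1sP hN m).1 ms.
have [el [Ke Ke0 eb]] := Edot_Linfty Ly.
have [ml [Km Km0 mb] _] := mint_bdd_spec hm hN.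
have [_ _ mm] := mint_spec hN hm.
(* Both sides are bounded for the essential supremum norm and agree on indicators times basis
   vectors, by the choice of [m] and [y]. *)
have lE u : Linfty P u -> l u = Edot P y u + mint_bdd P N m u.
  move=> Lu; apply/eqP; rewrite -subr_eq0; apply/eqP; move: u Lu.
  apply: (Linfty_linear_eq0 hN).
  - move=> c u v Lu Lv; rewrite ll// el// ml//; ring.
  - have [C C0 hC] := luxemburg_le_Linfty_norm hN Phi_ge0 Phi_convex Phi_sym Phi0 Phi_L1.
    exists (K * C + (Ke + Km)); first by rewrite addr_ge0 ?addr_ge0// mulr_ge0// ltW.
    move=> u Lu; have := hC _ Lu; have := eb _ Lu; have := mb _ Lu; have := lK Lu.
    have := ILP Lu; move=> /(seminorm_fineK sL) <-; have [M M0 ->] := Linfty_norm_fin hN Lu.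
    rewrite -!EFinM !lee_fin => h1 h2 h3 h4.
    apply: (le_trans (ler_normB _ _)); rewrite mulrDl mulrDl; apply: lerD.
      by apply: (le_trans h1); rewrite -mulrA ler_pM2l.
    by apply: (le_trans (ler_normD _ _)); exact: lerD.
  - move=> A x mA; rewrite (@linear_vrestr_cst (fun u => l u - (Edot P y u + mint_bdd P N m u)))//.
      rewrite big1// => j _; rewrite mint_bdd_delta// -m0E//.
      suff -> : Edot P y (vrestr A (fun=> delta_mx 0 j)) = m0 A 0 j - m A 0 j.
        by rewrite subrK subrr mulr0.
      by apply: EFin_inj; rewrite Edot_delta// -my.
    by move=> c u v Lu Lv; rewrite ll// el// ml//; ring.
(* Off [B k] the singular part vanishes, so the pairing with [y] is [l] itself; the pairing over
   [B k] tends to 0. *)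
have eK u : Linfty P u -> Edot P y u <= K * fine (L u).
  move=> Lu; have cv := Edot_vrestr_cvg0 mB decB PB (Linfty_integrable_dotp hN Lu Ly).
  suff h k : Edot P y u - K * fine (L u) <= Edot P y (vrestr (B k) u).
    rewrite -subr_le0 -(cvg_lim (@Rhausdorff R) cv).
    by apply: limr_ge; [apply/cvg_ex; exists 0|exact: nearW].
  have mBC : measurable (~` B k) by exact: measurableC.
  have LB := Linfty_vrestr hN mBC Lu.
  rewrite (Edot_vrestrDC Lu Ly (mB k)).
  suff : Edot P y (vrestr (~` B k) u) <= K * fine (L u) by lra.
  have := lE _ LB; rewrite mint_bdd_vrestr0// => [|A mA AB]; last first.
    by apply: (mB0 k) => //; apply/disjoints_subset.
  rewrite addr0 => <-; apply: (le_trans (ler_norm _)); rewrite -lee_fin.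
  apply: (le_trans (lK LB)); rewrite EFinM (seminorm_fineK sL (ILP Lu)).
  apply: lee_wpmul2l; first by rewrite lee_fin ltW.
  by apply: luxemburg_vrestr_le => //; exact: mI.
exists y, m; split; last by move=> u Lu; rewrite lE// /ypair mm.
  (* The bound [K * L u <= K + K * E u] calls for [Efun_conj_le] with [b = c = K], which gives
     exactly the bound 1. *)
  apply: (Efun_conj_orlicz Ly K0); rewrite -(divff (lt0r_neq0 K0)).
  apply: Efun_conj_le => // u Lu Eu; apply: (@le_trans _ _ (K%:E * (1 + E u))%E).
    apply: (@le_trans _ _ (K%:E * L u)%E).
      by rewrite -(seminorm_fineK sL (ILP Lu)) -EFinM lee_fin; exact: eK.
    apply: lee_wpmul2l; first by rewrite lee_fin ltW.
    by apply: modular_lt_luxemburg => //; exact: mI.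
  rewrite -[E u]fineK ?ge0_fin_numE//.
  by rewrite -EFinD -!EFinM -EFinD lee_fin mulrDr mulr1.
(* Restricted to a late tail, any [u] of finite modular has modular below 1, so [l] is at most [K]
   there, while the integral against [m] is unchanged and the pairing with [y] is negligible. Hence
   [sigma] is at most [K]. *)
split=> //; apply: (@le_lt_trans _ _ K%:E); last exact: ltry.
apply: ge_ereal_sup => _ [u [Lu Eu] <-]; rewrite lee_fin mm//.
have {}Eu : (E u < +oo)%E.
  by apply: le_lt_trans Eu; exact: modular_le_Efun.
have ce := Edot_vrestr_cvg0 mB decB PB (Linfty_integrable_dotp hN Lu Ly).
have cm := modular_vrestr_cvg0 mB decB PB (mI Lu) Eu.
apply/ler_addgt0Pr => e e0.
have h1 : \forall k \near \oo, `|0 - Edot P y (vrestr (B k) u)| < e.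
  by move/cvgrPdist_lt: ce => /(_ e e0).
have h2 : \forall k \near \oo, (E (vrestr (B k) u) < 1)%E.
  by apply: (cvge_near_lt cm); rewrite lte01.
have [k [h1k h2k]] := @filter_ex _ \oo _ _ (filterI h1 h2).
have LB := Linfty_vrestr hN (mB k) Lu.
rewrite -(mint_bdd_vrestr hm (mB k) _ Lu); last by move=> A mA; exact: mB0.
have := lE _ LB; have : l (vrestr (B k) u) <= K.
  apply: (le_trans (ler_norm _)); rewrite -lee_fin; apply: (le_trans (lK LB)).
  rewrite -[leRHS]mule1; apply: lee_wpmul2l; first by rewrite lee_fin ltW.
  apply/LP => //; first exact: mI.
  by rewrite invr1 scale1r ltW.
move: h1k; rewrite sub0r normrN ltr_norml => /andP[]; lra.
Qed.

End representation_of_bounded_functionals.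

(** Off the unions [C k] of the two sequences of tails both singular parts vanish, so the pairings
    with [y] and [y'] agree there, and in the limit everywhere. The singular parts then agree by
    subtraction. *)
Lemma ypair_unique y m y' m' : L1 P y -> L1 P y' -> M1s P N m -> M1s P N m' ->
  (forall u, Linfty P u -> ypair P N y m u = ypair P N y' m' u) ->
  ae_eq_vec P y' y /\ m' = m.
Proof.
move=> Ly Ly' /(M1sP hN)[hm [B [mB decB PB mB0]]] /(M1sP hN)[hm' [B' [mB' decB' PB' mB0']]] yy.
have [_ _ mm] := mint_spec hN hm; have [_ _ mm'] := mint_spec hN hm'.
have {}yy u : Linfty P u ->
    Edot P y u + mint_bdd P N m u = Edot P y' u + mint_bdd P N m' u.
  by move=> Lu; rewrite -mm// -mm'//; exact: yy.
have LA A j : measurable A -> Linfty P (vrestr A (fun=> delta_mx 0 j : 'rV[R]_n)).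
  by move=> mA; exact: (Linfty_vrestr hN mA (Linfty_cst P hN _)).
pose C k := B k `|` B' k.
have mC k : measurable (C k) by exact: measurableU.
have decC k : C k.+1 `<=` C k by move=> w [/decB|/decB']; [left|right].
have PC : P \o C @ \oo --> 0%E.
  apply: (@squeeze_cvge _ _ _ _ (cst 0%E) _ (fun k => P (B k) + P (B' k))%E).
  - apply: nearW => k /=; rewrite measure_ge0/=; exact: measureU2.
  - exact: cvg_cst.
  - by rewrite -[0%E]adde0; apply: cvgeD.
have Eyy u : Linfty P u -> Edot P y u = Edot P y' u.
  move=> Lu; apply/eqP; rewrite -subr_eq0; apply/eqP.
  have c1 := Edot_vrestr_cvg0 mC decC PC (Linfty_integrable_dotp hN Lu Ly).
  have c2 := Edot_vrestr_cvg0 mC decC PC (Linfty_integrable_dotp hN Lu Ly').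
  have c3 := cvgB c1 c2; rewrite subr0 in c3.
  suff e k : Edot P y (vrestr (C k) u) - Edot P y' (vrestr (C k) u) = Edot P y u - Edot P y' u.
    have cc : Edot P y (vrestr (C k) u) - Edot P y' (vrestr (C k) u) @[k --> \oo] -->
        Edot P y u - Edot P y' u.
      by under eq_fun do rewrite e; exact: cvg_cst.
    by apply: (cvg_unique (@Rhausdorff R) cc); exact: c3.
  rewrite (Edot_vrestrDC Lu Ly (mC k)) (Edot_vrestrDC Lu Ly' (mC k)).
  have mCC : measurable (~` C k) by exact: measurableC.
  have := yy _ (Linfty_vrestr hN mCC Lu); rewrite !mint_bdd_vrestr0//.
  - rewrite !addr0 => ->; ring.
  - move=> A mA AC; apply: (mB0' k) => //; apply/disjoints_subset => w /AC h Bw.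
    by apply: h; right.
  - move=> A mA AC; apply: (mB0 k) => //; apply/disjoints_subset => w /AC h Bw.
    by apply: h; left.
split; last first.
  apply/funext => A; have [mA|mA] := pselect (measurable A); last first.
    by have /M1P[-> //] := hm; have /M1P[-> //] := hm'.
  apply/rowP => j; rewrite -!mint_bdd_delta//.
  by have := yy _ (LA A j mA); rewrite (Eyy _ (LA A j mA)) => /addrI.
have /L1P iy := Ly; have /L1P iy' := Ly'.
have h j : {ae P, forall w, y' w 0 j = y w 0 j}.
  have : ae_eq P setT (fun w => (y' w 0 j)%:E) (fun w => (y w 0 j)%:E).
    apply: integral_ae_eq => //; first exact: measurable_int (iy j).
    by move=> A _ mA; rewrite -!Edot_delta// (Eyy _ (LA A j mA)).
  by apply: filterS => w /(_ I)[].
by apply: filterS (ae_forall_ord h) => w hw; apply/rowP.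
Qed.
Lemma orlicz_vrestr A u : measurable A -> LPhi u -> LPhi (vrestr A u).
Proof.
move=> mA Lu; have mu := orlicz_measurable Lu.
apply/(orliczP hN Phi_ge0 Phi_convex Phi_sym Phi0 Phi_L1); split.
  exact: measurable_vrestr.
by apply: (le_lt_trans (luxemburg_vrestr_le mA mu)); case: Lu.
Qed.

Lemma rho_vrestr_le m A u : M1 P m -> (rho P N m (vrestr A u) <= rho P N m u)%E.
Proof.
move=> hm; apply: rho_le => v Lv vu; apply: le_rho => //.
apply: filterS vu => w h j; apply: (le_trans (h j)).
by rewrite mxE normrM ler_piMl// indicE; case: (_ \in _); rewrite ?normr0 ?normr1.
Qed.

(** Cut at the height [k] of [N u]. Below it [u] is bounded and contributes at most [s]. Above it,
    on [D], a bounded [v] close to [u] in [rho] replaces [u]: the multiple [k / (M + 1)] of [v] is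
    still dominated by [u] on [D], so its integral is at most [s] and that of [v] is small. The
    error is bounded by [rho (u - v)]. *)
Lemma mint_le_sigma m u : Ms P N Phi m -> LPhi u -> (E u < +oo)%E ->
  ((mint P N m u)%:E <= sigma P N Phi m)%E.
Proof.
move=> hMs Lu Eu; have [[hm _] soo] := hMs.
have [ml mr mb] := mint_spec hN hm; have [mL _] := mint_orlicz hMs.
have mu := orlicz_measurable Lu.
have := sigma_ge0 hm; move: soo; case Es : (sigma _ _ _ _) => [s| |] // _.
rewrite !lee_fin => s0; apply/ler_addgt0Pr => e e0.
have e20 : 0 < e / 2 by rewrite divr_gt0.
have [v Lv uv] := Linfty_rho_dense hN hm (orlicz_dom_rho hMs Lu) e20.
have [M M0 hM] := Linfty_norm_fin hN Lv; have mv := mI Lv.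
have M1 : 0 < M + 1 by rewrite ltr_wpDl.
(* Chosen so that [s * (M + 1) / k] is at most [e / 2]. *)
pose k := 2 * (s + 1) * (M + 1) / e; have k0 : 0 < k.
  by rewrite /k divr_gt0// !mulr_gt0// ltr_wpDl.
pose D := [set w | k < N (u w)].
have mD : measurable D.
  rewrite -[D]setTI (_ : D = (N \o u) @^-1` `]k, +oo[).
    by apply: (measurable_vnorm hN mu).
  by apply/seteqP; split => w /=; rewrite in_itv/= andbT.
have mDC : measurable (~` D) by exact: measurableC.
have LDu : Linfty P (vrestr (~` D) u).
  apply/(LinftyP P hN); split; first exact: measurable_vrestr.
  exists k; apply: aeW => w; have [Dw|Dw] := pselect ((~` D) w).
    by rewrite vrestr_in// leNgt; apply/negP.
  by rewrite vrestr_notin// (vnorm0 hN) ltW.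
have h1 : mint P N m (vrestr (~` D) u) <= s.
  rewrite -lee_fin -Es; apply: mint_le_sigma_Linfty => //.
  apply: le_lt_trans Eu; apply: leE => //; first exact: measurable_vrestr.
  by apply: aeW => w; exact: (vnorm_vrestr_le hN).
have LDv := Linfty_vrestr hN mD Lv.
have h2 : mint P N m (vrestr D v) <= e / 2.
  have kM : 0 < k / (M + 1) by exact: divr_gt0.
  have Lt : Linfty P ((k / (M + 1)) *: vrestr D v) by exact: (LinftyZ hN).
  have : ((mint P N m ((k / (M + 1)) *: vrestr D v))%:E <= s%:E)%E.
    rewrite -Es; apply: mint_le_sigma_Linfty => //.
    apply: le_lt_trans Eu; apply: leE => //; first exact: mI.
    apply: filterS (Linfty_norm_ae hN hM) => w hw.
    rewrite (vnormZ hN _ (vrestr D v w)) gtr0_norm//.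
    have [Dw|Dw] := pselect (D w); last first.
      by rewrite vrestr_notin// (vnorm0 hN) mulr0 (vnorm_ge0 hN).
    rewrite vrestr_in//; apply: (le_trans _ (ltW Dw)).
    rewrite -mulrA ler_piMr ?(ltW k0)// mulrC ler_pdivrMr// mul1r.
    by apply: (le_trans hw); rewrite lerDl.
  rewrite lee_fin (linear_onZ mL)//; [|exact: (seminorm_on0 sL)|exact: ILP].
  rewrite mulrC -ler_pdivlMr// => /le_trans; apply.
  have -> : s / (k / (M + 1)) = s * (e / 2) / (s + 1).
    by rewrite /k; field; rewrite !gt_eqF// ltr_wpDl.
  rewrite ler_pdivrMr ?ltr_wpDl// mulrC ler_pM2l//.
  by rewrite lerDl.
have Luv : LPhi (u - v) by apply: (linB (seminorm_onZD sL)) => //; exact: ILP.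
have h3 : mint P N m (vrestr D (u - v)) <= e / 2.
  apply: (le_trans (ler_norm _)); rewrite -lee_fin.
  apply: (le_trans (mr _ (orlicz_dom_rho hMs (orlicz_vrestr mD Luv)))).
  by apply: (le_trans (rho_vrestr_le _ _ hm)); exact: ltW.
have : mint P N m u = mint P N m (vrestr (~` D) u) +
    (mint P N m (vrestr D v) + mint P N m (vrestr D (u - v))).
  rewrite -(linear_onD mL); [|exact: ILP|exact: orlicz_vrestr].
  have vD : vrestr D v + vrestr D (u - v) = vrestr D u.
    by have := vrestrZD D 1 v (u - v); rewrite !scale1r => <-; rewrite addrC subrK.
  rewrite vD -(linear_onD mL); [|exact: ILP|exact: orlicz_vrestr].
  by rewrite addrC vrestrDC.
lra.
Qed.

(* beta is the Lagrange multiplier of the constraint E u <= 1. *)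
Lemma inf_conj_le y (s : R) : L1 P y ->
  (forall u, Linfty P u -> (E u <= 1)%E -> Edot P y u <= s) ->
  (ereal_inf [set b%:E * Ec y b + b%:E | b in [set b : R | (0 < b)%R]] <= s%:E)%E.
Proof.
move=> Ly hs; have [el _] := Edot_Linfty Ly; have I0 := Linfty0 P hN.
have E00 : E 0 = 0%E by exact: modular0.
have el0 : Edot P y 0 = 0 by exact: (linear_on0 el I0).
(* Each [u] with [E u < 1] bounds the multiplier from above by its element of [Q]. The infimum [b]
   satisfies all these bounds, and convexity shows that it is also large enough for the [u] with
   [E u > 1]. *)
pose Q := [set (s - Edot P y u) / (1 - fine (E u)) | u in
  [set u | Linfty P u /\ (E u < 1)%E]].
have finE u : (E u < 1)%E -> exists2 e : R, E u = e%:E & 0 <= e < 1.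
  have := E0 u; case: (E u) => [e| |] //; rewrite lee_fin lte_fin => h1 h2.
  by exists e => //; rewrite h1.
have Q0 : Q !=set0.
  by exists ((s - Edot P y 0) / (1 - fine (E 0))), 0 => //; split; rewrite ?E00 ?lte01.
have Qlb : has_lbound Q.
  exists 0 => _ [u [Lu Eu1] <-]; have [e Ee /andP[e0 e1]] := finE _ Eu1.
  by rewrite Ee divr_ge0 ?subr_ge0 ?(ltW e1)// hs// ltW.
pose b := inf Q.
have b0 : 0 <= b.
  apply: lb_le_inf => // _ [u [Lu Eu1] <-]; have [e Ee /andP[e0 e1]] := finE _ Eu1.
  by rewrite Ee divr_ge0 ?subr_ge0 ?(ltW e1)// hs// ltW.
have hb u : Linfty P u -> (E u < +oo)%E -> Edot P y u <= s + b * (fine (E u) - 1).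
  move=> Lu; have := E0 u; case Ee : (E u) => [e| |] //; rewrite lee_fin /= => e0 _.
  have [e1|e1|e1] := ltgtP e 1.
  - have : b <= (s - Edot P y u) / (1 - e).
      by apply: ge_inf => //; exists u; rewrite /= ?Ee//.
    by rewrite ler_pdivlMr ?subr_gt0// mulrBr mulrBr; lra.
  - have : (Edot P y u - s) / (e - 1) <= b.
      apply: lb_le_inf => // _ [v [Lv Ev1] <-]; have [e' Ee' /andP[e'0 e'1]] := finE _ Ev1.
      (* The weight at which the convexity bound for the modular of [t *: u + (1 - t) *: v] equals
         1, so that [hs] applies to this combination. *)
      rewrite Ee' /=; pose t := (1 - e') / (e - e').
      have ee' : 0 < e - e' by lra.
      have t01 : 0 <= t <= 1.
        apply/andP; split; first by rewrite divr_ge0//; lra.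
        by rewrite ler_pdivrMr// mul1r; lra.
      have := modular_convex hN Phi_ge0 Phi_convex Phi_sym Phi0 (P := P) (mI Lu) (mI Lv) t01.
      rewrite Ee Ee' -!EFinM -EFinD.
      have -> : t * e + (1 - t) * e' = 1 by rewrite /t; field; rewrite gt_eqF.
      move=> /hs; rewrite el ?(linear_onZ el)//; last exact: (LinftyZ hN).
      move=> /(_ (LinftyD hN (LinftyZ hN _ Lu) (LinftyZ hN _ Lv))).
      have tE : t * (e - e') = 1 - e' by rewrite /t divfK// gt_eqF.
      move: (Edot P y u) (Edot P y v) => x z /(ler_wpM2r (ltW ee')).
      have -> : (t * x + (1 - t) * z) * (e - e') =
        (t * (e - e')) * x + ((e - e') - (t * (e - e'))) * z by ring.
      rewrite tE => h; rewrite ler_pdivrMr ?subr_gt0// [leRHS]mulrAC.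
      by rewrite ler_pdivlMr ?subr_gt0//; lra.
    rewrite ler_pdivrMr ?subr_gt0//; lra.
  - by rewrite e1 subrr mulr0 addr0; apply: hs => //; rewrite Ee e1.
(* The multiplier [b] may be 0, whereas the conjugate integral needs a positive parameter; hence
   [b + e]. *)
apply/lee_addgt0Pr => e e0; have be : 0 < b + e by rewrite ltr_wpDl.
apply: (@le_trans _ _ ((b + e)%:E * Ec y (b + e)%R + (b + e)%:E)%E).
  by apply: ereal_inf_lbound; exists (b + e).
have : (Ec y (b + e) <= ((s - b) / (b + e))%:E)%E.
  apply: Efun_conj_le => // u Lu Eu; have := hb u Lu Eu; have := E0 u; move: Eu.
  case: (E u) => [q| |] // _; rewrite lee_fin => q0 /= h.
  by rewrite -EFinM -EFinD lee_fin; nra.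
have be0 : (0 <= (b + e)%:E)%E by rewrite lee_fin ltW.
move=> /(lee_wpmul2l be0) h; apply: (@le_trans _ _ ((s - b)%:E + (b + e)%:E)%E).
  rewrite leeD2r//; apply: (le_trans h).
  by rewrite -EFinM lee_fin mulrC divfK// gt_eqF.
by rewrite -!EFinD lee_fin; lra.
Qed.
Lemma luxemburg_le1P u : measurable_vec u -> (L u <= 1)%E <-> (E u <= 1)%E.
Proof. by move=> mu; rewrite (LP mu ltr01) invr1 scale1r. Qed.

Lemma ypair_Linfty_linear y m : L1 P y -> M1 P m -> linear_on (Linfty P) (ypair P N y m).
Proof.
move=> Ly hm c u v Lu Lv; have [el _] := Edot_Linfty Ly; have [ml _ _] := mint_spec hN hm.
rewrite /ypair el// ml; [ring|exact: (Linfty_dom_rho hN hm)..].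
Qed.

(* u and v are glued along the tails carrying the singular measure. *)
Lemma ypair_split_le y m (s : R) u v : L1 P y -> M1s P N m ->
  (forall w, Linfty P w -> (Efun P Phi (N \o w) <= 1)%E -> ypair P N y m w <= s) ->
  Linfty P u -> (E u <= 1)%E -> Linfty P v -> (E v < +oo)%E ->
  Edot P y u + mint P N m v <= s.
Proof.
move=> Ly /(M1sP hN)[hm [B [mB decB PB mB0]]] hs Lu Eu Lv Ev.
have yl := ypair_Linfty_linear Ly hm; have I0 := Linfty0 P hN.
have [el _] := Edot_Linfty Ly; have [_ _ mm] := mint_spec hN hm.
have [ml _ _] := mint_bdd_spec hm hN.
have s0 : 0 <= s.
  rewrite -(linear_on0 yl I0); apply: hs => //.
  rewrite /Efun; under eq_integral => w _ do rewrite /= (vnorm0 hN) Phi0.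
  by rewrite integral0 lee01.
have {}hs w : Linfty P w -> (E w <= 1)%E -> ypair P N y m w <= s.
  move=> Lw Ew; apply: ler_of_scale => // t t01.
  rewrite -(linear_onZ yl I0)//; apply: hs; first exact: (LinftyZ hN).
  apply: le_trans Ew.
  exact: (Efun_scale_le_modular hN Phi_ge0 Phi_convex Phi_sym Phi0).
(* On a late tail the glued vector has modular at most [1 + (1 - t)], and multiplication by [t]
   makes it admissible because [t * (2 - t) <= 1]. *)
apply: ler_of_scale => // t /andP[t0 t1]; apply/ler_addgt0Pr => e e0.
have e20 : 0 < e / 2 by rewrite divr_gt0.
have h1 : \forall k \near \oo, `|0 - Edot P y (vrestr (B k) u)| < e / 2.
  have /cvgrPdist_lt := Edot_vrestr_cvg0 mB decB PB (Linfty_integrable_dotp hN Lu Ly).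
  exact.
have h2 : \forall k \near \oo, `|0 - Edot P y (vrestr (B k) v)| < e / 2.
  have /cvgrPdist_lt := Edot_vrestr_cvg0 mB decB PB (Linfty_integrable_dotp hN Lv Ly).
  exact.
have h3 : \forall k \near \oo, (E (vrestr (B k) v) < (1 - t)%:E)%E.
  apply: (cvge_near_lt (modular_vrestr_cvg0 mB decB PB (mI Lv) Ev)).
  by rewrite lte_fin subr_gt0.
have [k [h1k [h2k h3k]]] := @filter_ex _ \oo _ _ (filterI h1 (filterI h2 h3)).
have mBC : measurable (~` B k) by exact: measurableC.
have LBu := Linfty_vrestr hN mBC Lu; have LBv := Linfty_vrestr hN (mB k) Lv.
pose w := vrestr (~` B k) u + vrestr (B k) v.
have Lw : Linfty P w by exact: (LinftyD hN).
have Ew : (E w <= 1 + (1 - t)%:E)%E.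
  apply: (@le_trans _ _ (E u + E (vrestr (B k) v))%E); last first.
    by apply: leeD => //; exact: ltW.
  rewrite /modular -ge0_integralD//; try by [move=> *; exact: hull_ge0|exact: mE (mI _)].
  apply: ge0_le_integral => //; try by [move=> *; exact: hull_ge0|exact: mE (mI _)].
  - by apply: emeasurable_funD; exact: mE (mI _).
  move=> x _; rewrite /w !fctE; have [Bx|Bx] := pselect (B k x).
    by rewrite vrestr_notin ?add0r; [rewrite leeDr// hull_ge0|exact].
  by rewrite vrestr_in// vrestr_notin// addr0 leeDl// hull_ge0.
have t01 : 0 <= t <= 1 by rewrite t0 ltW.
have := hs _ (LinftyZ hN t Lw) _; rewrite (linear_onZ yl I0)//.
have -> : ypair P N y m w =
    Edot P y u - Edot P y (vrestr (B k) u) + Edot P y (vrestr (B k) v) + mint P N m v.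
  rewrite /ypair (linear_onD el)// !mm// (linear_onD ml)//.
  rewrite mint_bdd_vrestr0// => [|A mA AB]; last first.
    by apply: (mB0 k) => //; apply/disjoints_subset.
  rewrite mint_bdd_vrestr//; last by move=> A mA; exact: mB0.
  by rewrite (Edot_vrestrDC Lu Ly (mB k)); ring.
have -> : (E (t *: w)%R <= 1)%E.
  apply: (le_trans (modularZ_le hN Phi_ge0 Phi_convex Phi_sym Phi0 (mI Lw) t01)).
  apply: (@le_trans _ _ (t%:E * (1 + (1 - t)%:E))%E); first by apply: lee_wpmul2l.
  by rewrite -EFinD -EFinM lee_fin; nra.
move=> /(_ isT); move: h1k h2k; rewrite !sub0r !normrN !ltr_norml.
move: (Edot P y u) (mint P N m v) (Edot P y (vrestr (B k) u)) (Edot P y (vrestr (B k) v)).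
move=> a b c q /andP[c1 c2] /andP[q1 q2] h; nra.
Qed.

(** A cycle [S <= D <= I + sigma <= S]. The second inequality is Young's together with
    [mint_le_sigma]; for the third, [ypair_split_le] lets the two terms be maximized separately, so
    that [inf_conj_le] applies with [S - sigma] in place of [s]. *)
Lemma dual_normE y m : orlicz_conj P N Phi y -> Ms P N Phi m ->
  dual_norm LPhi L (ypair P N y m) = ereal_sup [set (ypair P N y m u)%:E | u in
    [set u | Linfty P u /\ (Efun P Phi (N \o u) <= 1)%E]] /\
  dual_norm LPhi L (ypair P N y m) =
    (ereal_inf [set b%:E * Ec y b + b%:E | b in [set b : R | (0 < b)%R]] +
     sigma P N Phi m)%E.
Proof.
move=> Lsy hMs; have [[hm _] soo] := hMs; have [Ly _] := orlicz_conjP Lsy.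
set D := dual_norm _ _ _; set S := ereal_sup _; set I := ereal_inf _.
have SD : (S <= D)%E.
  apply: ge_ereal_sup => _ [u [Lu Eu] <-]; apply: ereal_sup_ubound; exists u => //.
  split; first exact: ILP.
  apply/luxemburg_le1P; first exact: mI.
  by apply: le_trans Eu; exact: modular_le_Efun.
have DI : (D <= I + sigma P N Phi m)%E.
  apply: ge_ereal_sup => _ [u [Lu Lu1] <-]; have mu := orlicz_measurable Lu.
  have Eu : (E u <= 1)%E by apply/luxemburg_le1P.
  have Euoo : (E u < +oo)%E by exact: le_lt_trans Eu (ltry 1).
  rewrite /ypair EFinD; apply: leeD; last exact: mint_le_sigma.
  apply: le_ereal_inf_tmp => _ [b /= b0 <-].
  have := Efun_conj_ge0 (P := P) (N := N) Phi0 y b; case Eb : (Ec y b) => [c| |] // c0; last first.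
    by rewrite gt0_muley ?lte_fin// leey.
  have Eboo : (Ec y b < +oo)%E by rewrite Eb ltry.
  apply: (le_trans (Edot_young hN Phi_ge0 Phi_convex Phi_sym Phi0 mu (L1_measurable Ly) b0 Euoo Eboo)).
  move: Eu (E0 u); rewrite Eb; case: (E u) => [e| |] //; rewrite !lee_fin => e1 e0.
  nra.
have S0 : (0 <= S)%E.
  apply: ereal_sup_ubound; exists 0.
    split; first exact: (Linfty0 P hN).
    rewrite /Efun; under eq_integral => w _ do rewrite /= (vnorm0 hN) Phi0.
    by rewrite integral0 lee01.
  by rewrite (linear_on0 (ypair_Linfty_linear Ly hm) (Linfty0 P hN)).
have Doo : (D < +oo)%E.
  have [_ [K K0 hK]] := ypair_orlicz Lsy hMs; apply: (@le_lt_trans _ _ K%:E); last exact: ltry.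
  apply: ge_ereal_sup => _ [u [Lu Lu1] <-].
  apply: (@le_trans _ _ (`|ypair P N y m u|%:E)); first by rewrite lee_fin ler_norm.
  apply: (le_trans (hK _ Lu)); rewrite -[leRHS]mule1; apply: lee_wpmul2l => //.
have IS : (I + sigma P N Phi m <= S)%E.
  have := le_lt_trans SD Doo; have := sigma_ge0 hm; move: S0 soo.
  case ES : S => [s| |] //; case Es : (sigma _ _ _ _) => [q| |] // _ _ _ _.
  rewrite -leeBrDr// -EFinB; apply: inf_conj_le => // u Lu Eu.
  rewrite lerBrDl -lerBrDr -lee_fin -Es; apply: ge_ereal_sup => _ [v [Lv Ev] <-].
  rewrite lee_fin lerBrDr addrC; apply: (ypair_split_le Ly hMs.1) => //.
    by move=> w Lw Ew; rewrite -lee_fin -ES; apply: ereal_sup_ubound; exists w.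
  by apply: le_lt_trans Ev; exact: modular_le_Efun.
split; apply/le_anti; first by rewrite SD (le_trans DI).
by rewrite DI (le_trans IS).
Qed.

(** The upper bound is the factor 2 of [Edot_orlicz_le]. For the lower one, dividing [u] by
    [1 + E u] gives a pairing of at most [D * (1 + E u)], and [Efun_conj_le] applies with
    [b = c = D + e], where [e] covers the case [D = 0]. *)
Lemma luxemburg_conj_bounds y : orlicz_conj P N Phi y ->
  (luxemburg_conj P N Phi y <= dual_norm LPhi L (Edot P y))%E /\
  (dual_norm LPhi L (Edot P y) <= 2%:E * luxemburg_conj P N Phi y)%E.
Proof.
move=> Lsy; have [Ly _] := orlicz_conjP Lsy; have [el [K K0 eb]] := Edot_orlicz Lsy.
have S0 := seminorm_on0 sL.
split; last first.
  rewrite -lee_pdivrMl//; apply: le_ereal_inf_tmp => _ [b [b0 hb] <-].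
  rewrite lee_pdivrMl//; apply: ge_ereal_sup => _ [u [Lu Lu1] <-].
  apply: (@le_trans _ _ (`|Edot P y u|%:E)); first by rewrite lee_fin ler_norm.
  apply: (le_trans (Edot_orlicz_le Ly b0 hb Lu)); rewrite -EFinM -[leRHS]mule1.
  by apply: lee_wpmul2l => //; rewrite lee_fin mulr_ge0// ltW.
have D0 : (0 <= dual_norm LPhi L (Edot P y))%E.
  apply: ereal_sup_ubound; exists 0; last by rewrite (linear_on0 el S0).
  split => //; rewrite -[leLHS](seminorm_fineK sL S0) (seminorm_fine0 sL).
  exact: lee01.
case ED : (dual_norm _ _ _) D0 => [D| |] // D0; last by rewrite leey.
rewrite lee_fin in D0; apply/lee_addgt0Pr => e e0; rewrite -EFinD.
have De : 0 < D + e by rewrite ltr_wpDl.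
apply: ereal_inf_lbound; exists (D + e) => //; split => //.
rewrite -(divff (lt0r_neq0 De)); apply: Efun_conj_le => // u Lu Eu.
have := modular_lt_luxemburg (mI Lu) Eu; have := E0 u; move: Eu.
case: (E u) => [q| |] // _; rewrite lee_fin -EFinD => q0 hq.
have q1 : 0 < 1 + q by rewrite ltr_wpDr.
have : (((1 + q)^-1 * Edot P y u)%:E <= D%:E)%E.
  rewrite -ED -(linear_onZ el S0); last exact: ILP.
  apply: ereal_sup_ubound; exists ((1 + q)^-1 *: u) => //.
  have Lq := ILP (LinftyZ hN (1 + q)^-1 Lu); split => //.
  apply/luxemburg_le1P; first exact: (orlicz_measurable Lq).
  by apply/LP => //; exact: mI.
rewrite lee_fin mulrC ler_pdivrMr// -EFinM -EFinD lee_fin => h.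
apply: (le_trans h); nra.
Qed.

(** * The dual spaces of L^Phi and of its heart *)

Local Notation MPhi := (orlicz_heart P N Phi).

Let Linfty_heart u : Linfty P u -> MPhi u.
Proof.
move=> Lu; split=> [|e e0]; first exact: ILP.
exists u => //; rewrite subrr -(seminorm_fineK sL (seminorm_on0 sL)) (seminorm_fine0 sL).
by rewrite lte_fin.
Qed.

Let sM : seminorm_on MPhi L.
Proof.
apply: seminorm_on_closure => //; [exact: (Linfty0 P hN)|exact: (LinftyZD hN)].
Qed.

Lemma Edot_ae_eq y y' u : P.-integrable setT (fun w => (dotp (u w) (y w))%:E) ->
  P.-integrable setT (fun w => (dotp (u w) (y' w))%:E) -> ae_eq_vec P y' y ->
  Edot P y' u = Edot P y u.
Proof.
move=> i i' h; apply: EFin_inj; rewrite !EdotE//; apply: ae_eq_integral => //.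
- exact: measurable_int i'.
- exact: measurable_int i.
by apply: filterS h => w /= -> _.
Qed.

Lemma orlicz_dual_mem y m w : orlicz_conj P N Phi y -> Ms P N Phi m ->
  annihilator LPhi L (Linfty P) w -> dual_space LPhi L (fun u => ypair P N y m u + w u).
Proof.
move=> Lsy hMs [[wl wc] _]; have [yl [K K0 yb]] := ypair_orlicz Lsy hMs.
have [K' K'0 wb] := continuous_bounded_on sL wl wc.
have ll : linear_on LPhi (fun u => ypair P N y m u + w u).
  by move=> c u v Lu Lv; rewrite yl// wl//; ring.
split=> //; apply: (bounded_continuous_on sL ll); exists (K + K').
  exact: addr_ge0.
move=> u Lu; have := yb _ Lu; have := wb _ Lu.
rewrite -(seminorm_fineK sL Lu) -!EFinM !lee_fin mulrDl => h1 h2.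
by apply: (le_trans (ler_normD _ _)); lra.
Qed.

(** Only the restriction of [l] to L^infty is represented by [y] and [m]; the annihilator component
    is the remainder, which vanishes on L^infty. *)
Lemma orlicz_dual_representation l : dual_space LPhi L l ->
  exists y m w,
    [/\ orlicz_conj P N Phi y, Ms P N Phi m, annihilator LPhi L (Linfty P) w,
        forall u, LPhi u -> l u = ypair P N y m u + w u
      & forall y' m' w', orlicz_conj P N Phi y' -> Ms P N Phi m' ->
          annihilator LPhi L (Linfty P) w' ->
          (forall u, LPhi u -> l u = ypair P N y' m' u + w' u) ->
          [/\ ae_eq_vec P y' y, m' = m & forall u, LPhi u -> w' u = w u]].
Proof.
move=> [ll lc]; have [K K0 lb] := continuous_bounded_on sL ll lc.
have K1 : 0 < K + 1 by rewrite ltr_wpDl.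
have llI : linear_on (Linfty P) l by move=> c u v Lu Lv; apply: ll; exact: ILP.
have [|y [m [Lsy hMs lE]]] := Linfty_representation llI K1.
  move=> u Lu; apply: (le_trans (lb _ (ILP Lu))); apply: lee_wpmul2r => //.
  by rewrite lee_fin lerDl.
have [yl [K' K'0 yb]] := ypair_orlicz Lsy hMs.
exists y, m, (fun u => l u - ypair P N y m u); split=> //.
- have wl : linear_on LPhi (fun u => l u - ypair P N y m u).
    by move=> c u v Lu Lv; rewrite ll// yl//; ring.
  split; last by move=> u Lu; rewrite lE// subrr.
  split=> //; apply: (bounded_continuous_on sL wl); exists (K + K'); first exact: addr_ge0.
  move=> u Lu; have := lb _ Lu; have := yb _ Lu.
  rewrite -(seminorm_fineK sL Lu) -!EFinM !lee_fin mulrDl => h1 h2.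
  by apply: (le_trans (ler_normB _ _)); lra.
- by move=> u Lu; rewrite addrC subrK.
move=> y' m' w' Lsy' hMs' [_ w'0] lE'.
have [ey em] : ae_eq_vec P y' y /\ m' = m.
  apply: ypair_unique; [by case: Lsy|by case: Lsy'|by case: hMs|by case: hMs'|].
  by move=> u Lu; rewrite -lE// (lE' _ (ILP Lu)) w'0// addr0.
split=> // u Lu; rewrite (lE' _ Lu) em /ypair.
by rewrite (Edot_ae_eq _ _ ey); [ring|exact: orlicz_conj_integrable..].
Qed.

Lemma heart_dual_mem y m : orlicz_conj P N Phi y -> Ms P N Phi m ->
  dual_space MPhi L (ypair P N y m).
Proof.
move=> Lsy hMs; have [yl [K K0 yb]] := ypair_orlicz Lsy hMs.
have ll : linear_on MPhi (ypair P N y m) by move=> c u v [Lu _] [Lv _]; exact: yl.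
by split=> //; apply: (bounded_continuous_on sM ll); exists K => // u [Lu _]; exact: yb.
Qed.

(** L^infty is dense in the heart, so the remainder that vanishes on L^infty is 0. *)
Lemma heart_dual_representation l : dual_space MPhi L l ->
  exists y m,
    [/\ orlicz_conj P N Phi y, Ms P N Phi m,
        forall u, MPhi u -> l u = ypair P N y m u
      & forall y' m', orlicz_conj P N Phi y' -> Ms P N Phi m' ->
          (forall u, MPhi u -> l u = ypair P N y' m' u) ->
          ae_eq_vec P y' y /\ m' = m].
Proof.
move=> [ll lc]; have [K K0 lb] := continuous_bounded_on sM ll lc.
have K1 : 0 < K + 1 by rewrite ltr_wpDl.
have llI : linear_on (Linfty P) l by move=> c u v Lu Lv; apply: ll; exact: Linfty_heart.
have [|y [m [Lsy hMs lE]]] := Linfty_representation llI K1.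
  move=> u Lu; apply: (le_trans (lb _ (Linfty_heart Lu))); apply: lee_wpmul2r => //.
  by rewrite lee_fin lerDl.
have [yl [K' K'0 yb]] := ypair_orlicz Lsy hMs.
exists y, m; split=> //.
- move=> u Mu; apply/eqP; rewrite -subr_eq0; apply/eqP; move: u Mu.
  apply: (dense_linear_on_eq0 sM (A := Linfty P)).
  + exact: Linfty_heart.
  + by move=> u [].
  + by move=> c u v Mu Mv; rewrite ll// yl; [ring|case: Mu|case: Mv].
  + exists (K + K'); first exact: addr_ge0.
    move=> u Mu; have := lb _ Mu; have := yb _ Mu.1.
    rewrite -(seminorm_fineK sM Mu) -!EFinM !lee_fin mulrDl => h1 h2.
    by apply: (le_trans (ler_normB _ _)); lra.
  + by move=> u Lu; rewrite lE// subrr.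
move=> y' m' Lsy' hMs' lE'.
apply: ypair_unique; [by case: Lsy|by case: Lsy'|by case: hMs|by case: hMs'|].
by move=> u Lu; rewrite -lE// lE'//; exact: Linfty_heart.
Qed.

Lemma Ms0 : Ms P N Phi (fun=> 0).
Proof.
have h0 : M1 P (fun=> 0 : 'rV[R]_n).
  apply/M1P; split=> //; first by move=> *; rewrite addr0.
  by exists 0 => A j _; rewrite mxE normr0.
split.
  apply/(M1sP hN); split => //; exists (fun=> set0); split => //; first by move=> k.
  have -> : P \o (fun=> set0) = cst 0%E :> (nat -> \bar R).
    by apply/funext => k /=; rewrite measure0.
  exact: cvg_cst.
apply: (@le_lt_trans _ _ 0%E); last exact: ltry.
apply: ge_ereal_sup => _ [u [Lu _] <-]; have [_ _ ->//] := mint_spec hN h0.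
by rewrite -(mint_bdd_vrestr h0 (@measurable0 _ T))// mint_bdd_vrestr0.
Qed.

(** * Integrands with [Phi a] integrable for every [a] *)

Section finite_integrand.
Hypothesis Phi_int : forall a : R, 0 < a -> P.-integrable setT (Phi a).

Lemma Linfty_modular_lty u : Linfty P u -> (E u < +oo)%E.
Proof.
move=> Lu; have [M M0 hM] := Linfty_norm_fin hN Lu.
have M1 : 0 < M + 1 by rewrite ltr_wpDl.
have i := Phi_int M1; apply: (@le_lt_trans _ _ (\int[P]_w Phi (M + 1) w)%E); last first.
  exact: (integrable_lty measurableT i).
apply: ae_ge0_le_integral => //; try by [exact: mE (mI Lu)|move=> *; exact: hull_ge0].
  exact: measurable_int i.
apply: filterS (Linfty_norm_ae hN hM) => w hw _.
apply: (@le_trans _ _ (Phi (N (u w)) w)); first exact: hull_le.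
apply: le_Phi => //.
  exact: (vnorm_ge0 hN).
by apply: (le_trans hw); rewrite lerDl.
Qed.

Lemma Ms_eq0 : Ms P N Phi = [set (fun=> 0)].
Proof.
apply/seteqP; split=> [m hMs|_ ->]; last exact: Ms0.
have [[hm _] soo] := hMs; have [ml _ mb] := mint_spec hN hm; have [mL _] := mint_orlicz hMs.
have := sigma_ge0 hm; move: soo; case Es : (sigma _ _ _ _) => [s| |] // _; rewrite lee_fin => s0.
have le0 u : Linfty P u -> mint P N m u <= 0.
  move=> Lu; rewrite leNgt; apply/negP => x0; set x := mint P N m u in x0.
  (* The multiple of [u] is chosen to have integral [s + 1], above the supremum. *)
  have := mint_le_sigma_Linfty hm (LinftyZ hN ((s + 1) / x) Lu)
    (Linfty_modular_lty (LinftyZ hN _ Lu)).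
  rewrite Es lee_fin (linear_onZ mL (seminorm_on0 sL)); last exact: ILP.
  by rewrite divfK ?gt_eqF//; lra.
apply/funext => A; have [mA|nA] := pselect (measurable A); last first.
  by have /M1P[-> //] := hm.
apply/rowP => j; rewrite [RHS]mxE -mint_bdd_delta//.
have LA : Linfty P (vrestr A (fun=> delta_mx 0 j : 'rV[R]_n)).
  exact: (Linfty_vrestr hN mA (Linfty_cst P hN _)).
rewrite -mb//; apply/le_anti; rewrite le0//=.
have := le0 _ (LinftyZ hN (-1) LA); rewrite (linear_onZ mL (seminorm_on0 sL)); last exact: ILP.
by rewrite mulN1r oppr_le0.
Qed.

Lemma heart_morse : MPhi = morse_heart P N Phi.
Proof.
apply/seteqP; split=> u.
  move=> [Lu hu]; split=> [|b b0]; first exact: orlicz_L1 Lu.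
  (* One factor 2 is spent on passing from the hull back to [Phi], the other on writing [u] as the
     sum of [u - v] and [v] by convexity. *)
  have b40 : 0 < b / 4 by rewrite divr_gt0.
  have [v Lv uv] := hu _ b40; have mu := orlicz_measurable Lu; have mv := mI Lv.
  rewrite Efun_div//; set h : R := 2^-1; have h01 : 0 <= h < 1 by rewrite /h; lra.
  rewrite [b^-1 *: u](_ : _ = h *: ((2 / b) *: u)); last first.
    by rewrite scalerA /h mulrA mulVf ?mul1r.
  apply: le_lt_trans (Efun_scale_le_modular hN Phi_ge0 Phi_convex Phi_sym Phi0 _ h01) _.
  rewrite [(2 / b) *: u](_ : _ = h *: ((b / 4)^-1 *: (u - v)) + (1 - h) *: ((b / 4)^-1 *: v)).
    have h01' : 0 <= h <= 1 by rewrite /h; lra.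
    have mw1 := measurable_vecZ (b / 4)^-1 (measurable_vecB mu mv).
    have mw2 := measurable_vecZ (b / 4)^-1 mv.
    apply: le_lt_trans (modular_convex hN Phi_ge0 Phi_convex Phi_sym Phi0 mw1 mw2 h01') _.
    have /luxemburg_leP := ltW uv.
    move=> /(_ hN Phi_ge0 Phi_convex Phi_sym Phi0 (measurable_vecB mu mv) b40) h1.
    apply: (@le_lt_trans _ _ (h%:E * 1 + (1 - h)%:E * E ((b / 4)^-1 *: v)%R)%E).
      by rewrite leeD2r// lee_wpmul2l// lee_fin; case/andP: h01.
    have := Linfty_modular_lty (LinftyZ hN (b / 4)^-1 Lv); have := E0 ((b / 4)^-1 *: v).
    by case: (E _) => [e| |] // _ _; rewrite -!EFinM -EFinD ltry.
  have -> : 1 - h = h by rewrite /h; field.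
  rewrite -scalerDr -scalerDr subrK !scalerA; congr (_ *: _); rewrite /h; field.
  by rewrite gt_eqF.
move=> [Lu hu]; have mu := L1_measurable Lu.
have Eu b : 0 < b -> (E (b^-1 *: u)%R < +oo)%E.
  by move=> b0; apply: le_lt_trans (hu _ b0); rewrite Efun_div//; exact: modular_le_Efun.
have LPu : LPhi u.
  split=> //; have := Eu 1 ltr01; rewrite invr1 scale1r => E1.
  apply: (le_lt_trans (modular_lt_luxemburg mu E1)).
  by rewrite lte_add_pinfty// ltry.
(* Truncation at height [k]: the sets [D k] decrease to the empty set, and as the modular of
   [(2 / e) u] is finite, that of its restriction to [D k] tends to 0. *)
split=> // e e0; pose D k := [set w | k%:R < N (u w)].
have mD k : measurable (D k).
  rewrite -[D k]setTI (_ : D k = (N \o u) @^-1` `]k%:R, +oo[).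
    by apply: (measurable_vnorm hN mu).
  by apply/seteqP; split => w /=; rewrite in_itv/= andbT.
have decD k : D k.+1 `<=` D k.
  by move=> w; apply: le_lt_trans; rewrite ler_nat.
have DI : \bigcap_k D k = set0.
  apply/seteqP; split=> // w h; have := h (Num.truncn (N (u w))).+1 I.
  have := truncnS_gt (N (u w)); rewrite /D /=; lra.
have PD : P \o D @ \oo --> 0%E.
  rewrite -(measure0 P) -DI; apply: nonincreasing_cvg_mu => //.
  - exact: (le_lt_trans (probability_le1 P (mD 0%N)) (ltry 1)).
  - exact: bigcapT_measurable.
  - by apply/nonincreasing_seqP => k; apply/subsetPset.
have e20 : 0 < e / 2 by rewrite divr_gt0.
have cm := modular_vrestr_cvg0 mD decD PD (measurable_vecZ (e / 2)^-1 mu) (Eu _ e20).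
have h2 : \forall k \near \oo, (E (vrestr (D k) ((e / 2)^-1 *: u)) < 1)%E.
  by apply: (cvge_near_lt cm); rewrite lte01.
have [k hk] := @filter_ex _ \oo _ _ h2.
have mDC : measurable (~` D k) by exact: measurableC.
exists (vrestr (~` D k) u).
  apply/(LinftyP P hN); split; first exact: measurable_vrestr.
  exists k%:R; apply: aeW => w; have [Dw|Dw] := pselect ((~` D k) w).
    by rewrite vrestr_in// leNgt; apply/negP.
  by rewrite vrestr_notin// (vnorm0 hN).
have -> : u - vrestr (~` D k) u = vrestr (D k) u.
  by apply/eqP; rewrite subr_eq vrestrDC.
apply: (@le_lt_trans _ _ (e / 2)%:E); last by rewrite lte_fin; lra.
apply/(LP (measurable_vrestr (mD k) mu) e20).
apply: ltW; rewrite [X in E X](_ : _ = vrestr (D k) ((e / 2)^-1 *: u))//.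
by apply/funext => w; rewrite !fctE /vrestr !scalerA mulrC.
Qed.

(** A vector of finite norm has a positive multiple in [dom_E]; the cone property then reaches all
    positive multiples, which is what the Morse heart asks for. *)
Lemma cone_heart : is_cone (dom_E P N Phi) -> LPhi = MPhi.
Proof.
move=> cone; apply/seteqP; split; last by move=> u [].
rewrite heart_morse => u [Lu /ereal_inf_lt[_ [c [c0 hc] <-] _]]; split=> // b b0.
have Dc : dom_E P N Phi (c^-1 *: u).
  split; last by rewrite -Efun_div//; exact: le_lt_trans hc (ltry 1).
  rewrite -[c^-1 *: u]addr0; apply: L1ZD => //.
  exact: (L1_0 hN).
have cb : 0 < c / b by rewrite divr_gt0.
have [_] := cone _ _ cb Dc; rewrite scalerA Efun_div//.
by have -> : c / b / c = b^-1 by field; rewrite !gt_eqF.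
Qed.

End finite_integrand.

End orlicz_duality.

Theorem mainTheorem4 (d : measure_display) (T : measurableType d) (R : realType)
  (P : probability T R) (n : nat) (n_ge1 : (1 <= n)%N)
  (N : 'rV[R]_n -> R) (N_norm : is_norm N)
  (Phi : R -> T -> \bar R)
  (Phi_ge0 : forall xi w, (0 <= Phi xi w)%E)
  (Phi_neq0 : exists xi w, Phi xi w <> 0%E)
  (Phi_convex : random_convex Phi)
  (Phi_sym : forall xi w, Phi (- xi) w = Phi xi w)
  (Phi0 : forall w, Phi 0 w = 0%E)
  (Phi_L1 : exists2 a : R, 0 < a &
     P.-integrable setT (Phi a) /\ P.-integrable setT (conjugate Phi a)) :
  let LPhi := orlicz P N Phi in
  let normPhi := luxemburg P N Phi in
  let LPhistar := orlicz_conj P N Phi in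
  let MPhi := orlicz_heart P N Phi in
  let perp := annihilator LPhi normPhi (Linfty P) in
  is_banach P LPhi normPhi
  /\
  [/\ forall y u, LPhistar y -> LPhi u ->
        (fun w => dotp (u w) (y w)) \in Lfun P 1%E
    & forall m u, Ms P N Phi m -> LPhi u -> dom_rho P N m u]
  /\
  (forall y m w, LPhistar y -> Ms P N Phi m -> perp w ->
     dual_space LPhi normPhi (fun u => ypair P N y m u + w u))
  /\
  (forall l, dual_space LPhi normPhi l ->
     exists y m w,
       [/\ LPhistar y, Ms P N Phi m, perp w,
           forall u, LPhi u -> l u = ypair P N y m u + w u
         & forall y' m' w', LPhistar y' -> Ms P N Phi m' -> perp w' ->
             (forall u, LPhi u -> l u = ypair P N y' m' u + w' u) ->
             [/\ ae_eq_vec P y' y, m' = m & forall u, LPhi u -> w' u = w u]])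
  /\
  (forall y m, LPhistar y -> Ms P N Phi m ->
     dual_norm LPhi normPhi (ypair P N y m) =
       ereal_sup [set (ypair P N y m u)%:E | u in
         [set u | Linfty P u /\ (Efun P Phi (N \o u) <= 1)%E]]
     /\
     dual_norm LPhi normPhi (ypair P N y m) =
       (ereal_inf [set b%:E *
            Efun P (conjugate Phi) (fun w => dual_vnorm N (y w) / b)%R + b%:E
          | b in [set b : R | (0 < b)%R]]
        + sigma P N Phi m)%E)
  /\
  (forall y, LPhistar y ->
     (luxemburg_conj P N Phi y <= dual_norm LPhi normPhi (Edot P y))%E /\
     (dual_norm LPhi normPhi (Edot P y) <= 2%:E * luxemburg_conj P N Phi y)%E)
  /\
  (forall y m, LPhistar y -> Ms P N Phi m ->
     dual_space MPhi normPhi (ypair P N y m))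
  /\
  (forall l, dual_space MPhi normPhi l ->
     exists y m,
       [/\ LPhistar y, Ms P N Phi m,
           forall u, MPhi u -> l u = ypair P N y m u
         & forall y' m', LPhistar y' -> Ms P N Phi m' ->
             (forall u, MPhi u -> l u = ypair P N y' m' u) ->
             ae_eq_vec P y' y /\ m' = m])
  /\
  ((forall a : R, 0 < a -> P.-integrable setT (Phi a)) ->
     [/\ Ms P N Phi = [set (fun=> 0)],
         MPhi = morse_heart P N Phi
       & is_cone (dom_E P N Phi) -> LPhi = MPhi]).
Proof.
split; first exact: orlicz_banach.
split.
  split=> [y u Ly Lu|m u]; last exact: orlicz_dom_rho.
  apply/Lfun1_integrable.
  exact: (orlicz_conj_integrable N_norm Phi_ge0 Phi_convex Phi_sym Phi0 Phi_L1 Ly Lu).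
split; first by move=> *; exact: orlicz_dual_mem.
split; first by move=> *; exact: orlicz_dual_representation.
split; first by move=> *; exact: dual_normE.
split; first by move=> *; exact: luxemburg_conj_bounds.
split; first by move=> *; exact: heart_dual_mem.
split; first by move=> *; exact: heart_dual_representation.
move=> Phi_int; split; [exact: Ms_eq0|exact: heart_morse|exact: cone_heart].
Qed.
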